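(* Let $q\ge 7$ be an odd prime power, $\Sigma_\infty$ a hyperplane of $\mathrm{PG}(4,q)$, and let $\mathcal C$ be a set of $q^2$ affine points together with a set of affine planes ($\mathcal C$-planes) satisfying: (A1) each $\mathcal C$-plane meets $\mathcal C$ in a $q$-arc, and every plane meeting $\mathcal C$ in more than four points is a $\mathcal C$-plane; (A2) any two distinct points of $\mathcal C$ lie in exactly one $\mathcal C$-plane; (A3) each affine point is either in $\mathcal C$, or on no $\mathcal C$-plane, or on exactly two $\mathcal C$-planes. Let $\mathcal S=\{t_A: A\in\mathcal C\}\cup\{t_\infty\}$ and let $\mathcal S'$ be any spread of $\Sigma_\infty$ with $\mathcal S'\neq\mathcal S$. Then in the Bruck–Bose plane $\mathcal P(\mathcal S')$, the set of points corresponding to $\mathcal C$ is not an arc.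
   Context: Affine points/lines/planes are those not contained in $\Sigma_\infty$. A $k$-arc (arc) is a set of points of a plane, no three collinear. For a $\mathcal C$-plane $\pi$, the $q$-arc $\pi\cap\mathcal C$ lies ($q$ odd) in a unique conic $(\pi\cap\mathcal C)\cup\{\pi_\infty\}$ of $\pi$; $\pi_\infty$ is the $\infty$-point of $\pi$, and an $\infty$-point is the $\infty$-point of some $\mathcal C$-plane. The $\mathcal C$-line of $\pi$ is $\pi\cap\Sigma_\infty$; a $0$-point is a point of $\Sigma_\infty$ on no $\mathcal C$-line. The set of all $\infty$-points and $0$-points is a line $t_\infty$ of $\Sigma_\infty$. For $A\in\mathcal C$ and a $\mathcal C$-plane $\pi\ni A$, $A_\pi$ is the point where the tangent at $A$ in $\pi$ to the conic $(\pi\cap\mathcal C)\cup\{\pi_\infty\}$ meets $\Sigma_\infty$; $t_A$ is the set of the $q+1$ points $A_\pi$ over the $q+1$ $\mathcal C$-planes $\pi\ni A$; each $t_A$ is a line and $\mathcal S$ is a spread of $\Sigma_\infty$. A spread of $\Sigma_\infty\cong\mathrm{PG}(3,q)$ is a set of $q^2+1$ pairwise disjoint lines covering all points. For a spread $\mathcal S'$, the Bruck–Bose plane $\mathcal P(\mathcal S')$ has as affine points the affine points of $\mathrm{PG}(4,q)$, as affine lines the affine planes meeting $\Sigma_\infty$ in a line of $\mathcal S'$, and a line at infinity whose points are the elements of $\mathcal S'$. *)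

(* Defs.v *)
From HB Require Import structures.
From mathcomp Require Import all_boot all_order all_algebra.

Set Implicit Arguments.
Unset Strict Implicit.
Unset Printing Implicit Defensive.

Import GRing.Theory.
Local Open Scope ring_scope.

(* [{vspace vT}] is a subtype of a matrix type, hence finite over a finite
   field; this is not declared in vector.v, which hides the encoding. *)
Section VspaceFinite.
Import VectorInternalTheory.

HB.instance Definition _ (F : finFieldType) (vT : vectType F) :=
  [Countable of {vspace vT} by <:].
HB.instance Definition _ (F : finFieldType) (vT : vectType F) :=
  [Finite of {vspace vT} by <:].

End VspaceFinite.

(* The subspaces of PG(4,q) are the vector subspaces of F^5, with vector
   dimension one more than projective dimension; incidence is inclusion. *)
Definition subspace (F : finFieldType) := {vspace 'rV[F]_5}.

Definition is_point (F : finFieldType) (U : subspace F) := \dim U == 1%N.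
Definition is_line (F : finFieldType) (U : subspace F) := \dim U == 2%N.
Definition is_plane (F : finFieldType) (U : subspace F) := \dim U == 3%N.
Definition is_hyperplane (F : finFieldType) (U : subspace F) := \dim U == 4%N.

Definition points_of (F : finFieldType) (U : subspace F) : {set subspace F} :=
  [set P : subspace F | is_point P && (P <= U)%VS].

Definition affine (F : finFieldType) (Sigma U : subspace F) := ~~ (U <= Sigma)%VS.

Definition affine_points (F : finFieldType) (Sigma : subspace F) :
    {set subspace F} :=
  [set P : subspace F | is_point P && affine Sigma P].

Definition affine_planes (F : finFieldType) (Sigma : subspace F) :
    {set subspace F} :=
  [set p : subspace F | is_plane p && affine Sigma p].

(* Lines are given as sets of points, so that the same notion of arc serves
   for planes of PG(4,q) and for the Bruck-Bose planes. *)
Definition is_arc (T : finType) (L : {set {set T}}) (K : {set T}) : Prop :=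
  forall X : {set T}, X \subset K -> #|X| = 3%N ->
  forall l : {set T}, l \in L -> ~~ (X \subset l).

Definition pg_lines (F : finFieldType) : {set {set subspace F}} :=
  [set points_of l | l : subspace F & is_line l].

Definition is_plane_arc (F : finFieldType) (k : nat) (p : subspace F)
    (K : {set subspace F}) : Prop :=
  [/\ K \subset points_of p, #|K| = k & is_arc (pg_lines F) K].

(* Every quadratic form on a subspace of F^5 is the restriction of a form
   v |-> v M v^T.  It is nonsingular on a plane p when it has no nonzero
   singular vector there lying in the radical of its polar form, whose matrix
   is M + M^T. *)
Definition qform (F : finFieldType) (M : 'M[F]_5) (v : 'rV[F]_5) : F :=
  (v *m M *m v^T) 0 0.

Definition polar (F : finFieldType) (M : 'M[F]_5) (v w : 'rV[F]_5) : F :=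
  (v *m (M + M^T) *m w^T) 0 0.

Definition nonsingular_on (F : finFieldType) (M : 'M[F]_5) (p : subspace F) :=
  [forall v : 'rV[F]_5,
     [&& v \in p, qform M v == 0
       & [forall w : 'rV[F]_5, (w \in p) ==> (polar M v w == 0)]]
     ==> (v == 0)].

Definition is_conic (F : finFieldType) (p : subspace F)
    (K : {set subspace F}) : bool :=
  [exists M : 'M[F]_5, nonsingular_on M p &&
     (K == [set P in points_of p |
              [forall v : 'rV[F]_5, (v \in P) ==> (qform M v == 0)]])].

Definition is_tangent (F : finFieldType) (p : subspace F)
    (K : {set subspace F}) (A l : subspace F) : bool :=
  [&& is_line l, (l <= p)%VS & points_of l :&: K == [set A]].

Section CPlanes.

Variables (F : finFieldType) (Sigma : subspace F).
(* [C] is the point set and [CP] the set of C-planes *)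
Variables (C CP : {set subspace F}).

Definition plane_section (p : subspace F) : {set subspace F} := points_of p :&: C.

Definition is_infty_point_of (p N : subspace F) : bool :=
  is_conic p (N |: plane_section p).

Definition infty_points : {set subspace F} :=
  [set N : subspace F | [exists p in CP, is_infty_point_of p N]].

Definition zero_points : {set subspace F} :=
  [set P in points_of Sigma | [forall p in CP, ~~ (P <= p :&: Sigma)%VS]].

Definition t_infty : {set subspace F} := infty_points :|: zero_points.

(* [X] is the point A_p *)
Definition is_tangent_trace (A p X : subspace F) : bool :=
  [exists N : subspace F, exists l : subspace F,
     [&& is_infty_point_of p N,
         is_tangent p (N |: plane_section p) A l
       & X == (l :&: Sigma)%VS]].

Definition t_at (A : subspace F) : {set subspace F} :=
  [set X : subspace F | [exists p in CP, (A <= p)%VS && is_tangent_trace A p X]].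

Definition C_spread : {set {set subspace F}} := t_infty |: [set t_at A | A in C].

End CPlanes.

Definition is_spread (F : finFieldType) (Sigma : subspace F)
    (S : {set subspace F}) : Prop :=
  [/\ #|S| = (#|F| ^ 2).+1,
      {in S, forall l : subspace F, is_line l && (l <= Sigma)%VS},
      {in S &, forall l m : subspace F,
         l != m -> [disjoint points_of l & points_of m]}
    & {in points_of Sigma, forall P : subspace F,
         exists2 l : subspace F, l \in S & (P <= l)%VS}].

(* Points of the Bruck-Bose plane: [inl P] is an affine point of PG(4,q),
   [inr l] an element of the spread. *)
Definition bb_point (F : finFieldType) : finType :=
  (subspace F + subspace F)%type.

Definition bb_line_infty (F : finFieldType) (S : {set subspace F}) :
    {set bb_point F} :=
  [set inr l | l in S].

Definition bb_affine_line (F : finFieldType) (Sigma p : subspace F) :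
    {set bb_point F} :=
  inr (p :&: Sigma)%VS
    |: [set inl P | P in points_of p :&: affine_points Sigma].

Definition bb_lines (F : finFieldType) (Sigma : subspace F)
    (S : {set subspace F}) : {set {set bb_point F}} :=
  bb_line_infty S
    |: [set bb_affine_line Sigma p
       | p in affine_planes Sigma & (p :&: Sigma)%VS \in S].

Definition bb_image (F : finFieldType) (C : {set subspace F}) :
    {set bb_point F} :=
  [set inl P | P in C].

(* Main.v *)
From HB Require Import structures.
Require Import Defs.
From mathcomp Require Import all_boot all_order all_fingroup all_algebra cyclic.
From mathcomp Require Import zify ring.

(* Fix a linear form phi with kernel Sigma, so that the affine points are the vectors with
   phi = 1.  With the C-planes as lines, C is an affine plane of order q.  Counting the
   affine points of a C-plane p outside C shows, by (A3), that at least q - 1 other C-planes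
   meet p in an affine line; these lines are concurrent in a point of Sigma, and the C-planes
   which cross p in this way belong to one parallel class.  Hence there are two parallel
   classes all of whose members pass through one point n of Sigma.  Modulo n they rule the
   surface z = s t, so C = {O + s e1 + t e2 + s t e3 + h(s,t) n}; every other C-plane lies
   over a line of the (s,t)-plane, which makes h quadratic along almost all lines, hence
   quadratic.  After a change of basis h = a s^2 + b t^2 with a d^2 - b e^2 anisotropic, and
   all the conics are explicit: t_infty is the line <e3, n>, and t_A is the line of the
   tangent directions (d, e) at A.

   Let C be an arc in P(S').  A line of S' disjoint from t_infty is the graph of a linear
   map, and it must be some t_A, as otherwise a translate of it contains two chords of C with
   a common end point.  If t_infty were not in S', then a line of S' meeting t_infty would
   meet t_A and t_A' for some A <> A' with t_A and t_A' not in S'.  For a = A' - A, the points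
   of t_A and t_A' in direction a would lie on lines of S' meeting t_infty; these two lines
   coincide, and a translate of the common line contains three points of C. *)

Set Implicit Arguments.
Unset Strict Implicit.
Unset Printing Implicit Defensive.

(** One principle drives the geometric half: by (A3) an affine point on three C-planes lies in [C],
    while by (A2) two C-planes share at most one point of [C]. Hence three C-planes never share an
    affine line. If two of the lines cut on [p] met in an affine point, that point would be in [C]
    and all the other lines would pass through it; too many directions at that point result, so only
    concurrency in Sigma remains. (A3) is used again for the anisotropy: if [b * m ^ 2 = a], the
    midpoint of two points of one C-plane would be an affine point outside [C] on no second C-plane.
    In the final model, [C] over a line of direction [(d, e)] is a parabola [A + k D + k ^ 2 E]: [E]
    is the point at infinity of the conic, [D] the tangent direction at [A], and a chord has the
    tangent direction at the point whose parameters are the midpoint of those of its ends. This last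
    fact produces the chords that contradict the arc property. The bound on [q] serves the counts
    and makes polynomials of degree at most 4 that vanish on the whole field trivial. *)

Lemma double_count (I J : finType) (A : {set I}) (B : {set J}) (r : I -> J -> bool) :
  \sum_(i in A) #|[set j in B | r i j]| = \sum_(j in B) #|[set i in A | r i j]|.
Proof.
have S (K : finType) (D : {set K}) (P : pred K) :
  #|[set k in D | P k]| = \sum_(k in D) P k.
  rewrite -sum1_card big_mkcond [RHS]big_mkcond; apply: eq_bigr => k _.
  by rewrite inE; case: (k \in D) => //=; case: (P k).
under eq_bigr do rewrite S.
under [RHS]eq_bigr do rewrite S.
exact: exchange_big.
Qed.

(** Each predicate excludes at most one element of [X], so filtering them out one after the other
    leaves something. It serves to pick a C-plane through a point that avoids finitely many bad
    positions. *)
Lemma exists_avoiding_all (I : eqType) (X : seq I) (s : seq (pred I)) :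
  uniq X -> (size s < size X)%N ->
  (forall i x y, (i < size s)%N -> x \in X -> y \in X ->
     nth xpred0 s i x -> nth xpred0 s i y -> x = y) ->
  exists2 x, x \in X & all (fun P : pred I => ~~ P x) s.
Proof.
elim: s X => [|P s IHs] X uX ltX H.
  by case: X ltX {uX H} => // x X _; exists x; rewrite ?inE ?eqxx.
have lt : (size s < size (filter (predC P) X))%N.
  have := count_predC P X; rewrite [size (filter _ _)]size_filter.
  suff : (count P X <= 1)%N by move: ltX => /=; lia.
  rewrite -size_filter leqNgt; apply/negP => lt1.
  have uY := filter_uniq P uX.
  case E : (filter P X) lt1 uY => [|x [|y Y]] // _ /=.
  have : x \in filter P X by rewrite E inE eqxx.
  have : y \in filter P X by rewrite E !inE eqxx orbT.
  rewrite !mem_filter => /andP[Py yX] /andP[Px xX].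
  by rewrite (H 0%N x y isT xX yX Px Py) inE eqxx.
have [|y] := IHs _ (filter_uniq _ uX) lt.
  by move=> i x y lti; rewrite !mem_filter => /andP[_ xX] /andP[_ yX]; apply: (H i.+1).
by rewrite mem_filter => /andP[/= nP yX] ys; exists y; rewrite //= nP.
Qed.

(** * Finite affine planes *)

Section AffinePlane.

Variables (T I : finType) (C : {set T}) (B : {set I}) (sec : I -> {set T}) (q : nat).
Hypotheses (q_gt0 : (0 < q)%N) (cardC : #|C| = (q ^ 2)%N).
Hypothesis sec_sub : forall p, p \in B -> sec p \subset C.
Hypothesis card_sec : forall p, p \in B -> #|sec p| = q.
Hypothesis blockP : forall a b, a \in C -> b \in C -> a != b ->
  exists2 p, p \in B & (a \in sec p) && (b \in sec p).
Hypothesis block_uniq : forall p r a b, p \in B -> r \in B -> a != b ->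
  a \in sec p -> b \in sec p -> a \in sec r -> b \in sec r -> p = r.

Definition parallel p r := (p == r) || [disjoint sec p & sec r].

Lemma card_blocks2 a b : a \in C -> b \in C -> a != b ->
  #|[set p in B | (a \in sec p) && (b \in sec p)]| = 1%N.
Proof.
move=> aC bC ab; have [p pB /andP[ap bp]] := blockP aC bC ab.
apply/eqP/cards1P; exists p; apply/setP => r; rewrite !inE.
apply/idP/eqP => [/and3P[rB ar br] | ->]; last by rewrite pB ap.
exact: block_uniq ab ar br ap bp.
Qed.

Lemma card_secI p r : p \in B -> r \in B -> p != r -> (#|sec p :&: sec r| <= 1)%N.
Proof.
move=> pB rB; apply: contraR; rewrite -ltnNge => /card_gt1P[a [b []]].
by move=> /setIP[ap ar] /setIP[bp br] ab; apply/eqP; apply: block_uniq ab ap bp ar br.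
Qed.

(** Counting the pairs of a block through [a] and a further point on it gives
    [x * (q - 1) = q ^ 2 - 1], since each further point is on exactly one such block. *)
Lemma card_blocks1 a : (1 < q)%N -> a \in C -> #|[set p in B | a \in sec p]| = q.+1.
Proof.
move=> q_gt1 aC; pose Ba := [set p in B | a \in sec p].
have := double_count Ba (C :\ a) (fun p b => b \in sec p).
under eq_bigr => p /[1!inE] /andP[pB ap].
  have -> : [set b in C :\ a | b \in sec p] = sec p :\ a.
    apply/setP=> b; rewrite !inE; case: eqP => //= _.
    by case: (boolP (b \in sec p)); rewrite ?andbF ?andbT // => /(subsetP (sec_sub pB)).
  have -> : #|sec p :\ a| = q.-1 by have := cardsD1 a (sec p); rewrite ap card_sec // => ->.
  over.
rewrite sum_nat_const.
under eq_bigr => b /[!inE] /andP[ba bC].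
  have -> : #|[set p in Ba | b \in sec p]| = 1%N.
    rewrite -(card_blocks2 bC aC ba); apply: eq_card => p.
    by rewrite !inE -andbA [(b \in _) && _]andbC.
  over.
rewrite sum1_card; have := cardsD1 a C; rewrite aC cardC => /eqP.
rewrite -/Ba; move: #|Ba| #|_ :\ a| => x y; rewrite -mulnn.
case: (q) q_gt1 => [|[|k]] //= _; nia.
Qed.

(** The [q] points of [sec p] are joined to [a] by different blocks, since a block through [a] meets
    [sec p] at most once. They use up [q] of the [q + 1] blocks through [a]; one is left. *)
Lemma playfair p a : (1 < q)%N -> p \in B -> a \in C -> a \notin sec p ->
  #|[set r in B | (a \in sec r) && [disjoint sec p & sec r]]| = 1%N.
Proof.
move=> q_gt1 pB aC ap; pose Ba := [set r in B | a \in sec r].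
have := double_count Ba (sec p) (fun r b => b \in sec r).
under [in RHS]eq_bigr => b bp.
  have bC := subsetP (sec_sub pB) _ bp.
  have ab : a != b by apply: contraNneq ap => ->.
  have -> : #|[set r in Ba | b \in sec r]| = 1%N.
    rewrite -(card_blocks2 aC bC ab); apply: eq_card => r.
    by rewrite !inE -andbA.
  over.
rewrite sum1_card card_sec // => sumE.
have : \sum_(r in Ba) (#|[set b in sec p | b \in sec r]| + [disjoint sec p & sec r]) = q.+1.
  rewrite -(card_blocks1 q_gt1 aC) -sum1_card; apply: eq_bigr => r /[1!inE] /andP[rB ar].
  have pr : p != r by apply: contraNneq ap => ->.
  have := card_secI pB rB pr; rewrite -setI_eq0 -cards_eq0.
  have -> : [set b in sec p | b \in sec r] = sec p :&: sec r by apply/setP=> b; rewrite !inE.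
  by case: #|_| => [|[|]].
rewrite big_split /= sumE => /eqP; rewrite -addn1 eqn_add2l => /eqP dE.
apply: etrans dE; rewrite -sum1_card [RHS]big_mkcond [LHS]big_mkcond.
apply: eq_bigr => r _; by rewrite !inE; case: (r \in B) => //=; case: (a \in _) => //=; case: [disjoint _ & _].
Qed.

Lemma parallel_refl p : parallel p p. Proof. by rewrite /parallel eqxx. Qed.

Lemma parallel_sym p r : parallel p r = parallel r p.
Proof. by rewrite /parallel eq_sym disjoint_sym. Qed.

Lemma parallelPn p r : p \in B -> r \in B -> ~~ parallel p r ->
  exists a, [/\ a \in C, a \in sec p & a \in sec r].
Proof.
move=> pB rB; rewrite negb_or => /andP[_]; rewrite -setI_eq0 => /set0Pn[a /setIP[ap ar]].
by exists a; split=> //; apply: (subsetP (sec_sub pB)).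
Qed.

Lemma parallel_meet p r a : parallel p r -> a \in sec p -> a \in sec r -> p = r.
Proof.
case/orP => [/eqP // | /pred0P d ap ar].
by have /= := d a; rewrite ap ar.
Qed.

Lemma parallel_uniq p r r' a : (1 < q)%N -> p \in B -> r \in B -> r' \in B ->
  parallel p r -> parallel p r' -> a \in sec r -> a \in sec r' -> r = r'.
Proof.
move=> q_gt1 pB rB r'B pr pr' ar ar'.
have aC : a \in C by apply: (subsetP (sec_sub rB)).
have [ap | ap] := boolP (a \in sec p).
  by rewrite -(parallel_meet pr ap ar) (parallel_meet pr' ap ar').
have/eqP/cards1P[x xE] := playfair q_gt1 pB aC ap.
have aux s : s \in B -> parallel p s -> a \in sec s -> s = x.
  move=> sB /orP[/eqP e | d] as_; first by rewrite -e (negPf ap) in as_.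
  by apply/set1P; rewrite -xE inE sB as_.
by rewrite (aux r) // (aux r').
Qed.

Lemma parallel_trans p r s : (1 < q)%N -> p \in B -> r \in B -> s \in B ->
  parallel p r -> parallel p s -> parallel r s.
Proof.
move=> q_gt1 pB rB sB pr ps; have [//|nrs] := boolP (parallel r s); have [a [_ ar as_]] := parallelPn rB sB nrs.
by case/negP: nrs; rewrite (parallel_uniq q_gt1 pB rB sB pr ps ar as_) parallel_refl.
Qed.

Lemma parallel_through p a : (1 < q)%N -> p \in B -> a \in C ->
  exists r, [/\ r \in B, parallel p r & a \in sec r].
Proof.
move=> q_gt1 pB aC; have [ap | ap] := boolP (a \in sec p).
  by exists p; split=> //; apply: parallel_refl.
have/eqP/cards1P[r /setP/(_ r)] := playfair q_gt1 pB aC ap.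
by rewrite !inE eqxx => /and3P[rB ar d]; exists r; split=> //; apply/orP; right.
Qed.

(** By [parallel_uniq] the members of a class are disjoint sets of [q] points inside a set of
    [q ^ 2]. *)
Lemma card_parallel p : (1 < q)%N -> p \in B ->
  (#|[set r in B | parallel p r]| <= q)%N.
Proof.
move=> q_gt1 pB.
have := double_count [set r in B | parallel p r] C (fun r a => a \in sec r).
under eq_bigr => r /[1!inE] /andP[rB pr].
  have -> : [set a in C | a \in sec r] = sec r.
    apply/setP=> b; rewrite !inE.
    by case: (boolP (b \in sec r)); rewrite ?andbF ?andbT // => /(subsetP (sec_sub rB)).
  rewrite card_sec //; over.
rewrite sum_nat_const => sumE.
rewrite -(leq_pmul2r q_gt0) sumE mulnn -cardC -sum1_card leq_sum // => a aC.
rewrite leqNgt; apply/negP => /card_gt1P[r [s []]]; rewrite !inE.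
move=> /andP[/andP[rB pr] ar] /andP[/andP[sB ps] as_] /eqP; apply.
exact: (parallel_uniq q_gt1 pB rB sB pr ps ar as_).
Qed.

End AffinePlane.

Import GRing.Theory.
Local Open Scope ring_scope.

(** * C-planes in vector coordinates *)

Section VspaceTools.

Variables (F : finFieldType) (m : nat).
Local Notation W := 'rV[F]_m.
Implicit Types (U V : {vspace W}) (v w n : W).

Lemma card_vspace_set U : #|[set v in U]| = (#|F| ^ \dim U)%N.
Proof.
pose f (x : 'rV[F]_(\dim U)) := \sum_i x 0 i *: (vbasis U)`_i.
have injf : injective f.
  move=> x y E; apply/rowP => i.
  have /freeP fr := basis_free (vbasisP U).
  have : \sum_(i < \dim U) (x 0 i - y 0 i) *: (vbasis U)`_i = 0.
    under eq_bigr do rewrite scalerBl.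
    by rewrite big_split /= sumrN -/(f x) -/(f y) E subrr.
  by move=> /(fr (fun i => x 0 i - y 0 i))/(_ i)/eqP; rewrite subr_eq0 => /eqP.
have -> : [set v in U] = f @: setT.
  apply/setP => v; rewrite inE; apply/idP/imsetP => [vU | [x _ ->]].
    exists (\row_i coord (vbasis U) i v) => //.
    rewrite {1}(coord_vbasis vU); by apply: eq_bigr => i _; rewrite mxE.
  by apply: memv_suml => i _; rewrite memvZ // vbasis_mem // mem_nth // size_tuple.
by rewrite card_imset // cardsT card_mx mul1n.
Qed.

Lemma dim_add_line U v : v \notin U -> \dim (U + <[v]>) = (\dim U).+1.
Proof.
move=> vU; have v0 : v != 0 by apply: contraNneq vU => ->; rewrite mem0v.
rewrite dimv_disjoint_sum ?dim_vline ?v0 ?addn1 //.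
apply/eqP; rewrite -subv0; apply/subvP => w /memv_capP[wU /vlineP[k wE]].
rewrite memv0 wE; have [-> | k0] := eqVneq k 0; first by rewrite scale0r.
case/negP: vU; have -> : v = k^-1 *: w by rewrite wE scalerA mulVf ?scale1r.
by rewrite memvZ.
Qed.

(** The form is a coordinate of the component [v - projV U v] along a complement of [U], chosen
    nonzero at [v] and rescaled. *)
Lemma separating_form U v : v \notin U ->
  exists f : 'Hom(W, F^o), (forall u, u \in U -> f u = 0) /\ f v = 1.
Proof.
move=> vU; 
have [w0 | w_neq0] := eqVneq (v - projv U v) 0.
  by case/negP: vU; move/eqP: w0; rewrite subr_eq0 => /eqP ->; apply: memv_proj.
set w := v - projv U v in w_neq0.
have [i wi] : exists i, w 0 i != 0.
  apply/existsP; apply: contraNT w_neq0; rewrite negb_exists => /forallP H.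
  by apply/eqP/rowP => i; have := H i; rewrite negbK [RHS]mxE => /eqP.
pose ff (u : W) : F^o := ((u - projv U u) 0 i) / (w 0 i).
have lin : linear ff.
  move=> k x y; rewrite /ff linearP /= !mxE.
  by rewrite -[k *: _]/(k * _) mulrA -mulrDl; congr (_ / _); ring.
pose ffl := GRing.isLinear.Build F W F^o *:%R ff lin.
pose fL : {linear W -> F^o} := HB.pack ff ffl.
exists (linfun fL); split=> [u uU|]; rewrite lfunE /= /ff.
  by rewrite projv_id // subrr mxE mul0r.
by rewrite divff.
Qed.

Lemma span2P U a b v : (\dim U <= 2)%N -> a \in U -> b \in U -> a != 0 ->
  b \notin <[a]>%VS -> v \in U -> exists x y, v = x *: a + y *: b.
Proof.
move=> dU aU bU a0 ba vU.
have UE : (<[a]> + <[b]>)%VS == U.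
  by rewrite eqEdim subv_add -!memvE aU bU /= dim_add_line // dim_vline a0.
move: vU; rewrite -(eqP UE) => /memv_addP[u /vlineP[x ->] [w /vlineP[y ->] ->]].
by exists x, y.
Qed.

Lemma span3P U a b c v : (\dim U <= 3)%N -> a \in U -> b \in U -> c \in U ->
  a != 0 -> b \notin <[a]>%VS -> c \notin (<[a]> + <[b]>)%VS -> v \in U ->
  exists x y z, v = x *: a + y *: b + z *: c.
Proof.
move=> dU aU bU cU a0 ba cab vU.
have UE : (<[a]> + <[b]> + <[c]>)%VS == U.
  by rewrite eqEdim !subv_add -!memvE aU bU cU /= !dim_add_line // dim_vline a0.
move: vU; rewrite -(eqP UE) => /memv_addP[w /memv_addP[u /vlineP[x ->]]].
by move=> [u' /vlineP[y ->] ->] [u'' /vlineP[z ->] ->]; exists x, y, z.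
Qed.

End VspaceTools.

(* C consists of the representatives with phi = 1 of the given affine points; conf_block and
   conf_uniq are (A2), conf_le2 and conf_ge2 are (A3). *)
Record configuration (F : finFieldType) (phi : 'Hom('rV[F]_5, F^o))
    (C : {set 'rV[F]_5}) (B : {set subspace F}) : Prop := Configuration {
  conf_odd : odd #|F|;
  conf_ge7 : (7 <= #|F|)%N;
  conf_aff : forall v, v \in C -> phi v = 1;
  conf_card : #|C| = (#|F| ^ 2)%N;
  conf_dim : forall p, p \in B -> \dim p = 3%N;
  conf_sec : forall p, p \in B -> #|[set v in C | v \in p]| = #|F|;
  conf_arc : forall p a b c, p \in B -> a \in C -> b \in C -> c \in C ->
    a \in p -> b \in p -> c \in p -> a != b -> c != a -> c != b ->
    c \notin (<[a]> + <[b]>)%VS;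
  conf_block : forall a b, a \in C -> b \in C -> a != b ->
    exists2 p, p \in B & (a \in p) && (b \in p);
  conf_uniq : forall p r a b, p \in B -> r \in B -> a \in C -> b \in C -> a != b ->
    a \in p -> b \in p -> a \in r -> b \in r -> p = r;
  conf_le2 : forall v p1 p2 p3, phi v = 1 -> v \notin C ->
    p1 \in B -> p2 \in B -> p3 \in B -> v \in p1 -> v \in p2 -> v \in p3 ->
    [\/ p1 = p2, p1 = p3 | p2 = p3];
  conf_ge2 : forall v p, phi v = 1 -> v \notin C -> p \in B -> v \in p ->
    exists2 r, r \in B & (r != p) && (v \in r)
}.

Section Configuration.

Variables (F : finFieldType) (phi : 'Hom('rV[F]_5, F^o)).
Variables (C : {set 'rV[F]_5}) (B : {set subspace F}).
Hypothesis conf : configuration phi C B.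

Local Notation q := #|F|.
Local Notation W := 'rV[F]_5.
Implicit Types (p r s U V : {vspace W}) (a b c n v : W).

Definition vsec p := [set v in C | v \in p].

Local Notation par := (parallel vsec).

Let q7 := conf_ge7 conf.

Lemma in_vsec p v : (v \in vsec p) = (v \in C) && (v \in p).
Proof. by rewrite inE. Qed.

Let q_gt0 : (0 < q)%N. Proof. exact: leq_trans q7. Qed.
Let q_gt1 : (1 < q)%N. Proof. exact: leq_trans q7. Qed.
Let cardC := conf_card conf.
Let sec_sub p : p \in B -> vsec p \subset C.
Proof. by move=> _; apply/subsetP => v; rewrite in_vsec => /andP[]. Qed.
Let card_sec : forall p, p \in B -> #|vsec p| = q := conf_sec conf.
Let blockP a b : a \in C -> b \in C -> a != b ->
  exists2 p, p \in B & (a \in vsec p) && (b \in vsec p).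
Proof.
move=> aC bC ab; have [p pB pab] := conf_block conf aC bC ab.
by exists p; rewrite // !in_vsec aC bC.
Qed.
Let block_uniq p r a b : p \in B -> r \in B -> a != b ->
  a \in vsec p -> b \in vsec p -> a \in vsec r -> b \in vsec r -> p = r.
Proof.
rewrite !in_vsec => pB rB ab /andP[aC ap] /andP[bC bp] /andP[_ ar] /andP[_ br].
exact: (conf_uniq conf pB rB aC bC ab ap bp ar br).
Qed.

Lemma par_trans p r s : p \in B -> r \in B -> s \in B -> par p r -> par p s -> par r s.
Proof. exact: (parallel_trans q_gt0 cardC sec_sub card_sec blockP block_uniq). Qed.

Lemma par_uniq p r s a : p \in B -> r \in B -> s \in B -> par p r -> par p s ->
  a \in C -> a \in r -> a \in s -> r = s.
Proof.
move=> pB rB sB pr ps aC ar as_.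
by apply: (parallel_uniq q_gt0 cardC sec_sub card_sec blockP block_uniq _ pB rB sB pr ps
  (a := a)); rewrite ?in_vsec ?aC.
Qed.

Lemma par_meet p r a : par p r -> a \in C -> a \in p -> a \in r -> p = r.
Proof. by move=> pr aC ap ar; apply: (parallel_meet pr (a := a)); rewrite in_vsec aC. Qed.

Lemma par_through p a : p \in B -> a \in C -> exists r, [/\ r \in B, par p r & a \in r].
Proof.
move=> pB aC.
have [r [rB pr]] := parallel_through q_gt0 cardC sec_sub card_sec blockP block_uniq q_gt1 pB aC.
by rewrite in_vsec aC => ar; exists r.
Qed.

Lemma npar_meet p r : p \in B -> r \in B -> ~~ par p r ->
  exists a, [/\ a \in C, a \in p & a \in r].
Proof.
move=> pB rB /(parallelPn sec_sub pB rB)[a [aC]].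
by rewrite !in_vsec aC => ap ar; exists a.
Qed.

Lemma card_class p : p \in B -> (#|[set r in B | par p r]| <= q)%N.
Proof. exact: (card_parallel q_gt0 cardC sec_sub card_sec blockP block_uniq). Qed.

Lemma card_through a : a \in C -> #|[set p in B | a \in p]| = q.+1.
Proof.
move=> aC; rewrite -(card_blocks1 q_gt0 cardC sec_sub card_sec blockP block_uniq q_gt1 aC).
by apply: eq_card => p; rewrite !inE aC.
Qed.

(** The form [phi] is onto on [U], so the vectors with [phi v = 1] are a coset of [U :&: lker phi],
    whose dimension is one less. *)
Lemma card_aff U a : a \in U -> phi a = 1 ->
  #|[set v in U | phi v == 1]| = (q ^ (\dim U).-1)%N.
Proof.
move=> aU pa.
have dK : \dim (U :&: lker phi) = (\dim U).-1.
  have := limg_ker_dim phi U; suff -> : \dim (phi @: U) = 1%N by rewrite addn1 => <-.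
  apply/eqP; rewrite eqn_leq; apply/andP; split.
    by apply: leq_trans (dimvS (subvf _)) _; rewrite dimvf.
  rewrite lt0n dimv_eq0; apply/eqP => E.
  have := memv_img phi aU; rewrite E memv0 pa; apply/negP; exact: oner_neq0.
rewrite -dK -card_vspace_set -[RHS](card_imset _ (addrI a)); apply: eq_card => v.
rewrite inE; apply/andP/imsetP => [[vU /eqP pv] | [w]].
  exists (v - a); last by rewrite addrC subrK.
  by rewrite inE memv_cap memv_ker memvB // linearB /= pv pa subrr.
rewrite inE memv_cap memv_ker => /andP[wU /eqP pw] ->.
by rewrite memvD // linearD /= pa pw addr0.
Qed.

End Configuration.

(** * C-planes meeting in an affine line *)

Section Adjacency.

Variables (F : finFieldType) (phi : 'Hom('rV[F]_5, F^o)).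
Variables (C : {set 'rV[F]_5}) (B : {set subspace F}).
Hypothesis conf : configuration phi C B.

Local Notation q := #|F|.
Local Notation W := 'rV[F]_5.
Implicit Types (p r s U V : {vspace W}) (a b c n v : W).
Local Notation par := (parallel (vsec C)).
Let q7 := conf_ge7 conf.
Let Caff := conf_aff conf.
Let Bdim := conf_dim conf.
Let q_gt0 : (0 < q)%N. Proof. exact: leq_trans q7. Qed.
Let q_gt1 : (1 < q)%N. Proof. exact: leq_trans q7. Qed.

Lemma block_pts p : p \in B -> exists a b,
  [/\ a \in C, b \in C, a \in p, b \in p & a != b].
Proof.
move=> pB; have : (1 < #|vsec C p|)%N by rewrite (conf_sec conf pB).
by move=> /card_gt1P[a [b []]]; rewrite !in_vsec => /andP[? ?] /andP[? ?] ?; exists a, b.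
Qed.

Lemma block_pts3 p : p \in B -> exists a b c,
  [/\ a \in C, b \in C & c \in C] /\ [/\ a \in p, b \in p & c \in p]
  /\ [/\ a != b, c != a & c != b].
Proof.
move=> pB; have : (2 < #|vsec C p|)%N by rewrite (conf_sec conf pB); apply: leq_trans q7.
move=> /card_gt2P[a [b [c [[]]]]]; rewrite !in_vsec => /andP[aC ap] /andP[bC bp] /andP[cC cp].
by move=> [ab bc ca]; exists a, b, c; rewrite [c == b]eq_sym.
Qed.

Lemma three_blocks v p r s : phi v = 1 -> p \in B -> r \in B -> s \in B ->
  v \in p -> v \in r -> v \in s -> p != r -> p != s -> r != s -> v \in C.
Proof.
move=> pv pB rB sB vp vr vs pr ps rs; apply: contraT => vC.
by case: (conf_le2 conf pv vC pB rB sB vp vr vs) => e; move: pr ps rs; rewrite e eqxx.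
Qed.

Lemma meet_uniq p r a b : p \in B -> r \in B -> p != r ->
  a \in C -> b \in C -> a \in p -> b \in p -> a \in r -> b \in r -> a = b.
Proof.
move=> pB rB pr aC bC ap bp ar br; apply/eqP; apply: contraNT pr => ab.
by apply/eqP; apply: (conf_uniq conf pB rB aC bC ab).
Qed.

Definition adjacent p : {set subspace F} :=
  [set r in B | [&& r != p, \dim (p :&: r)%VS == 2%N & ~~ (p :&: r <= lker phi)%VS]].

Lemma adjacentP p r : r \in adjacent p ->
  [/\ r \in B, r != p, \dim (p :&: r) = 2%N & exists a, [/\ a \in p, a \in r & phi a = 1]].
Proof.
rewrite inE => /and4P[rB rp /eqP d /subvPn[u /memv_capP[up ur]]]; rewrite memv_ker => u0.
split=> //; exists ((phi u)^-1 *: u); rewrite !memvZ //; split=> //.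
by rewrite linearZ /= -[_ *: _]/(_ * _) mulVf.
Qed.

Lemma line_adj p r a n v : r \in adjacent p -> phi a = 1 -> phi n = 0 -> n != 0 ->
  a \in p -> a \in r -> n \in p -> n \in r -> v \in p -> v \in r ->
  exists k, v = phi v *: a + k *: n.
Proof.
move=> /adjacentP[rB rp d _] pa pn n0 ap ar np nr vp vr.
have a0 : a != 0 by apply: contra_eq_neq pa => ->; rewrite linear0 eq_sym oner_neq0.
have na : n \notin <[a]>%VS.
  apply/negP => /vlineP[k nE]; move: pn; rewrite nE linearZ /= pa.
  rewrite -[_ *: _]/(_ * _) mulr1 => k0; by move: n0; rewrite nE k0 scale0r eqxx.
have [||||||x [y E]] := @span2P F _ (p :&: r)%VS a n v; rewrite ?memv_cap ?ap ?ar ?np ?nr ?vp ?vr ?d //.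
exists y; rewrite {2}E linearD !linearZ /= pa pn scaler0 addr0.
by rewrite -[_ *: 1]/(_ * _) mulr1.
Qed.

(** Count pairs of an affine point of [p] outside [C] and another C-plane through it. There are
    [q ^ 2 - q] such points, each on another C-plane; with [x] adjacent planes and at most [q - 1]
    other members of the parallel class, [q ^ 2 - q <= (q - 1) * x + (q - 1)]. *)
Lemma card_adjacent p : p \in B -> (q.-1 <= #|adjacent p|)%N.
Proof.
move=> pB; have [a [b [aC bC ap bp ab]]] := block_pts pB.
pose E := [set v in p | phi v == 1] :\: vsec C p.
have cE : #|E| = (q ^ 2 - q)%N.
  rewrite cardsD (card_aff ap (Caff aC)) Bdim //=; congr (_ - _)%N.
  rewrite -(conf_sec conf pB); apply: eq_card => v; rewrite !inE.
  by have [/Caff -> | _] := boolP (v \in C); rewrite ?eqxx ?andbT ?andbF ?andbb.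
pose B' := B :\ p.
have := double_count E B' (fun v r => v \in r).
have : (#|E| <= \sum_(v in E) #|[set r in B' | v \in r]|)%N.
  rewrite -sum1_card leq_sum // => v /[!inE] /and3P[vN vp /eqP pv].
  rewrite vp andbT in vN; have [r rB /andP[rp vr]] := conf_ge2 conf pv vN pB vp.
  by apply/card_gt0P; exists r; rewrite !inE rp rB vr.
move=> le1 sumE; rewrite {}sumE in le1.
(* An adjacent [r] shares [q] affine points with [p], any other [r] at most one; if [r] is not
   parallel to [p], one of the shared points is in [C] and is not counted. *)
have bound r : r \in B' ->
  (#|[set v in E | v \in r]| <= q.-1 * (r \in adjacent p) + par p r)%N.
  rewrite !inE => /andP[rp rB]; rewrite rB rp /=.
  have nopar : ~~ par p r -> exists c, [/\ c \in C, c \in p & c \in r].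
    exact: (npar_meet pB rB).
  have [d2 | ] := boolP ((_ == 2%N) && _).
    rewrite muln1; move: d2 => /andP[/eqP d2 /subvPn[u /memv_capP[up ur]]].
    rewrite memv_ker => u0; pose w := (phi u)^-1 *: u.
    have pw : phi w = 1 by rewrite linearZ /= -[_ *: _]/(_ * _) mulVf.
    have wI : w \in (p :&: r)%VS by rewrite memv_cap !memvZ.
    have cI := card_aff wI pw; rewrite d2 expn1 in cI.
    have [pr | /nopar[c [cC cp cr]]] := boolP (par p r).
      rewrite addn1 prednK // -cI; apply/subset_leq_card/subsetP => v.
      by rewrite !inE memv_cap => /andP[/and3P[_ -> ->] ->].
    rewrite addn0 -ltnS prednK // -cI; apply/proper_card/properP; split.
      apply/subsetP => v.
      by rewrite !inE memv_cap => /andP[/and3P[_ -> ->] ->].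
    by exists c; rewrite !inE ?memv_cap ?cp ?cr ?cC // Caff // eqxx.
  move=> nadj; rewrite muln0 add0n.
  have [-> | /set0Pn[v]] := eqVneq [set v in E | v \in r] set0; first by rewrite cards0.
  rewrite !inE => /andP[/and3P[vN vp /eqP pv] vr]; rewrite vp andbT in vN.
  have d1 : (\dim (p :&: r) <= 1)%N.
    have nk : ~~ (p :&: r <= lker phi)%VS.
      apply/subvPn; exists v; first by rewrite memv_cap vp.
      by rewrite memv_ker pv oner_neq0.
    rewrite nk andbT in nadj.
    have := dimvS (capvSl p r); rewrite (Bdim pB) => le3.
    suff : \dim (p :&: r) != 3%N by move: nadj le3; case: (\dim _) => [|[|[|[|]]]].
    apply: contraNneq rp => d3.
    have : (p :&: r == p)%VS by rewrite eqEdim capvSl d3 (Bdim pB).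
    move=> /eqP/capv_idPl pr; by rewrite eq_sym eqEdim pr (Bdim pB) (Bdim rB).
  have v0 : v != 0 by apply: contra_eq_neq pv => ->; rewrite linear0 eq_sym oner_neq0.
  have IE : (<[v]> == p :&: r)%VS.
    by rewrite eqEdim -memvE memv_cap vp vr dim_vline v0.
  have only w : w \in p -> w \in r -> phi w = 1 -> w = v.
    move=> wp wr pw; have : w \in (p :&: r)%VS by rewrite memv_cap wp.
    rewrite -(eqP IE) => /vlineP[k wE]; move: pw; rewrite wE linearZ /= pv.
    by rewrite -[_ *: 1]/(_ * _) mulr1 => ->; rewrite scale1r.
  have [pr | /nopar[c [cC cp cr]]] := boolP (par p r).
    apply: (@leq_trans #|[set v]|); last by rewrite cards1.
    apply/subset_leq_card/subsetP => w; rewrite !inE.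
    by move=> /andP[/and3P[_ wp /eqP pw] wr]; rewrite (only w).
  by rewrite -(only c) ?cC ?Caff in vN.
have le2 := @leq_sum _ (index_enum _) _ _ _ bound.
have := leq_trans le1 le2; rewrite big_split /= -big_distrr /= cE.
have -> : (\sum_(r in B') (r \in adjacent p) = #|adjacent p|)%N.
  rewrite -sum1_card [RHS]big_mkcond [LHS]big_mkcond /=; apply: eq_bigr => r _.
  by rewrite !inE; case: (r \in B) => //=; case: eqP => //= _; case: ifP.
have : (\sum_(r in B') (par p r : nat) <= q.-1)%N.
  have := card_class conf pB; rewrite (cardsD1 p) inE pB parallel_refl => le.
  suff -> : (\sum_(r in B') (par p r : nat) = #|[set r in B | par p r] :\ p|)%N.
    by rewrite -ltnS prednK.
  rewrite -sum1_card [RHS]big_mkcond [LHS]big_mkcond /=; apply: eq_bigr => r _.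
  by rewrite !inE; case: (r \in B) => //=; case: eqP => //= _; case: ifP.
rewrite -mulnn; move: #|adjacent p| (\sum_(r in _) _)%N => x y; case: (q) q7 => //= k; nia.
Qed.

(** If [r] and [s] differed, both [a] and [a + n] would lie on three C-planes, hence in [C], and [p]
    and [r] would share two points of [C]. *)
Lemma adjacent_line_uniq p r s a n : p \in B -> r \in adjacent p -> s \in adjacent p ->
  phi a = 1 -> phi n = 0 -> n != 0 -> a \in p -> n \in p ->
  a \in r -> n \in r -> a \in s -> n \in s -> r = s.
Proof.
move=> pB /adjacentP[rB rp _ _] /adjacentP[sB sp _ _] pa pn n0 ap np ar nr as_ ns.
apply/eqP; apply: contraNT n0 => rs.
have pan : phi (a + n) = 1 by rewrite linearD /= pa pn addr0.
rewrite eq_sym in rp; rewrite eq_sym in sp.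
have aC := three_blocks pa pB rB sB ap ar as_ rp sp rs.
have anC := three_blocks pan pB rB sB (memvD ap np) (memvD ar nr) (memvD as_ ns) rp sp rs.
have aE := meet_uniq pB rB rp aC anC ap (memvD ap np) ar (memvD ar nr).
by rewrite -(addKr a n) -aE addNr eqxx.
Qed.

Lemma adjacent_dir p r : r \in adjacent p ->
  exists n, [/\ n != 0, phi n = 0, n \in p & n \in r].
Proof.
move=> /adjacentP[rB rp d _].
have := limg_ker_dim phi (p :&: r); rewrite d.
have : (\dim (phi @: (p :&: r)) <= 1)%N.
  by apply: leq_trans (dimvS (subvf _)) _; rewrite dimvf.
move=> le1 dE; have : (p :&: r :&: lker phi)%VS != 0%VS.
  by rewrite -dimv_eq0; apply: contraTneq le1 => k0; rewrite k0 add0n in dE; rewrite dE.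
rewrite -vpick0; set n := vpick _ => n0; exists n.
have := memv_pick (p :&: r :&: lker phi); rewrite -/n !memv_cap memv_ker.
by move=> /andP[/andP[-> ->] /eqP].
Qed.

Lemma adjacent_dir_uniq p r n n' : r \in adjacent p -> n != 0 -> phi n = 0 -> phi n' = 0 ->
  n \in p -> n \in r -> n' \in p -> n' \in r -> exists k, n' = k *: n.
Proof.
move=> rA n0 pn pn' np nr np' nr'; have [_ _ _ [a [ap ar pa]]] := adjacentP rA.
have [k] := line_adj rA pa pn n0 ap ar np nr np' nr'.
by rewrite pn' scale0r add0r => ->; exists k.
Qed.

Lemma aff_scale v : phi v != 0 -> phi ((phi v)^-1 *: v) = 1.
Proof. by move=> pv; rewrite linearZ /= -[_ *: _]/(_ * _) mulVf. Qed.

Lemma adjacent_common p r s : p \in B -> r \in adjacent p -> s \in adjacent p ->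
  exists u, [/\ u != 0, u \in p, u \in r & u \in s].
Proof.
move=> pB /adjacentP[_ _ dr _] /adjacentP[_ _ ds _].
have dE := dimv_sum_cap (p :&: r) (p :&: s).
have le3 : (\dim (p :&: r + p :&: s) <= 3)%N.
  apply: (@leq_trans (\dim p)); last by rewrite (Bdim pB).
  by rewrite dimvS // subv_add !capvSl.
have : (p :&: r :&: (p :&: s))%VS != 0%VS.
  rewrite -dimv_eq0; apply: contraTneq le3 => k0.
  by rewrite k0 dr ds addn0 in dE; rewrite dE.
rewrite -vpick0; set u := vpick _ => u0; exists u.
have := memv_pick (p :&: r :&: (p :&: s)); rewrite -/u !memv_cap.
by move=> /andP[/andP[-> ->] /andP[_ ->]].
Qed.

Lemma card_multiples n : n != 0 -> #|[set k *: n | k in [set~ (0 : F)]]| = q.-1.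
Proof.
move=> n0; rewrite card_imset; first by rewrite cardsC1.
by move=> k l /eqP; rewrite -subr_eq0 -scalerBl scaler_eq0 (negPf n0) orbF subr_eq0 => /eqP.
Qed.

(** Otherwise [a] sends out in [p] the [q - 1] chords to the other points of [C] and at least
    [q - 1] lines cut by adjacent planes, all in different directions. The line at infinity of [p]
    has only [q + 1] points, and [2 (q - 1) > q + 1]. The count is made on nonzero vectors, [q - 1]
    for each direction. *)
Lemma adjacent_not_all_through p a : p \in B -> a \in C -> a \in p ->
  exists2 r, r \in adjacent p & a \notin r.
Proof.
move=> pB aC ap; apply/exists_inP; apply: contraT.
rewrite negb_exists_in => /forall_inP H.
have {}H r : r \in adjacent p -> a \in r by move=> /H; rewrite negbK.
pose K := (p :&: lker phi)%VS; pose Z := [set n in K] :\ 0.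
have cZ : (#|Z| <= q ^ 2 - 1)%N.
  have := cardsD1 (0 : W) [set n in K]; rewrite inE mem0v card_vspace_set => cE.
  have dK : (\dim K <= 2)%N.
    have : (\dim K <= 3)%N.
      apply: (@leq_trans (\dim p)); last by rewrite (Bdim pB).
      by rewrite dimvS ?capvSl.
    suff : \dim K != 3%N by case: (\dim K) => [|[|[|[|]]]].
    apply/eqP => d3; have : (p <= lker phi)%VS.
      by apply/capv_idPl/eqP; rewrite eqEdim capvSl (Bdim pB) d3.
    by move=> /subvP/(_ a ap); rewrite memv_ker (Caff aC); apply/negP; apply: oner_neq0.
  have : (q ^ \dim K <= q ^ 2)%N by rewrite leq_pexp2l.
  by rewrite cE /Z; move: #|_| => x; lia.
have := double_count Z (adjacent p) (fun v r => v \in r).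
have := double_count Z (vsec C p :\ a) (fun v b => v \in <[b - a]>%VS).
set S1 := (\sum_(v in Z) _)%N => E1; set S2 := (\sum_(v in Z) _)%N => E2.
have lo1 : (q.-1 * q.-1 <= S1)%N.
  have cS : q.-1 = #|vsec C p :\ a|.
    by have := cardsD1 a (vsec C p); rewrite (conf_sec conf pB) in_vsec aC ap => ->.
  rewrite E1 {1}cS -sum_nat_const leq_sum // => b; rewrite !inE => /and3P[ba bC bp].
  have ba0 : b - a != 0 by rewrite subr_eq0.
  rewrite -(card_multiples ba0); apply/subset_leq_card/subsetP => _ /imsetP[k k0 ->].
  rewrite !inE in k0 *; rewrite scaler_eq0 negb_or k0 ba0 memv_cap memv_ker.
  by rewrite (memvZ _ (memv_line _)) (memvZ _ (memvB bp ap)) linearZ linearB /= !Caff // subrr scaler0 eqxx.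
have lo2 : (q.-1 * q.-1 <= S2)%N.
  apply: leq_trans (_ : #|adjacent p| * q.-1 <= _)%N; first by rewrite leq_mul // card_adjacent.
  rewrite E2 -sum_nat_const leq_sum // => r rA.
  have [n [n0 pn np nr]] := adjacent_dir rA.
  rewrite -(card_multiples n0); apply/subset_leq_card/subsetP => _ /imsetP[k k0 ->].
  rewrite !inE in k0 *; rewrite scaler_eq0 negb_or k0 n0 memv_cap memv_ker.
  by rewrite !memvZ // linearZ /= pn scaler0 eqxx.
have up : (S1 + S2 <= #|Z|)%N.
  rewrite -sum1_card -big_split /= leq_sum // => v /[!inE] /andP[v0].
  rewrite memv_cap memv_ker => /andP[vp /eqP pv].
  have le1 : (#|[set b in vsec C p :\ a | v \in <[b - a]>%VS]| <= 1)%N.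
    rewrite leqNgt; apply/negP => /card_gt1P[b [c []]]; rewrite !inE.
    move=> /andP[/and3P[ba bC bp] /vlineP[k vk]] /andP[/and3P[ca cC cp] /vlineP[l vl]] bc.
    have := conf_arc conf pB aC bC cC ap bp cp; rewrite eq_sym ba ca eq_sym bc.
    move=> /(_ isT isT isT)/negP; apply.
    have l0 : l != 0 by apply: contraNneq v0 => l0; rewrite vl l0 scale0r.
    have -> : c = a + (l^-1 * k) *: (b - a).
      by rewrite -scalerA -vk vl scalerA mulVf // scale1r addrC subrK.
    rewrite scalerBr addrCA -[a in a - _]scale1r -scalerBl addrC.
    by rewrite memv_add // memvZ ?memv_line.
  have le2 : (#|[set r in adjacent p | v \in r]| <= 1)%N.
    rewrite leqNgt; apply/negP => /card_gt1P[r [s []]]; rewrite !inE.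
    move=> /andP[rA vr] /andP[sA vs] /eqP; apply.
    by apply: (adjacent_line_uniq pB _ _ (Caff aC) pv v0) => //; rewrite ?inE ?H ?inE.
  (* No direction is of both kinds: an adjacent plane through [a] containing the direction of the
     chord [a b] contains [b], a second point of [C] in common with [p]. *)
  suff : ~~ ((0 < #|[set b in vsec C p :\ a | v \in <[b - a]>%VS]|) &&
             (0 < #|[set r in adjacent p | v \in r]|))%N.
    by move: le1 le2; case: #|_| => [|[|]] // _; case: #|_| => [|[|]].
  apply/negP => /andP[/card_gt0P[b] + /card_gt0P[r]]; rewrite [r \in _]inE [b \in _]inE.
  rewrite !in_setD1 in_vsec => /andP[/and3P[ba bC bp] /vlineP[k vk]] /andP[rA vr].
  have ar := H r rA; have [rB rp _ _] := adjacentP rA.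
  have k0 : k != 0 by apply: contraNneq v0 => k0; rewrite vk k0 scale0r.
  have br : b \in r.
    have -> : b = k^-1 *: v + a by rewrite vk scalerA mulVf // scale1r subrK.
    by rewrite memvD // memvZ.
  case/eqP: ba; apply: (meet_uniq pB rB _ bC aC) => //; by rewrite eq_sym.
have := leq_trans (leq_add lo1 lo2) (leq_trans up cZ).
rewrite -mulnn; case: (q) q7 => //= k; nia.
Qed.

End Adjacency.

(** * The point at infinity common to the C-planes that cross a given one in an affine line *)

Section Direction.

Variables (F : finFieldType) (phi : 'Hom('rV[F]_5, F^o)).
Variables (C : {set 'rV[F]_5}) (B : {set subspace F}).
Hypothesis conf : configuration phi C B.

Local Notation q := #|F|.
Local Notation W := 'rV[F]_5.
Implicit Types (p r s U V : {vspace W}) (a b c n v : W).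
Local Notation par := (parallel (vsec C)).
Let q7 := conf_ge7 conf.
Let Bdim := conf_dim conf.

Definition direction p n :=
  [/\ n != 0, phi n = 0, n \in p & forall r, r \in adjacent phi B p -> n \in r].

Lemma adjacent_pair p : p \in B -> exists r s,
  [/\ r \in adjacent phi B p, s \in adjacent phi B p & r != s].
Proof.
move=> pB; have : (1 < #|adjacent phi B p|)%N.
  by apply: leq_trans (card_adjacent conf pB); move: q7; case: (q) => [|[|[|]]].
by move=> /card_gt1P[r [s [rA sA rs]]]; exists r, s.
Qed.

(** The lines cut on [p] meet pairwise. If [r1] and [r2] cut lines with an affine common point [a],
    then [a] is in [C]. A third line either meets one of these two in an affine point, again in [C]
    and therefore equal to [a], or meets both at infinity, which would put [n1] in [r2]. So all pass
    through [a], against [adjacent_not_all_through]. *)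
Lemma directionP p : p \in B -> exists n, direction p n.
Proof.
move=> pB; have [r1 [_ [r1A _ _]]] := adjacent_pair pB.
have [n1 [n0 pn np nr1]] := adjacent_dir r1A.
have [/forall_inP H | ] := boolP [forall r in adjacent phi B p, n1 \in r].
  by exists n1.
rewrite negb_forall_in => /exists_inP[r2 r2A nr2].
have r12 : r1 != r2 by apply: contraNneq nr2 => <-.
have [r1B r1p _ _] := adjacentP r1A; have [r2B r2p _ _] := adjacentP r2A.
rewrite eq_sym in r1p; rewrite eq_sym in r2p.
have [u [u0 up ur1 ur2]] := adjacent_common conf pB r1A r2A.
have pu : phi u != 0.
  apply: contraNneq nr2 => pu.
  have [k nE] := adjacent_dir_uniq r1A u0 pu pn up ur1 np nr1.
  by rewrite nE memvZ.
have [a [aC ap ar1 ar2]] : exists a, [/\ a \in C, a \in p, a \in r1 & a \in r2].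
  exists ((phi u)^-1 *: u); rewrite !memvZ //; split=> //.
  by apply: (three_blocks conf (aff_scale pu) pB r1B r2B); rewrite ?memvZ.
suff H r : r \in adjacent phi B p -> a \in r.
  by have [r /H ar] := adjacent_not_all_through conf pB aC ap; rewrite ar.
move=> rA; have [-> // | r1r] := eqVneq r r1; have [-> // | r2r] := eqVneq r r2.
have [rB rp _ [b [bp br pb]]] := adjacentP rA; rewrite eq_sym in rp.
have key r' v : r' \in adjacent phi B p -> r != r' -> a \in r' -> v != 0 -> v \in p ->
    v \in r -> v \in r' -> phi v != 0 -> a \in r.
  move=> r'A rr' ar' v0 vp vr vr' pv; have [r'B r'p _ _] := adjacentP r'A.
  rewrite eq_sym in r'p.
  have vC : (phi v)^-1 *: v \in C.
    by apply: (three_blocks conf (aff_scale pv) pB rB r'B); rewrite ?memvZ.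
  suff -> : a = (phi v)^-1 *: v by rewrite memvZ.
  by apply: (meet_uniq conf pB r'B r'p aC vC); rewrite ?memvZ.
have [v1 [v10 v1p v1r v1r1]] := adjacent_common conf pB rA r1A.
have [v2 [v20 v2p v2r v2r2]] := adjacent_common conf pB rA r2A.
have [pv1 | pv1] := eqVneq (phi v1) 0; last exact: (key r1 v1).
have [pv2 | pv2] := eqVneq (phi v2) 0; last exact: (key r2 v2).
have [k v2E] := adjacent_dir_uniq rA v10 pv1 pv2 v1p v1r v2p v2r.
have [l nE] := adjacent_dir_uniq r1A v10 pv1 pn v1p v1r1 np nr1.
have k0 : k != 0 by apply: contraNneq v20 => k0; rewrite v2E k0 scale0r.
case/negP: nr2; rewrite nE memvZ //.
have -> : v1 = k^-1 *: v2 by rewrite v2E scalerA mulVf // scale1r.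
by rewrite memvZ.
Qed.

(** For distinct C-planes, not being parallel means sharing a point of [C]: these are the planes
    whose common affine line with [p] carries a point of [C]. *)
Definition linked p : {set subspace F} := [set r in adjacent phi B p | ~~ par p r].

(** Of the [q] affine lines of [p] in the direction [n], at least [q - 1] are cut by adjacent
    planes. The points in question lie on the one that may remain, and a line has at most two points
    of an arc. *)
Lemma card_unmatched p : p \in B ->
  (#|[set a in vsec C p | [forall r in adjacent phi B p, a \notin r]]| <= 2)%N.
Proof.
move=> pB; have [n [n0 pn np nA]] := directionP pB.
set U := [set a in _ | _]; have [a [b [aC bC ap bp ab]]] := block_pts conf pB.
pose X := [set v in p | phi v == 1]; pose A := adjacent phi B p.
pose Z := [set v in X | [forall r in A, v \notin r]].
have ZE v : (v \in Z) = (v \in X) && [forall r in A, v \notin r] by rewrite inE.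
have cZ : (#|Z| <= q)%N.
  have := double_count A X (fun r v => v \in r).
  under eq_bigr => r rA.
    have [rB rp d [c [cp cr pc]]] := adjacentP rA.
    have -> : [set v in X | v \in r] = [set v in (p :&: r)%VS | phi v == 1].
      by apply/setP => v; rewrite !inE memv_cap andbAC.
    have cI : c \in (p :&: r)%VS by rewrite memv_cap cp.
    rewrite (card_aff cI pc) d /= expn1; over.
  rewrite sum_nat_const => E.
  have : (\sum_(v in X) #|[set r in A | v \in r]| + #|Z| <= #|X|)%N.
    have -> : #|Z| = (\sum_(v in X) [forall r in A, v \notin r])%N.
      rewrite -sum1_card [RHS]big_mkcond [LHS]big_mkcond /=; apply: eq_bigr => v _.
      by rewrite ZE; case: (v \in X) => //=; case: ifP.
    rewrite -big_split -sum1_card leq_sum //= => v vX.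
    have /[!inE] /andP[vp /eqP pv] := vX.
    have le1 : (#|[set r in A | v \in r]| <= 1)%N.
      rewrite leqNgt; apply/negP => /card_gt1P[r [s [/setIdP[rA vr] /setIdP[sA vs] /eqP]]]; apply.
      exact: (adjacent_line_uniq conf pB rA sA pv pn n0 vp np vr (nA r rA) vs (nA s sA)).
    have [/forall_inP H | _] := boolP [forall r in A, v \notin r]; last by rewrite addn0.
    suff -> : [set r in A | v \in r] = set0 by rewrite cards0.
    by apply/setP => r; rewrite in_set in_set0; apply/negbTE/negP => /andP[/H/negP].
  rewrite -E (card_aff ap (conf_aff conf aC)) (Bdim pB) /=.
  have := card_adjacent conf pB; rewrite -/A -mulnn; move: #|A| #|Z| => x y.
  by case: (q) q7 => //= k; nia.
(* The affine line through [c] in the direction [n] avoids every adjacent plane, since those contain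
   [n]; having [q] points, it fills [Z]. *)
have lineE c : c \in U -> Z = [set c + k *: n | k in [set: F]].
  rewrite inE in_vsec => /andP[/andP[cC cp] /forall_inP cU].
  apply/eqP; rewrite eq_sym eqEcard; apply/andP; split; last first.
    rewrite card_imset ?cardsT // => k l /addrI/eqP.
    by rewrite -subr_eq0 -scalerBl scaler_eq0 (negPf n0) orbF subr_eq0 => /eqP.
  apply/subsetP => _ /imsetP[k _ ->]; rewrite !inE memvD ?memvZ //.
  rewrite linearD linearZ /= pn scaler0 addr0 (conf_aff conf cC) eqxx /=.
  apply/forall_inP => r rA; apply: contra (cU r rA) => cr.
  by rewrite -(addrK (k *: n) c) memvB // memvZ // nA.
rewrite leqNgt; apply/negP => /card_gt2P[c [d [e [[cU dU eU] [cd de ec]]]]].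
have mem x : x \in U -> [/\ x \in C, x \in p & exists k, x = c + k *: n].
  move=> xU; move: (xU); rewrite inE in_vsec => /andP[/andP[xC xp] _]; split=> //.
  have : x \in Z by rewrite (lineE x xU); apply/imsetP; exists 0; rewrite ?inE // scale0r addr0.
  by rewrite (lineE c cU) => /imsetP[k _ ->]; exists k.
have [cC cp _] := mem c cU; have [dC dp [k dE]] := mem d dU; have [eC ep [l eE]] := mem e eU.
have k0 : k != 0 by apply: contraNneq cd => k0; rewrite dE k0 scale0r addr0.
have := conf_arc conf pB cC dC eC cp dp ep cd ec; rewrite [e == d]eq_sym de => /(_ isT)/negP; apply.
have -> : e = (1 - l / k) *: c + (l / k) *: d.
  by rewrite dE scalerDr scalerA divfK // scalerBl scale1r addrA subrK.
by rewrite memv_add // memvZ ?memv_line.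
Qed.

(** All but two points of [C] in [p] lie on an adjacent plane, necessarily linked to [p], and a
    plane other than [p] accounts for at most one of them. *)
Lemma card_linked p : p \in B -> (q.-2 <= #|linked p|)%N.
Proof.
move=> pB; set U := [set a in vsec C p | [forall r in adjacent phi B p, a \notin r]].
have cU : (#|U| <= 2)%N := card_unmatched pB.
have cS : (q.-2 <= #|vsec C p :\: U|)%N.
  by rewrite cardsDS ?(conf_sec conf pB) ?subsetIl //; [lia | apply/subsetP => v /[1!inE]/andP[]].
apply: leq_trans cS _.
have := double_count (vsec C p :\: U) (linked p) (fun a r => a \in r).
move=> E; have : (#|vsec C p :\: U| <=
  \sum_(a in vsec C p :\: U) #|[set r in linked p | a \in r]|)%N.
  rewrite -sum1_card leq_sum // => a; rewrite in_setD [a \in U]in_set => /andP[+ aS].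
  rewrite aS /= negb_forall_in => /exists_inP[r rA]; rewrite negbK => ar.
  apply/card_gt0P; exists r; apply/setIdP; split=> //; apply/setIdP; split=> //.
  have [rB rp _ _] := adjacentP rA.
  apply: contraNN rp => pr; move: aS; rewrite in_vsec => /andP[aC ap].
  by rewrite (par_meet pr aC ap ar).
move=> /leq_trans; apply; rewrite E -sum1_card leq_sum // => r.
rewrite inE => /andP[/adjacentP[rB rp _ _] _].
rewrite leqNgt; apply/negP => /card_gt1P[a [b [/setIdP[/setDP[/setIdP[aC ap] _] ar]]]].
move=> /setIdP[/setDP[/setIdP[bC bp] _] br] /eqP; apply.
by rewrite eq_sym in rp; apply: (meet_uniq conf pB rB rp).
Qed.

End Direction.

(** * Two parallel classes through one point at infinity *)

Section Linked.

Variables (F : finFieldType) (phi : 'Hom('rV[F]_5, F^o)).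
Variables (C : {set 'rV[F]_5}) (B : {set subspace F}).
Hypothesis conf : configuration phi C B.

Local Notation q := #|F|.
Local Notation W := 'rV[F]_5.
Implicit Types (p r s U V : {vspace W}) (a b c n v : W).
Local Notation par := (parallel (vsec C)).
Let q7 := conf_ge7 conf.
Let Caff := conf_aff conf.
Let Bdim := conf_dim conf.
Let q_gt0 : (0 < q)%N. Proof. exact: leq_trans q7. Qed.
Let q_gt1 : (1 < q)%N. Proof. exact: leq_trans q7. Qed.

Lemma aff_neq0 a : phi a = 1 -> a != 0.
Proof. by move=> pa; apply: contra_eq_neq pa => ->; rewrite linear0 eq_sym oner_neq0. Qed.

Lemma aff_notin_line a b : phi a = 1 -> phi b = 1 -> a != b -> b \notin <[a]>%VS.
Proof.
move=> pa pb; apply: contraNN => /vlineP[k bE]; move: pb; rewrite bE linearZ /= pa.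
by rewrite -[_ *: _]/(_ * _) mulr1 => ->; rewrite scale1r.
Qed.

Lemma dir_notin_line a n : phi a = 1 -> phi n = 0 -> n != 0 -> n \notin <[a]>%VS.
Proof.
move=> pa pn; apply: contraNN => /vlineP[k nE]; move: pn; rewrite nE linearZ /= pa.
by rewrite -[_ *: _]/(_ * _) mulr1 => ->; rewrite scale0r.
Qed.

Lemma block_span p V a b c : p \in B -> a \in C -> b \in C -> c \in C ->
  a \in p -> b \in p -> c \in p -> a != b -> c != a -> c != b ->
  a \in V -> b \in V -> c \in V -> (p <= V)%VS.
Proof.
move=> pB aC bC cC ap bp cp ab ca cb aV bV cV; apply/subvP => v vp.
have le3 : (\dim p <= 3)%N by rewrite (Bdim pB).
have [x [y [z ->]]] := span3P le3 ap bp cp (aff_neq0 (Caff aC))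
  (aff_notin_line (Caff aC) (Caff bC) ab) (conf_arc conf pB aC bC cC ap bp cp ab ca cb) vp.
by rewrite !memvD // memvZ.
Qed.

Lemma line_block_uniq p r s a n : p \in B -> r \in B -> s \in B -> a \in C ->
  phi n = 0 -> n != 0 -> a \in p -> a \in r -> a \in s ->
  n \in p -> n \in r -> n \in s -> p != r -> p != s -> r = s.
Proof.
move=> pB rB sB aC pn n0 ap ar as_ np nr ns pr ps.
apply/eqP; apply: contraNT n0 => rs.
have pan : phi (a + n) = 1 by rewrite linearD /= pn addr0 Caff.
have anC := three_blocks conf pan pB rB sB (memvD ap np) (memvD ar nr) (memvD as_ ns) pr ps rs.
have aE := meet_uniq conf pB rB pr aC anC ap (memvD ap np) ar (memvD ar nr).
by rewrite -(addKr a n) -aE addNr eqxx.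
Qed.

(** In a solid, any two C-planes through a common point of [C] meet in an affine line, so they are
    adjacent. Three C-planes through one point [a] of [C] would then all contain the line through
    [a] in the direction of the first. *)
Lemma not_in_solid V : {subset C <= V} -> (4 < \dim V)%N.
Proof.
move=> CV; rewrite ltnNge; apply/negP => dV.
have BV p : p \in B -> (p <= V)%VS.
  move=> pB; have [a [b [c [[aC bC cC] [[ap bp cp] [ab ca cb]]]]]] := block_pts3 conf pB.
  by apply: (block_span pB aC bC cC ap bp cp ab ca cb); apply: CV.
have : (0 < #|C|)%N by rewrite (conf_card conf) expn_gt0 q_gt0.
case/card_gt0P => a aC.
have : (2 < #|[set p in B | a \in p]|)%N.
  by rewrite (card_through conf aC); move: q7; lia.
case/card_gt2P => p [r [s [[/setIdP[pB ap] /setIdP[rB ar] /setIdP[sB as_]] [pr rs sp]]]].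
rewrite eq_sym in sp.
have [n dn] := directionP conf pB; have [n0 pn np nA] := dn.
have adj t : t \in B -> a \in t -> p != t -> n \in t.
  move=> tB at_ pt; apply: nA; rewrite inE tB eq_sym pt /=.
  have nk : ~~ (p :&: t <= lker phi)%VS.
    by apply/subvPn; exists a; rewrite ?memv_cap ?ap // memv_ker (Caff aC) oner_neq0.
  rewrite nk andbT.
  have arith x y : (y <= 3)%N -> y != 3%N -> (x <= 4)%N -> (x + y = 3 + 3)%N -> y == 2%N.
    by move: x y => [|[|[|[|[|x]]]]] [|[|[|[|y]]]].
  have := dimv_sum_cap p t; rewrite (Bdim pB) (Bdim tB).
  have : (\dim (p + t) <= 4)%N.
    by apply: leq_trans dV; rewrite dimvS // subv_add !BV.
  have : (\dim (p :&: t) != 3)%N.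
    apply: contraNneq pt => d3.
    have : (p :&: t == p)%VS by rewrite eqEdim capvSl d3 (Bdim pB).
    by move=> /eqP/capv_idPl pr'; rewrite eqEdim pr' (Bdim pB) (Bdim tB).
  have : (\dim (p :&: t) <= 3)%N.
    by apply: (@leq_trans (\dim p)); [rewrite dimvS ?capvSl | rewrite (Bdim pB)].
  exact: arith.
case/eqP: rs; apply: (line_block_uniq pB rB sB aC pn n0) => //; exact: adj.
Qed.

Lemma mem_linked p r : p \in B -> r \in linked phi C B p ->
  [/\ r \in adjacent phi B p, r \in B, p != r & exists a, [/\ a \in C, a \in p & a \in r]].
Proof.
move=> pB /setIdP[rA npr]; have [rB rp _ _] := adjacentP rA.
by split=> //; [rewrite eq_sym | exact: npar_meet pB rB npr].
Qed.

(** The line common to [p] and [r] has a single point at infinity, which is both that of [p] and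
    that of [r]. *)
Lemma linked_direction p r n : p \in B -> direction phi B p n -> r \in linked phi C B p ->
  direction phi B r n.
Proof.
move=> pB [n0 pn np nA] rL; have [rA rB pr [a [aC ap ar]]] := mem_linked pB rL.
have [n' dn'] := directionP conf rB; have [n'0 pn' n'r n'A] := dn'.
have pA : p \in adjacent phi B r.
  move: rA; rewrite !inE pB capvC pr; by case/and4P => _ _ -> ->.
have [k n'E] := adjacent_dir_uniq pA n'0 pn' pn n'r (n'A p pA) (nA r rA) np.
split=> //; first exact: nA.
by move=> s sA; rewrite n'E memvZ // n'A.
Qed.

Lemma linked_sym p r : p \in B -> r \in linked phi C B p -> p \in linked phi C B r.
Proof.
move=> pB rL; have [rA rB pr _] := mem_linked pB rL; move: rL => /setIdP[_ npr].
apply/setIdP; rewrite parallel_sym npr; split=> //.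
by move: rA; rewrite !inE pB capvC pr; case/and4P => _ _ -> ->.
Qed.

(* Otherwise p, r and s form a triangle and span a solid; since q + 1 > 6, every point
   of C lies on a block meeting this triangle in three distinct points, so C would be
   contained in the solid. *)
Lemma linked_parallel p r s : p \in B -> r \in linked phi C B p -> s \in linked phi C B p ->
  par r s.
Proof.
move=> pB rL sL; apply: contraT => nrs.
have [rA rB pr [a [aC ap ar]]] := mem_linked pB rL.
have [sA sB ps [b [bC bp bs]]] := mem_linked pB sL.
have [d [dC dr ds]] := npar_meet rB sB nrs.
have rs : r != s by apply: contraNneq nrs => ->; apply: parallel_refl.
have [n [n0 pn np nA]] := directionP conf pB.
have nr := nA r rA; have ns := nA s sA.
have ab : a != b.
  apply: contraNneq rs => ab; rewrite -ab in bs.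
  by apply/eqP; apply: (line_block_uniq pB rB sB aC pn n0).
have dp : d \notin p.
  apply: contraNN ab => dp; apply/eqP.
  have -> := meet_uniq conf pB rB pr aC dC ap dp ar dr.
  exact: (meet_uniq conf pB sB ps dC bC dp bp ds bs).
pose V := (p + r)%VS.
have pV : (p <= V)%VS by apply: addvSl.
have rV : (r <= V)%VS by apply: addvSr.
(* The plane [s] is spanned by [b] and [n], which are in [p], and by [d], which is in [r]. *)
have sV : (s <= V)%VS.
  apply/subvP => v vs; have le3 : (\dim s <= 3)%N by rewrite (Bdim sB).
  have dbn : d \notin (<[b]> + <[n]>)%VS.
    have bnp : (<[b]> + <[n]> <= p)%VS by rewrite subv_add -!memvE bp np.
    by apply: contraNN dp; apply: (subvP bnp).
  have [x [y [z ->]]] := span3P le3 bs ns ds (aff_neq0 (Caff bC))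
    (dir_notin_line (Caff bC) pn n0) dbn vs.
  by rewrite !memvD ?memvZ ?(subvP pV b) ?(subvP pV n) ?(subvP rV d).
have dV : (\dim V <= 4)%N.
  have arith x y z t : (x + y = z + t)%N -> y = 2%N -> z = 3%N -> t = 3%N -> (x <= 4)%N.
    by move=> E yE zE tE; move: E; rewrite yE zE tE addn2 => -[->].
  have [_ _ d2 _] := adjacentP rA.
  exact: arith (dimv_sum_cap p r) d2 (Bdim pB) (Bdim rB).
suff /not_in_solid : {subset C <= V} by rewrite ltnNge dV.
move=> e eC; apply: contraT => eV.
have ep : e \notin p by apply: contraNN eV; apply: (subvP pV).
have er : e \notin r by apply: contraNN eV; apply: (subvP rV).
have es : e \notin s by apply: contraNN eV; apply: (subvP sV).
(* The six conditions are to pass through a vertex of the triangle or to be parallel to a side; each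
   holds for at most one C-plane through [e]. *)
pose bad : seq (pred (subspace F)) := [:: (fun t : {vspace W} => a \in t);
  (fun t : {vspace W} => b \in t); (fun t : {vspace W} => d \in t); (par p); (par r); (par s)].
have [||i t t' lti|t] := @exists_avoiding_all _ (enum [set t in B | e \in t]) bad.
- exact: enum_uniq.
- by rewrite -cardE (card_through conf eC); apply: leqW q7.
- rewrite !mem_enum => /setIdP[tB et] /setIdP[t'B et'].
  have pt x : x \in C -> x \in V -> x \in t -> x \in t' -> t = t'.
    move=> xC xV xt xt'; apply: (conf_uniq conf tB t'B eC xC) => //.
    by apply: contraNneq eV => ->.
  have pl x : x \in B -> par x t -> par x t' -> t = t'.
    by move=> xB xt xt'; apply: (par_uniq conf xB tB t'B xt xt' eC).
  move: i lti => [|[|[|[|[|[|i]]]]]] //= _.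
  + by apply: pt => //; apply: (subvP pV).
  + by apply: pt => //; apply: (subvP pV).
  + by apply: pt => //; apply: (subvP rV).
  + exact: pl.
  + exact: pl.
  + exact: pl.
rewrite mem_enum => /setIdP[tB et] /= /and5P[nat nbt ndt npt /and3P[nrt nst _]].
have [x [xC xp xt]] := npar_meet pB tB npt.
have [y [yC yr yt]] := npar_meet rB tB nrt.
have [z [zC zs zt]] := npar_meet sB tB nst.
have xy : x != y.
  apply: contraNneq nat => xy; rewrite -xy in yr.
  by rewrite (meet_uniq conf pB rB pr aC xC ap xp ar yr).
have zx : z != x.
  apply: contraNneq nbt => zx; rewrite -zx in xp.
  by rewrite (meet_uniq conf pB sB ps bC zC bp xp bs zs).
have zy : z != y.
  apply: contraNneq ndt => zy; rewrite -zy in yr.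
  by rewrite (meet_uniq conf rB sB rs dC zC dr yr ds zs).
have tV := block_span tB xC yC zC xt yt zt xy zx zy (subvP pV x xp) (subvP rV y yr)
  (subvP sV z zs).
by case/negP: eV; apply: (subvP tV).
Qed.

(** Take [t] linked to [s]. By [linked_parallel] the planes linked to [r] and those linked to [t]
    all lie in the class of [p], which has at most [q] members; both sets have at least [q - 2]
    elements and [2 (q - 2) > q], so they share some [u]. The direction is carried along the chain
    [p], [r], [u], [t], [s]. *)
Lemma class_direction p r s n : p \in B -> direction phi B p n -> r \in linked phi C B p ->
  s \in B -> par p s -> direction phi B s n.
Proof.
move=> pB dn rL sB ps; have [_ rB _ _] := mem_linked pB rL.
have : (0 < #|linked phi C B s|)%N.
  by apply: leq_trans (card_linked conf sB); move: q7; case: (q) => [|[|[|]]].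
case/card_gt0P => t tL; have [_ tB _ _] := mem_linked sB tL.
pose X := [set x in B | par p x].
have sub u w : u \in B -> w \in B -> par p w -> w \in linked phi C B u ->
    linked phi C B u \subset X.
  move=> uB wB pw wL; apply/subsetP => x xL; have [_ xB _ _] := mem_linked uB xL.
  apply/setIdP; split=> //; rewrite parallel_sym in pw.
  by apply: (par_trans conf wB) => //; apply: (linked_parallel uB).
have subt := sub t s tB sB ps (linked_sym sB tL).
have subr := sub r p rB pB (parallel_refl _ _) (linked_sym pB rL).
have [u] : exists u, u \in linked phi C B t :&: linked phi C B r.
  have arith k x y z w : (7 <= k)%N -> (k.-2 <= x)%N -> (k.-2 <= y)%N -> (z <= k)%N ->
      (z + w = x + y)%N -> (0 < w)%N by case: k => [|[|k]] //=; clear; lia.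
  apply/card_gt0P; apply: arith q7 (card_linked conf tB) (card_linked conf rB) _ (cardsUI _ _).
  by apply: leq_trans (card_class conf pB); apply: subset_leq_card; rewrite subUset subt subr.
move=> /setIP[ut ur]; have [_ uB _ _] := mem_linked tB ut.
apply: (linked_direction tB _ (linked_sym sB tL)).
apply: (linked_direction uB _ (linked_sym tB ut)).
apply: (linked_direction rB _ ur); exact: (linked_direction pB dn).
Qed.

Lemma exists_grid : exists p r n, [/\ p \in B, r \in B & ~~ par p r] /\
  [/\ n != 0, phi n = 0 & forall s, s \in B -> par p s || par r s = (n \in s)].
Proof.
have : (1 < #|C|)%N by rewrite (conf_card conf) -(expn0 q) ltn_exp2l.
case/card_gt1P => a [b [aC bC ab]]; have [p pB _] := conf_block conf aC bC ab.
have [n dn] := directionP conf pB; have [n0 pn np _] := dn.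
have : (0 < #|linked phi C B p|)%N.
  by apply: leq_trans (card_linked conf pB); move: q7; case: (q) => [|[|[|]]].
case/card_gt0P => r rL; have [_ rB _ _] := mem_linked pB rL.
have npr : ~~ par p r by case/setIdP: rL.
exists p, r, n; split=> //; split=> // s sB.
have dr := linked_direction pB dn rL.
apply/orP/idP => [[ps | rs] | ns].
- by case: (class_direction pB dn rL sB ps).
- by case: (class_direction rB dr (linked_sym pB rL) sB rs).
(* Conversely, let [s] contain [n]. The members of the two classes through a point [c] of [C] on [s]
   contain the same affine line through [c] as [s], and three distinct C-planes cannot. *)
have [c [_ [cC _ cs _ _]]] := block_pts conf sB.
have [p' [p'B pp' cp']] := par_through conf pB cC.
have [r' [r'B rr' cr']] := par_through conf rB cC.
have [_ _ np' _] := class_direction pB dn rL p'B pp'.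
have [_ _ nr' _] := class_direction rB dr (linked_sym pB rL) r'B rr'.
have [-> | sp'] := eqVneq s p'; [by left | have [-> | sr'] := eqVneq s r'; [by right|]].
have p'r' := line_block_uniq sB p'B r'B cC pn n0 cs cp' cr' ns np' nr' sp' sr'.
case/negP: npr; rewrite -p'r' parallel_sym in rr'.
by rewrite parallel_sym in pp'; apply: (par_trans conf p'B).
Qed.

End Linked.

(** * Equations of C *)

Section Coordinates.

Variable F : finFieldType.
Local Notation W := 'rV[F]_5.

Definition comb (v0 v1 v2 v3 v4 : W) (a b c d e : F) : W :=
  a *: v0 + b *: v1 + c *: v2 + d *: v3 + e *: v4.

Lemma lfun_comb (f : 'Hom(W, F^o)) v0 v1 v2 v3 v4 a b c d e :
  f (comb v0 v1 v2 v3 v4 a b c d e) =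
  a * f v0 + b * f v1 + c * f v2 + d * f v3 + e * f v4.
Proof. by rewrite /comb !linearD !linearZ. Qed.

Definition comb_basis (v0 v1 v2 v3 v4 : W) :=
  (forall v, exists a b c d e, v = comb v0 v1 v2 v3 v4 a b c d e) /\
  (forall a b c d e, comb v0 v1 v2 v3 v4 a b c d e = 0 ->
     [/\ a = 0, b = 0, c = 0, d = 0 & e = 0]).

Lemma comb_inj v0 v1 v2 v3 v4 a b c d e a' b' c' d' e' :
  comb_basis v0 v1 v2 v3 v4 ->
  comb v0 v1 v2 v3 v4 a b c d e = comb v0 v1 v2 v3 v4 a' b' c' d' e' ->
  [/\ a = a', b = b', c = c', d = d' & e = e'].
Proof.
move=> [_ free] E; suff : comb v0 v1 v2 v3 v4 (a - a') (b - b') (c - c') (d - d') (e - e') = 0.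
  by case/free => /subr0_eq -> /subr0_eq -> /subr0_eq -> /subr0_eq -> /subr0_eq ->.
rewrite -[RHS](subrr (comb v0 v1 v2 v3 v4 a b c d e)) {2}E /comb.
by apply/rowP => i; rewrite !mxE; ring.
Qed.

Lemma comb_basis_forms v0 v1 v2 v3 v4 :
  (4 < \dim (<[v0]> + <[v1]> + <[v2]> + <[v3]> + <[v4]>))%N ->
  comb_basis v0 v1 v2 v3 v4 /\
  exists x0 x1 x2 x3 x4 : 'Hom(W, F^o),
    (forall v, v = comb v0 v1 v2 v3 v4 (x0 v) (x1 v) (x2 v) (x3 v) (x4 v)).
Proof.
move=> d5; pose X := [tuple v0; v1; v2; v3; v4].
have bX : basis_of fullv X.
  rewrite basisEdim dimvf dim_matrix /= andbT -dimv_leqif_sup ?subvf //.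
  rewrite eqn_leq dimvS ?subvf // dimvf dim_matrix.
  have -> : <<X>>%VS = (<[v0]> + <[v1]> + <[v2]> + <[v3]> + <[v4]>)%VS.
    by rewrite !span_cons span_nil addv0 !addvA.
  exact: d5.
have coordE v : v = comb v0 v1 v2 v3 v4 (coord X (inord 0) v) (coord X (inord 1) v)
   (coord X (inord 2) v) (coord X (inord 3) v) (coord X (inord 4) v).
  rewrite {1}(coord_basis bX (memvf v)) !big_ord_recr big_ord0 /= add0r /comb.
  by do ![congr (_ + _)]; congr (coord X _ v *: _); apply/val_inj; rewrite /= inordK.
split.
  split=> [v|a b c d e E].
    by do 5!eexists; apply: coordE.
  have /freeP fr := basis_free bX.
  pose k (i : 'I_5) := nth 0 [:: a; b; c; d; e] i.
  have kE : \sum_(i < 5) k i *: X`_i = 0.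
    by rewrite -[RHS]E !big_ord_recr big_ord0 /= add0r.
  have k0 := fr k kE.
  have := (k0 (inord 0), k0 (inord 1), k0 (inord 2), k0 (inord 3), k0 (inord 4)).
  by rewrite /k !inordK //= => -[[[[-> ->] ->] ->] ->].
pose x k : 'Hom(W, F^o) := linfun (coord X (inord k) : {linear W -> F^o}).
by exists (x 0%N), (x 1%N), (x 2%N), (x 3%N), (x 4%N) => v; rewrite !lfunE; apply: coordE.
Qed.

End Coordinates.

(** * The two rulings and the coordinates that they define *)

Section Pencils.

Variables (F : finFieldType) (phi : 'Hom('rV[F]_5, F^o)).
Variables (C : {set 'rV[F]_5}) (B : {set subspace F}).
Hypothesis conf : configuration phi C B.

Local Notation q := #|F|.
Local Notation W := 'rV[F]_5.
Implicit Types (p r s U V : {vspace W}) (a b c n v : W).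
Local Notation par := (parallel (vsec C)).
Let Caff := conf_aff conf.
Let Bdim := conf_dim conf.

Definition is_grid p r n := [/\ p \in B, r \in B & ~~ par p r] /\
  [/\ n != 0, phi n = 0 & forall s, s \in B -> par p s || par r s = (n \in s)].

Lemma is_grid_sym p r n : is_grid p r n -> is_grid r p n.
Proof.
move=> [[pB rB pr] [n0 pn H]]; split; first by rewrite parallel_sym.
by split=> // s sB; rewrite orbC H.
Qed.

Section Grid.

Variables (p r : {vspace W}) (n : W).
Hypothesis grid : is_grid p r n.

Lemma grid_mem s : s \in B -> par p s -> n \in s.
Proof. by move=> sB ps; have [_ [_ _ <- //]] := grid; rewrite ps. Qed.

Lemma grid_mem' s : s \in B -> par r s -> n \in s.
Proof. by move=> sB rs; have [_ [_ _ <- //]] := grid; rewrite rs orbT. Qed.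

Lemma grid_cross s t : s \in B -> t \in B -> par p s -> par r t -> ~~ par s t.
Proof.
move=> sB tB ps rt; have [[pB rB npr] _] := grid; apply: contraNN npr => st.
apply: (par_trans conf sB) => //; first by rewrite parallel_sym.
by apply: (par_trans conf tB) => //; rewrite parallel_sym.
Qed.

Lemma grid_cross_pt s t : s \in B -> t \in B -> par p s -> par r t ->
  exists c, [/\ c \in C, c \in s & c \in t].
Proof. by move=> sB tB ps rt; apply: (npar_meet sB tB); apply: grid_cross. Qed.

(** Projection from [n] is injective on [C]: the two grid planes through [a] both contain [n], so
    both would contain [b], yet they share only one point of [C]. *)
Lemma grid_noshare a b k : a \in C -> b \in C -> b = a + k *: n -> a = b.
Proof.
move=> aC bC bE; have [[pB rB npr] _] := grid.
have [s [sB ps as_]] := par_through conf pB aC.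
have [t [tB rt at_]] := par_through conf rB aC.
have st : s != t.
  by apply: contraNneq (grid_cross sB tB ps rt) => ->; apply: parallel_refl.
apply: (meet_uniq conf sB tB st aC bC) => //; rewrite bE memvD // memvZ //.
  exact: grid_mem.
exact: grid_mem'.
Qed.

Lemma grid_line s a b v : s \in B -> n \in s -> a \in C -> b \in C -> a \in s -> b \in s ->
  a != b -> v \in s -> exists x y z, v = x *: a + y *: b + z *: n.
Proof.
move=> sB ns aC bC as_ bs ab vs; have [_ [n0 pn _]] := grid.
have le3 : (\dim s <= 3)%N by rewrite (Bdim sB).
have ban : b \notin (<[a]> + <[n]>)%VS.
  apply/negP => /memv_addP[_ /vlineP[x ->] [_ /vlineP[y ->] bE]].
  have /eqP := Caff bC; rewrite bE linearD !linearZ /= (Caff aC) pn scaler0 addr0.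
  rewrite -[_ *: 1]/(_ * 1) mulr1 => /eqP x1; case/eqP: ab.
  by apply: (grid_noshare aC bC (k := y)); rewrite bE x1 scale1r.
have [x [z [y ->]]] := span3P le3 as_ ns bs (aff_neq0 (Caff aC))
  (dir_notin_line (Caff aC) pn n0) ban vs.
by exists x, y, z; rewrite addrAC.
Qed.

Lemma grid_aff_line s a b v : s \in B -> n \in s -> a \in C -> b \in C -> a \in s -> b \in s ->
  a != b -> v \in s -> phi v = 1 -> exists y z, v = (1 - y) *: a + y *: b + z *: n.
Proof.
move=> sB ns aC bC as_ bs ab vs pv; have [_ [n0 pn _]] := grid.
have [x [y [z vE]]] := grid_line sB ns aC bC as_ bs ab vs.
exists y, z; suff -> : 1 - y = x by [].
move: pv; rewrite vE !linearD !linearZ /= (Caff aC) (Caff bC) pn scaler0 addr0.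
by rewrite -![_ *: 1]/(_ * 1) !mulr1 => <-; rewrite addrK.
Qed.

(** Modulo [n] the plane [s] is a line, so if [f] were not constant on its points of [C], it would
    take all values there, in particular 0 at some [e]. The transversal through [e] meets [s0] and
    [s1] in points with values 0 and 1, so its only point of value 0 is the one on [s0]. Then
    [s = s0], where [f] is constant. *)
Lemma pencil_const (f : 'Hom(W, F^o)) s0 s1 : f n = 0 ->
  s0 \in B -> s1 \in B -> par p s0 -> par p s1 ->
  (forall c, c \in C -> c \in s0 -> f c = 0) -> (forall c, c \in C -> c \in s1 -> f c = 1) ->
  forall s c d, s \in B -> par p s -> c \in C -> d \in C -> c \in s -> d \in s -> f c = f d.
Proof.
move=> fn s0B s1B ps0 ps1 f0 f1 s c d sB ps cC dC cs ds; have [[pB rB npr] _] := grid.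
apply/eqP; apply: contraT => fcd.
have cd : c != d by apply: contraNneq fcd => ->.
have ns := grid_mem sB ps.
have inj : {in vsec C s &, injective f}.
  move=> a b /setIdP[aC as_] /setIdP[bC bs].
  have [y [z aE]] := grid_aff_line sB ns cC dC cs ds cd as_ (Caff aC).
  have [y' [z' bE]] := grid_aff_line sB ns cC dC cs ds cd bs (Caff bC).
  rewrite {1}aE {1}bE !linearD !linearZ /= fn !scaler0 !addr0.
  rewrite -![_ *: f _]/(_ * _) => E.
  have yy : y = y'.
    apply/eqP; rewrite -subr_eq0; apply/eqP.
    have : (y - y') * (f d - f c) = 0.
      have -> : (y - y') * (f d - f c) =
        ((1 - y) * f c + y * f d) - ((1 - y') * f c + y' * f d) by ring.
      by rewrite E subrr.
    by move/eqP; rewrite mulf_eq0 [f d - _ == 0]subr_eq0 [f d == _]eq_sym (negPf fcd) orbF => /eqP.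
  apply: (grid_noshare aC bC (k := z' - z)); rewrite bE aE yy.
  by apply/rowP => i; rewrite !mxE; ring.
have : f @: vsec C s = setT.
  by apply/eqP; rewrite eqEcard subsetT cardsT (card_in_imset inj) /vsec (conf_sec conf sB) leqnn.
move/setP/(_ 0); rewrite inE => /imsetP[e /setIdP[eC es] fe].
have [t [tB rt et]] := par_through conf rB eC.
have [a [aC as0 at_]] := grid_cross_pt s0B tB ps0 rt.
have [b [bC bs1 bt]] := grid_cross_pt s1B tB ps1 rt.
have ab : a != b.
  by apply: contra_eq_neq (f0 a aC as0) => ->; rewrite f1 // oner_neq0.
have [y [z eE]] := grid_aff_line tB (grid_mem' tB rt) aC bC at_ bt ab et (Caff eC).
have y0 : y = 0.
  move: fe; rewrite eE !linearD !linearZ /= fn (f0 a aC as0) (f1 b bC bs1) !scaler0 add0r addr0.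
  by rewrite -[_ *: 1]/(_ * _) mulr1.
have ae : a = e.
  by apply: (grid_noshare aC eC (k := z)); rewrite {1}eE y0 subr0 scale1r scale0r addr0.
have ss0 : s = s0.
  by apply: (par_uniq conf pB sB s0B ps ps0 eC es); rewrite -ae.
by move: fcd; rewrite !f0 ?eqxx // -ss0.
Qed.

End Grid.

End Pencils.

Section GridCoordinates.

Variables (F : finFieldType) (phi : 'Hom('rV[F]_5, F^o)).
Variables (C : {set 'rV[F]_5}) (B : {set subspace F}).
Hypothesis conf : configuration phi C B.

Local Notation q := #|F|.
Local Notation W := 'rV[F]_5.
Implicit Types (p r U V : {vspace W}).
Local Notation par := (parallel (vsec C)).
Let Caff := conf_aff conf.

Lemma grid_coordinates : exists (O e1 e2 e3 n : W) (h : F -> F -> F),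
  [/\ comb_basis O e1 e2 e3 n,
      phi O = 1, [/\ phi e1 = 0, phi e2 = 0, phi e3 = 0 & phi n = 0] &
      forall c, c \in C <-> exists s t, c = comb O e1 e2 e3 n 1 s t (s * t) (h s t)] /\
  let P s t := comb O e1 e2 e3 n 1 s t (s * t) (h s t) in
  [/\ forall s, exists b, [/\ b \in B, n \in b & forall t, P s t \in b],
      forall t, exists b, [/\ b \in B, n \in b & forall s, P s t \in b] &
      forall b, b \in B -> n \in b ->
        (exists s0, forall s t, P s t \in b -> s = s0) \/
        (exists t0, forall s t, P s t \in b -> t = t0)].
Proof.
have [p [r [n grid]]] := exists_grid conf; have grid' : is_grid phi C B r p n := is_grid_sym grid.
have [[pB rB npr] [n0 pn nP]] := grid; have CV := @not_in_solid _ _ _ _ conf.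
have cross s t : s \in B -> t \in B -> par p s -> par r t -> s != t.
  move=> sB tB ps rt; apply: contraNneq (grid_cross conf grid sB tB ps rt) => ->.
  exact: parallel_refl.
have [O [_ [OC _ _ _ _]]] := block_pts conf pB.
have [p0 [p0B pp0 Op0]] := par_through conf pB OC.
have [q0 [q0B rq0 Oq0]] := par_through conf rB OC.
have other s : s \in B -> O \in s -> exists c, [/\ c \in C, c \in s & c != O].
  move=> sB Os; have [a [b [aC bC as_ bs ab]]] := block_pts conf sB.
  have [aO | aO] := eqVneq a O; last by exists a.
  by exists b; rewrite -aO eq_sym.
have [c1 [c1C c1p0 c1O]] := other p0 p0B Op0.
have [c2 [c2C c2q0 c2O]] := other q0 q0B Oq0.
have [p1 [p1B pp1 c2p1]] := par_through conf pB c2C.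
have [q1 [q1B rq1 c1q1]] := par_through conf rB c1C.
have [c3 [c3C c3p1 c3q1]] := grid_cross_pt conf grid p1B q1B pp1 rq1.
have p01 : p0 != p1.
  apply: contraNneq (cross p0 q0 p0B q0B pp0 rq0) => p01; rewrite -p01 in c2p1.
  by apply/eqP; apply: (conf_uniq conf p0B q0B c2C OC).
have q01 : q0 != q1.
  apply: contraNneq (cross p0 q0 p0B q0B pp0 rq0) => q01; rewrite -q01 in c1q1.
  by apply/eqP; apply: (conf_uniq conf p0B q0B c1C OC).
have c23 : c2 != c3.
  apply: contraNneq q01 => c23; rewrite -c23 in c3q1.
  by apply/eqP; apply: (par_uniq conf rB q0B q1B rq0 rq1 c2C).
have c13 : c1 != c3.
  apply: contraNneq p01 => c13; rewrite -c13 in c3p1.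
  by apply/eqP; apply: (par_uniq conf pB p0B p1B pp0 pp1 c1C).
(* The points [O], [c1], [c3], [c2] are the vertices of the skew quadrilateral formed by two planes
   of each class; [e3] measures how far it is from a parallelogram. *)
pose e1 := c1 - O; pose e2 := c2 - O; pose e3 := c3 - c1 - c2 + O.
pose K := comb O e1 e2 e3 n.
have KO : O = K 1 0 0 0 0 by apply/rowP => i; rewrite !mxE; ring.
have K1 : c1 = K 1 1 0 0 0 by apply/rowP => i; rewrite !mxE; ring.
have K2 : c2 = K 1 0 1 0 0 by apply/rowP => i; rewrite !mxE; ring.
have K3 : c3 = K 1 1 1 1 0 by apply/rowP => i; rewrite !mxE; ring.
have Kn : n = K 0 0 0 0 1 by apply/rowP => i; rewrite !mxE; ring.
pose V := (<[O]> + <[e1]> + <[e2]> + <[e3]> + <[n]>)%VS.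
have KV a b c d e : K a b c d e \in V by rewrite /V /K !memv_add ?memvZ ?memv_line.
have grid_le s a b : s \in B -> n \in s -> a \in C -> b \in C -> a \in s -> b \in s ->
    a != b -> a \in V -> b \in V -> (s <= V)%VS.
  move=> sB ns aC bC as_ bs ab aV bV; apply/subvP => v vs.
  have [x [y [z ->]]] := grid_line conf grid sB ns aC bC as_ bs ab vs.
  by rewrite !memvD ?memvZ // Kn KV.
have p0V : (p0 <= V)%VS.
  by apply: (grid_le p0 c1 O) => //; rewrite ?K1 ?KO ?KV // (grid_mem grid).
have p1V : (p1 <= V)%VS.
  by apply: (grid_le p1 c2 c3) => //; rewrite ?K2 ?K3 ?KV // (grid_mem grid).
(* Each point of [C] lies on a transversal of [p0] and [p1], so what holds on these two planes
   extends to all of [C] by interpolation. *)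
have cutp c : c \in C -> exists t a b, [/\ t \in B, par r t & c \in t] /\
    [/\ [/\ a \in C, a \in p0 & a \in t], [/\ b \in C, b \in p1 & b \in t] & a != b].
  move=> cC; have [t [tB rt ct]] := par_through conf rB cC.
  have [a [aC ap at_]] := grid_cross_pt conf grid p0B tB pp0 rt.
  have [b [bC bp bt]] := grid_cross_pt conf grid p1B tB pp1 rt.
  exists t, a, b; split=> //; split=> //; apply: contraNneq p01 => ab; rewrite -ab in bp.
  by apply/eqP; apply: (par_uniq conf pB p0B p1B pp0 pp1 aC).
have /CV /comb_basis_forms [basis [x0 [x1 [x2 [x3 [x4 xE]]]]]] : {subset C <= V}.
  move=> c /cutp[t [a [b [[tB rt ct] [[aC ap at_] [bC bp bt] ab]]]]].
  have ns := grid_mem' grid tB rt.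
  have tV := grid_le t a b tB ns aC bC at_ bt ab (subvP p0V a ap) (subvP p1V b bp).
  exact: (subvP tV).
rewrite -/K in xE.
have xK a b c d e : [/\ x0 (K a b c d e) = a, x1 (K a b c d e) = b, x2 (K a b c d e) = c,
    x3 (K a b c d e) = d & x4 (K a b c d e) = e].
  by have := comb_inj basis (esym (xE (K a b c d e))).
have [O0 O1 O2 O3 O4] := xK 1 0 0 0 0; rewrite -KO in O0 O1 O2 O3 O4.
have [c10 c11 c12 c13' c14] := xK 1 1 0 0 0; rewrite -K1 in c10 c11 c12 c13' c14.
have [c20 c21 c22 c23' c24] := xK 1 0 1 0 0; rewrite -K2 in c20 c21 c22 c23' c24.
have [c30 c31 c32 c33 c34] := xK 1 1 1 1 0; rewrite -K3 in c30 c31 c32 c33 c34.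
have [n_0 n_1 n_2 n_3 n_4] := xK 0 0 0 0 1; rewrite -Kn in n_0 n_1 n_2 n_3 n_4.
have phiE : [/\ phi e1 = 0, phi e2 = 0 & phi e3 = 0].
  rewrite /e1 /e2 /e3 !linearD !linearN /= !(conf_aff conf) //.
  by split; rewrite ?subrr // sub0r addNr.
have [pe1 pe2 pe3] := phiE; have pO := Caff OC.
have x0E v : x0 v = phi v.
  by rewrite {2}(xE v) lfun_comb pO pe1 pe2 pe3 pn !mulr0 !addr0 mulr1.
have lineE (f : 'Hom(W, F^o)) y z a b : f n = 0 ->
    f ((1 - y) *: a + y *: b + z *: n) = (1 - y) * f a + y * f b.
  by move=> fn; rewrite !linearD !linearZ /= fn scaler0 addr0.
have onp0 (f : 'Hom(W, F^o)) y c : f n = 0 -> f O = y -> f c1 = y ->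
    c \in C -> c \in p0 -> f c = y.
  move=> fn fO f1 cC cp; rewrite eq_sym in c1O.
  have [u [v ->]] := grid_aff_line conf grid p0B (grid_mem grid p0B pp0) OC c1C Op0 c1p0 c1O cp (Caff cC).
  by rewrite lineE // fO f1 -mulrDl subrK mul1r.
have onp1 (f : 'Hom(W, F^o)) y c : f n = 0 -> f c2 = y -> f c3 = y ->
    c \in C -> c \in p1 -> f c = y.
  move=> fn fO f1 cC cp.
  have [u [v ->]] := grid_aff_line conf grid p1B (grid_mem grid p1B pp1) c2C c3C c2p1 c3p1 c23 cp (Caff cC).
  by rewrite lineE // fO f1 -mulrDl subrK mul1r.
have onq0 (f : 'Hom(W, F^o)) y c : f n = 0 -> f O = y -> f c2 = y ->
    c \in C -> c \in q0 -> f c = y.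
  move=> fn fO f1 cC cp; rewrite eq_sym in c2O.
  have [u [v ->]] := grid_aff_line conf grid q0B (grid_mem' grid q0B rq0) OC c2C Oq0 c2q0 c2O cp (Caff cC).
  by rewrite lineE // fO f1 -mulrDl subrK mul1r.
have onq1 (f : 'Hom(W, F^o)) y c : f n = 0 -> f c1 = y -> f c3 = y ->
    c \in C -> c \in q1 -> f c = y.
  move=> fn fO f1 cC cp.
  have [u [v ->]] := grid_aff_line conf grid q1B (grid_mem' grid q1B rq1) c1C c3C c1q1 c3q1 c13 cp (Caff cC).
  by rewrite lineE // fO f1 -mulrDl subrK mul1r.
have const2 := pencil_const conf grid n_2 p0B p1B pp0 pp1
  (fun c => onp0 x2 0 c n_2 O2 c12) (fun c => onp1 x2 1 c n_2 c22 c32).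
have const1 := pencil_const conf grid' n_1 q0B q1B rq0 rq1
  (fun c => onq0 x1 0 c n_1 O1 c21) (fun c => onq1 x1 1 c n_1 c11 c31).
(* Along the transversal through [c] the coordinate [x1] is constant, [x2] runs from 0 to 1, and
   [x3] runs from 0 on [p0] to the value of [x1] on [p1]; being affine, [x3] is their product. *)
have x3E c : c \in C -> x3 c = x1 c * x2 c.
  move=> cC; have [t [a [b [[tB rt ct] [[aC ap at_] [bC bp bt] ab]]]]] := cutp c cC.
  have [y [z cE]] := grid_aff_line conf grid tB (grid_mem' grid tB rt) aC bC at_ bt ab ct (Caff cC).
  have b31 : x3 b = x1 b.
    have := onp1 (x3 - x1) 0 b; rewrite !add_lfunE !opp_lfunE n_3 n_1 c23' c21 c33 c31 !subrr.
    by move=> /(_ erefl erefl erefl bC bp)/eqP; rewrite subr_eq0 => /eqP.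
  rewrite [in LHS]cE [in x2 c]cE !lineE // b31 (const1 t b c tB rt bC cC bt ct).
  rewrite (onp0 x3 0 a) // (onp0 x2 0 a) // (onp1 x2 1 b) //; ring.
have CE c : c \in C -> c = K 1 (x1 c) (x2 c) (x1 c * x2 c) (x4 c).
  by move=> cC; rewrite {1}(xE c) x0E (Caff cC) x3E.
have x12_inj : {in C &, injective (fun c => (x1 c, x2 c))}.
  move=> c d cC dC [E1 E2]; apply: (grid_noshare conf grid cC dC (k := x4 d - x4 c)).
  rewrite {1}(CE d dC) {1}(CE c cC) E1 E2; apply/rowP => i; rewrite !mxE; ring.
(* An injective map from the [q ^ 2] points of [C] to pairs of scalars is onto. *)
have x12_surj (st : F * F) : exists c, [/\ c \in C, x1 c = st.1 & x2 c = st.2].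
  have : (fun c => (x1 c : F, x2 c : F)) @: C = setT.
    apply/eqP; rewrite eqEcard subsetT cardsT card_prod mulnn -(conf_card conf).
    by rewrite (card_in_imset x12_inj) leqnn.
  by move/setP/(_ st); rewrite inE => /imsetP[c cC ->]; exists c.
have [g gP] := fin_all_exists x12_surj.
pose P s t := comb O e1 e2 e3 n 1 s t (s * t) (x4 (g (s, t))).
have PE s t : P s t = g (s, t).
  by have [gC /= g1 g2] := gP (s, t); rewrite (CE _ gC) g1 g2.
have PC s t : P s t \in C by rewrite PE; have [] := gP (s, t).
have P1 s t : x1 (P s t) = s by rewrite PE; have [] := gP (s, t).
have P2 s t : x2 (P s t) = t by rewrite PE; have [] := gP (s, t).
have CP c : c \in C -> c = P (x1 c) (x2 c).
  by move=> cC; apply: x12_inj => //=; rewrite P1 P2.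
exists O, e1, e2, e3, n, (fun s t => x4 (g (s, t))); split; [split=> // c; split | split].
- by move=> cC; exists (x1 c), (x2 c); apply: CP.
- by move=> [s [t ->]]; apply: PC.
- move=> s; have [b [bB rb sb]] := par_through conf rB (PC s 0).
  exists b; split=> // [|t]; first exact: (grid_mem' grid bB rb).
  have [u [uB pu tu]] := par_through conf pB (PC s t).
  have [d [dC du db]] := grid_cross_pt conf grid uB bB pu rb.
  rewrite -/(P s t); suff -> : P s t = d by [].
  rewrite (CP d dC) (const1 b d (P s 0)) // P1.
  by rewrite (const2 u d (P s t)) // P2.
- move=> t; have [b [bB pb sb]] := par_through conf pB (PC 0 t).
  exists b; split=> // [|s]; first exact: (grid_mem grid bB pb).
  have [u [uB ru tu]] := par_through conf rB (PC s t).
  have [d [dC db du]] := grid_cross_pt conf grid bB uB pb ru.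
  rewrite -/(P s t); suff -> : P s t = d by [].
  rewrite (CP d dC) (const2 b d (P 0 t)) // P2.
  by rewrite (const1 u d (P s t)) // P1.
move=> b bB; rewrite -nP // => /orP[pb | rb].
  right; have [c [_ [cC _ cb _ _]]] := block_pts conf bB.
  by exists (x2 c) => s t Pb; rewrite -(P2 s t); apply: (const2 b).
left; have [c [_ [cC _ cb _ _]]] := block_pts conf bB.
by exists (x1 c) => s t Pb; rewrite -(P1 s t); apply: (const1 b).
Qed.

End GridCoordinates.

(** * Polynomial functions over the field *)

Section FiniteField.

Variable F : finFieldType.

(** The order of the additive group kills 1; as it is odd, it would equal 1 in the field if 2 were
    0. *)
Lemma odd_two_neq0 : odd #|F| -> (2%:R : F) != 0.
Proof.
move=> oF; apply/negP => /eqP two0.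
have : (#|F|%:R : F) = 0.
  by rewrite -FinRing.zmodXgE -cardsT; apply: (expg_cardG (in_setT _)).
rewrite -(odd_double_half #|F|) oF natrD -muln2 natrM two0 mulr0 addr0.
by apply/eqP/oner_neq0.
Qed.

Lemma quartic_eq0 (a b c d e : F) : (5 <= #|F|)%N ->
  (forall x, a * x ^+ 4 + b * x ^+ 3 + c * x ^+ 2 + d * x + e = 0) ->
  [/\ a = 0, b = 0, c = 0, d = 0 & e = 0].
Proof.
move=> F5 H; pose p := Poly [:: e; d; c; b; a].
have p0 : p = 0.
  apply/eqP; apply: contraTT F5 => p_neq0; rewrite -ltnNge.
  have := max_poly_roots p_neq0 _ (enum_uniq F).
  rewrite -cardE => le; apply: (leq_trans (le _)); last exact: size_Poly.
  apply/allP => x _; rewrite rootE horner_Poly /= -[X in _ == X](H x).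
  by apply/eqP; ring.
have cE i : nth 0 [:: e; d; c; b; a] i = 0 by rewrite -coef_Poly -/p p0 coef0.
by split; [apply: (cE 4) | apply: (cE 3) | apply: (cE 2) | apply: (cE 1) | apply: (cE 0)].
Qed.

Lemma exists_avoiding (s : seq F) : (size s < #|F|)%N -> exists x : F, x \notin s.
Proof.
move=> lt; apply/existsP; apply: contraTT lt; rewrite negb_exists -leqNgt => /forallP H.
have sub : {subset enum F <= s} by move=> x _; have := H x; rewrite negbK.
by rewrite cardE; apply: uniq_leq_size sub; apply: enum_uniq.
Qed.

(** This is Lagrange interpolation at 0, 1 and -1; it lets the coefficients in [u] inherit a
    quadratic dependence on [v]. *)
Lemma quadratic_interpolation (f : F -> F) (a b c : F) : (2%:R : F) != 0 ->
  (forall x, f x = a * x ^+ 2 + b * x + c) ->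
  forall x, f x = f 0 + (f 1 - f (- 1)) / 2%:R * x + ((f 1 + f (- 1)) / 2%:R - f 0) * x ^+ 2.
Proof. by move=> two0 H x; rewrite !H; field. Qed.

(* In the coordinates u = (s + t) / 2 and v = (s - t) / 2, h is biquadratic; comparing
   the terms of degree 3 and 4 along two further lines through the origin
   shows that it is quadratic. *)
Lemma quadratic_on_lines (h : F -> F -> F) : (7 <= #|F|)%N -> (2%:R : F) != 0 ->
  (forall m k, m != 0 -> exists a b c, forall s, h s (m * s + k) = a * s ^+ 2 + b * s + c) ->
  exists a b c d e g, forall s t,
    h s t = a * s ^+ 2 + b * t ^+ 2 + c * (s * t) + d * s + e * t + g.
Proof.
move=> F7 two0 H; pose h' u v := h (u + v) (u - v).
have hu v : exists a b c, forall u, h' u v = a * u ^+ 2 + b * u + c.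
  have [a [b [c E]]] := H 1 (- (2%:R * v)) (oner_neq0 _).
  exists a, (a * v * 2%:R + b), (a * v ^+ 2 + b * v + c) => u.
  rewrite /h'; have -> : u - v = 1 * (u + v) + - (2%:R * v) by ring.
  by rewrite E; ring.
have hv u : exists a b c, forall v, h' u v = a * v ^+ 2 + b * v + c.
  have [|a [b [c E]]] := H (- 1) (2%:R * u); first by rewrite oppr_eq0 oner_neq0.
  exists a, (a * u * 2%:R + b), (a * u ^+ 2 + b * u + c) => v.
  rewrite /h'; have -> : u - v = - 1 * (u + v) + 2%:R * u by ring.
  by rewrite E; ring.
have [g00 [g01 [g02 [g10 [g11 [g12 [g20 [g21 [g22 gE]]]]]]]]] :
  exists g00 g01 g02 g10 g11 g12 g20 g21 g22, forall u v, h' u v =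
    (g00 + g01 * v + g02 * v ^+ 2) + (g10 + g11 * v + g12 * v ^+ 2) * u +
    (g20 + g21 * v + g22 * v ^+ 2) * u ^+ 2.
  have [a0 [b0 [c0 E0]]] := hv 0; have [a1 [b1 [c1 E1]]] := hv 1.
  have [a2 [b2 [c2 E2]]] := hv (- 1).
  exists c0, b0, a0, ((c1 - c2) / 2%:R), ((b1 - b2) / 2%:R), ((a1 - a2) / 2%:R).
  exists ((c1 + c2) / 2%:R - c0), ((b1 + b2) / 2%:R - b0), ((a1 + a2) / 2%:R - a0) => u v.
  have [a [b [c E]]] := hu v.
  rewrite (quadratic_interpolation two0 E) E0 E1 E2; by field.
(* On the line [v = c * u] the terms of degree 4 and 3 have coefficients [g22 * c ^ 2] and
   [c * (g21 + g12 * c)]. The values 1 and -1 of [c] are excluded because they give the lines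
   [t = 0] and [s = 0], on which nothing is assumed. *)
have slope c : c \notin [:: 0; 1; - 1] -> g22 = 0 /\ g21 + g12 * c = 0.
  rewrite !inE !negb_or => /and3P[c0 c1 cN1].
  have c10 : 1 + c != 0 by rewrite addrC -[1]opprK subr_eq0.
  have c1' : 1 - c != 0 by rewrite subr_eq0 eq_sym.
  have [|A [b [d E]]] := H ((1 - c) / (1 + c)) 0; first by rewrite mulf_neq0 ?invr_eq0.
  have {}E u : h' u (c * u) = A * (u + c * u) ^+ 2 + b * (u + c * u) + d.
    rewrite -E /h'; congr (h _ _); by field.
  have [||A0 B0 _ _ _] := @quartic_eq0 (g22 * c ^+ 2) (g12 * c ^+ 2 + g21 * c)
    (g02 * c ^+ 2 + g11 * c + g20 - A * (1 + c) ^+ 2) (g01 * c + g10 - b * (1 + c)) (g00 - d).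
  - exact: leq_trans F7.
  - by move=> u; apply/eqP; rewrite -(subrr (h' u (c * u))) {1}gE E; apply/eqP; ring.
  split.
    by move/eqP: A0; rewrite mulf_eq0 expf_eq0 (negPf c0) orbF => /eqP.
  apply/eqP; have : c * (g21 + g12 * c) == 0 by rewrite -B0; apply/eqP; ring.
  by rewrite mulf_eq0 (negPf c0).
have [c cN] := @exists_avoiding [:: 0; 1; - 1] (leq_trans (isT : (3 < 7)%N) F7).
have [d dN] := @exists_avoiding [:: c; 0; 1; - 1] (leq_trans (isT : (4 < 7)%N) F7).
rewrite inE negb_or in dN; case/andP: dN => dc dN.
have [G22 Ec] := slope c cN; have [_ Ed] := slope d dN.
have G12 : g12 = 0.
  have : g12 * (d - c) == 0 by rewrite -(subrr 0) -{1}Ed -Ec; apply/eqP; ring.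
  by rewrite mulf_eq0 subr_eq0 (negPf dc) orbF => /eqP.
have G21 : g21 = 0 by rewrite -Ec G12; ring.
exists ((g02 + g11 + g20) / 4%:R), ((g02 - g11 + g20) / 4%:R), ((g20 - g02) / 2%:R).
exists ((g01 + g10) / 2%:R), ((g10 - g01) / 2%:R), g00 => s t.
have -> : h s t = h' ((s + t) / 2%:R) ((s - t) / 2%:R).
  by rewrite /h'; congr (h _ _); field.
have four0 : (4%:R : F) != 0 by rewrite -[4%N]/(2 * 2)%N natrM mulf_neq0.
by rewrite gE G22 G12 G21; field; rewrite ?two0 ?four0.
Qed.

End FiniteField.

(** * The other C-planes lie over lines of the parameter plane *)

Section GridLines.

Variables (F : finFieldType) (phi : 'Hom('rV[F]_5, F^o)).
Variables (C : {set 'rV[F]_5}) (B : {set subspace F}).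
Hypothesis conf : configuration phi C B.

Local Notation q := #|F|.
Local Notation W := 'rV[F]_5.
Implicit Types (p r U V : {vspace W}).
Local Notation par := (parallel (vsec C)).
Let q7 := conf_ge7 conf.
Let Bdim := conf_dim conf.
Let q_gt1 : (1 < q)%N. Proof. exact: leq_trans q7. Qed.

Lemma grid_lines (O e1 e2 e3 n : W) (h : F -> F -> F)
    (P := fun s t => comb O e1 e2 e3 n 1 s t (s * t) (h s t)) :
  comb_basis O e1 e2 e3 n ->
  (forall c, c \in C <-> exists s t, c = P s t) ->
  (forall s, exists b, [/\ b \in B, n \in b & forall t, P s t \in b]) ->
  (forall t, exists b, [/\ b \in B, n \in b & forall s, P s t \in b]) ->
  (forall b, b \in B -> n \in b ->
        (exists s0, forall s t, P s t \in b -> s = s0) \/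
        (exists t0, forall s t, P s t \in b -> t = t0)) ->
  forall b s t s' t', b \in B -> P s t \in b -> P s' t' \in b ->
    (s != s' -> t != t' -> n \notin b) /\
    (P s t != P s' t' -> forall k, P (s + k * (s' - s)) (t + k * (t' - t)) \in b).
Proof.
move=> basis CP vert horz pencils b s t s' t' bB sb s'b.
have PC u v : P u v \in C by apply/CP; exists u, v.
have Pinj u v u' v' : P u v = P u' v' -> u = u' /\ v = v'.
  by move=> /(comb_inj basis)[_ -> -> _ _].
have Pneq u v u' v' : (u != u') || (v != v') -> P u v != P u' v'.
  by apply: contraTneq => /Pinj[-> ->]; rewrite !eqxx.
have vertE c u v v' : c \in B -> P u v \in c -> P u v' \in c -> v != v' ->
    n \in c /\ forall w, P u w \in c.
  move=> cB uv uv' vv'; have [d [dB nd ud]] := vert u.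
  suff -> : c = d by [].
  by apply: (conf_uniq conf cB dB (PC u v) (PC u v')) => //; rewrite Pneq // vv' orbT.
have horzE c u u' v : c \in B -> P u v \in c -> P u' v \in c -> u != u' ->
    n \in c /\ forall w, P w v \in c.
  move=> cB uv uv' uu'; have [d [dB nd vd]] := horz v.
  suff -> : c = d by [].
  by apply: (conf_uniq conf cB dB (PC u v) (PC u' v)) => //; rewrite Pneq // uu'.
have nb : s != s' -> t != t' -> n \notin b.
  move=> ss' tt'; apply/negP => /(pencils b bB)[[s0 H] | [t0 H]].
    by case/eqP: ss'; rewrite (H s t) // (H s' t').
  by case/eqP: tt'; rewrite (H s t) // (H s' t').
split=> // Pne k.
have [ss' | ss'] := eqVneq s s'.
  subst s'; rewrite subrr mulr0 addr0; have [|_ H] := vertE b s t t' bB sb s'b; last exact: H.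
  by apply: contraNneq Pne => ->.
have [tt' | tt'] := eqVneq t t'.
  subst t'; rewrite subrr mulr0 addr0; have [|_ H] := horzE b s s' t bB sb s'b; last exact: H.
  by apply: contraNneq Pne => ->.
have {}nb := nb ss' tt'.
have fun1 u v v' : P u v \in b -> P u v' \in b -> v = v'.
  move=> uv uv'; apply/eqP; apply: contraNT nb => vv'.
  by have [] := vertE b u v v' bB uv uv' vv'.
have fun2 u u' v : P u v \in b -> P u' v \in b -> u = u'.
  move=> uv uv'; apply/eqP; apply: contraNT nb => uu'.
  by have [] := horzE b u u' v bB uv uv' uu'.
pose S := [set st : F * F | P st.1 st.2 \in b].
have cS : #|S| = q.
  rewrite -(conf_sec conf bB) -(card_imset _ (_ : injective (fun st : F * F => P st.1 st.2))).
    apply: eq_card => c; rewrite inE; apply/imsetP/andP => [[[u v] /[1!inE] /= uv ->] | []].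
      by rewrite PC uv.
    by move=> /CP[u [v ->]] uv; exists (u, v); rewrite ?inE.
  by move=> [u v] [u' v'] /= /Pinj[-> ->].
(* The [q] points of [b] have distinct first parameters, so every value occurs. *)
have onto u : exists v, P u v \in b.
  have : [set st.1 | st in S] = setT.
    apply/eqP; rewrite eqEcard subsetT cardsT card_in_imset ?cS ?leqnn //.
    move=> [u1 v1] [u2 v2]; rewrite !inE /= => uv uv' E; rewrite -E in uv' *.
    by rewrite (fun1 _ _ _ uv uv').
  by move/setP/(_ u); rewrite inE => /imsetP[[u1 v] /[1!inE] /= uv ->]; exists v.
(* The span of [b] and [n] is proper, so a nonzero form vanishes on it; being zero at [n], it does
   not see [h] and gives an equation in [u] and [v] alone. *)
have dU : ~~ (fullv <= b + <[n]>)%VS.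
  by apply/negP => /dimvS; rewrite dim_add_line // (Bdim bB) dimvf dim_matrix.
have [w _ wU] := subvPn dU.
have [f [f0 fw]] := separating_form wU.
have fn : f n = 0 by apply: f0; apply: (subvP (addvSr _ _)); apply: memv_line.
have fb u v : P u v \in b -> f O + u * f e1 + v * f e2 + u * v * f e3 = 0.
  move=> uv; have : f (P u v) = 0.
    by apply: f0; apply: (subvP (addvSl _ _)).
  by rewrite lfun_comb fn mulr0 addr0 mul1r.
(* Otherwise the equation is that of a hyperbola with asymptote [u = u0]. Since [b] has a point over
   [u0], it splits as [(u - u0) * (v * f e3 + f e1) = 0], so [v] is constant off [u0], against
   [fun2]. *)
have g0 : f e3 = 0.
  apply/eqP; apply: contraT => g0.
  have [u0 e2E] : exists u0, f e2 = - (u0 * f e3).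
    by exists (- f e2 / f e3); rewrite divfK // opprK.
  have [v0 uv0] := onto u0.
  have dE : f O = - (u0 * f e1).
    apply/eqP; rewrite -subr_eq0 opprK -(fb _ _ uv0) e2E; apply/eqP; ring.
  have vE u v : u != u0 -> P u v \in b -> v = - f e1 / f e3.
    move=> uu0 uv; apply: (mulIf g0); rewrite divfK //; apply/eqP; rewrite -subr_eq0 opprK.
    have : (u - u0) * (v * f e3 + f e1) == 0.
      by rewrite -(fb _ _ uv) dE e2E; apply/eqP; ring.
    by rewrite mulf_eq0 [u - u0 == 0]subr_eq0 (negPf uu0).
  have [u1 uN1] := @exists_avoiding _ [:: u0] q_gt1.
  have [u2 uN2] := @exists_avoiding _ [:: u0; u1] (leq_trans (isT : (2 < 7)%N) q7).
  move: uN1 uN2; rewrite !inE negb_or => u1u0 /andP[u2u0 u2u1].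
  have [v1 uv1] := onto u1; have [v2 uv2] := onto u2.
  have E12 : v1 = v2 by rewrite (vE _ _ u1u0 uv1) (vE _ _ u2u0 uv2).
  by case/eqP: u2u1; rewrite E12 in uv1; apply: fun2 uv2 uv1.
have {}fb u v : P u v \in b -> f O + u * f e1 + v * f e2 = 0.
  by move=> /fb; rewrite g0 mulr0 addr0.
(* If [f e2] vanished, two points with different [s] would force [f e1 = 0] and [f O = 0], and [f]
   would be the zero form. *)
have be0 : f e2 != 0.
  apply/negP => /eqP b0.
  have fs := fb _ _ sb; have fs' := fb _ _ s'b; rewrite b0 !mulr0 !addr0 in fs fs'.
  have a0 : f e1 = 0.
    apply/eqP; have : (s - s') * f e1 == 0 by rewrite -(subrr 0) -{1}fs -fs'; apply/eqP; ring.
    by rewrite mulf_eq0 subr_eq0 (negPf ss').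
  rewrite a0 mulr0 addr0 in fs; have [[x [y [z [x' [y' wE]]]]] _] := (basis.1 w, basis.2).
  have := oner_neq0 F; rewrite -fw wE lfun_comb fs a0 b0 g0 fn !mulr0 !addr0.
  by rewrite eqxx.
set u := s + k * (s' - s); have [v uv] := onto u.
suff <- : v = t + k * (t' - t) by [].
apply/eqP; rewrite -subr_eq0.
have : f e2 * (v - (t + k * (t' - t))) == 0.
  have -> : f e2 * (v - (t + k * (t' - t))) = (f O + u * f e1 + v * f e2)
    - (1 - k) * (f O + s * f e1 + t * f e2) - k * (f O + s' * f e1 + t' * f e2).
    by rewrite /u; ring.
  by rewrite !fb // !mulr0 !subr0.
by rewrite mulf_eq0 (negPf be0).
Qed.

End GridLines.

(** * Diagonal form of [h] and its anisotropy *)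

Section NormalForm.

Variables (F : finFieldType) (phi : 'Hom('rV[F]_5, F^o)).
Variables (C : {set 'rV[F]_5}) (B : {set subspace F}).
Hypothesis conf : configuration phi C B.

Local Notation q := #|F|.
Local Notation W := 'rV[F]_5.
Implicit Types (p r U V : {vspace W}).
Local Notation par := (parallel (vsec C)).
Let Caff := conf_aff conf.
Let Bdim := conf_dim conf.

Lemma normal_form : exists (O e1 e2 e3 n : W) (a b : F)
    (P := fun s t => comb O e1 e2 e3 n 1 s t (s * t) (a * s ^+ 2 + b * t ^+ 2)),
  [/\ comb_basis O e1 e2 e3 n,
      phi O = 1 /\ [/\ phi e1 = 0, phi e2 = 0, phi e3 = 0 & phi n = 0],
      forall d e, b * e ^+ 2 = a * d ^+ 2 -> d = 0 /\ e = 0,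
      forall c, c \in C <-> exists s t, c = P s t &
      forall p s t s' t', p \in B -> P s t \in p -> P s' t' \in p -> P s t != P s' t' ->
        forall k, P (s + k * (s' - s)) (t + k * (t' - t)) \in p].
Proof.
have two0 := odd_two_neq0 (conf_odd conf).
have [O [e1 [e2 [e3 [n [h [[basis phiO phiE CP] [vert horz pencils]]]]]]]] := grid_coordinates conf.
have [pe1 pe2 pe3 pn] := phiE.
pose P s t := comb O e1 e2 e3 n 1 s t (s * t) (h s t).
have lines b s t s' t' : b \in B -> P s t \in b -> P s' t' \in b ->
    (s != s' -> t != t' -> n \notin b) /\
    (P s t != P s' t' -> forall k, P (s + k * (s' - s)) (t + k * (t' - t)) \in b).
  exact: (grid_lines conf basis CP vert horz pencils).
have PC u v : P u v \in C by apply/CP; exists u, v.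
have Pinj u v u' v' : P u v = P u' v' -> u = u' /\ v = v'.
  by move=> /(comb_inj basis)[_ -> -> _ _].
(* The C-plane over this line misses [n], so some form vanishes on the plane and is 1 at [n];
   solving its equation for the last coordinate exhibits [h] as quadratic. *)
have hq m k : m != 0 -> exists a b c, forall s, h s (m * s + k) = a * s ^+ 2 + b * s + c.
  move=> m0; have ne : P 0 k != P 1 (m + k).
    by apply/eqP => /Pinj[/eqP]; rewrite eq_sym oner_eq0.
  have [p pB /andP[P0 P1]] := conf_block conf (PC 0 k) (PC 1 (m + k)) ne.
  have [nb ln] := lines p 0 k 1 (m + k) pB P0 P1.
  have {}nb : n \notin p.
    apply: nb; first by rewrite eq_sym oner_neq0.
    by rewrite eq_sym -subr_eq0 addrK.
  have [f [f0 fn]] := separating_form nb.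
  exists (- (m * f e3)), (- (f e1 + m * f e2 + k * f e3)), (- (f O + k * f e2)) => s.
  have sp : P s (m * s + k) \in p.
    have -> : P s (m * s + k) = P (0 + s * (1 - 0)) (k + s * (m + k - k)).
      by congr (P _ _); ring.
    exact: ln ne s.
  have := f0 _ sp; rewrite lfun_comb fn mulr1 => E.
  apply/eqP; rewrite -subr_eq0 -E; apply/eqP; ring.
have [a [b [g3 [g1 [g2 [g0 hE]]]]]] := quadratic_on_lines (conf_ge7 conf) two0 hq.
(* The terms in 1, [s], [t] and [s * t] of [h] are multiples of the other coordinates of the point,
   so a shear along [n] absorbs them. *)
pose O' := O + g0 *: n; pose e1' := e1 + g1 *: n; pose e2' := e2 + g2 *: n.
pose e3' := e3 + g3 *: n.
have combE x0 x1 x2 x3 x4 : comb O' e1' e2' e3' n x0 x1 x2 x3 x4 =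
    comb O e1 e2 e3 n x0 x1 x2 x3 (x4 + g0 * x0 + g1 * x1 + g2 * x2 + g3 * x3).
  by apply/rowP => i; rewrite !mxE; ring.
pose Q s t := comb O' e1' e2' e3' n 1 s t (s * t) (a * s ^+ 2 + b * t ^+ 2).
have QE s t : Q s t = P s t.
  by rewrite /Q combE /P hE; congr (comb _ _ _ _ _ _ _ _ _ _); ring.
have basis' : comb_basis O' e1' e2' e3' n.
  split=> [v | x0 x1 x2 x3 x4].
    have [x0 [x1 [x2 [x3 [x4 ->]]]]] := basis.1 v.
    exists x0, x1, x2, x3, (x4 - (g0 * x0 + g1 * x1 + g2 * x2 + g3 * x3)).
    by rewrite combE; congr (comb _ _ _ _ _ _ _ _ _ _); ring.
  rewrite combE => /(basis.2)[-> -> -> ->]; rewrite !mulr0 !addr0.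
  by move=> ->.
have QC s t : Q s t \in C by rewrite QE.
have Qinj u v u' v' : Q u v = Q u' v' -> u = u' /\ v = v' by rewrite !QE; apply: Pinj.
have Qlines p s t s' t' : p \in B -> Q s t \in p -> Q s' t' \in p -> Q s t != Q s' t' ->
    forall k, Q (s + k * (s' - s)) (t + k * (t' - t)) \in p.
  by move=> pB; rewrite !QE => sp s'p ne k; rewrite QE; have [_ ln] := lines p s t s' t' pB sp s'p; apply: ln.
have phiQ x0 x1 x2 x3 x4 : phi (comb O' e1' e2' e3' n x0 x1 x2 x3 x4) = x0.
  by rewrite combE lfun_comb phiO pe1 pe2 pe3 pn !mulr0 !addr0 mulr1.
have Q0 d e : (d != 0) || (e != 0) -> Q 0 0 != Q d e.
  by apply: contraTneq => /Qinj[<- <-]; rewrite eqxx.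
have block0 d e : (d != 0) || (e != 0) -> exists p, [/\ p \in B, Q 0 0 \in p &
    forall k, Q (k * d) (k * e) \in p].
  move=> de; have [p pB /andP[p0 p1]] := conf_block conf (QC 0 0) (QC d e) (Q0 d e de).
  exists p; split=> // k.
  by have := Qlines p 0 0 d e pB p0 p1 (Q0 d e de) k; rewrite !add0r !subr0.
have third s t s' t' : Q s t != Q s' t' ->
    Q (s - (s' - s)) (t - (t' - t)) != Q s t /\ Q (s - (s' - s)) (t - (t' - t)) != Q s' t'.
  have two (x y : F) : x - (y - x) = y -> x = y.
    move=> E; apply: subr0_eq; apply: (mulfI two0); rewrite mulr0.
    have -> : 2%:R * (x - y) = x - (y - x) - y by ring.
    by rewrite E subrr.
  have one (x y : F) : x - (y - x) = x -> x = y.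
    move=> E; apply/eqP; rewrite -subr_eq0.
    have -> : x - y = x - (y - x) - x by ring.
    by rewrite E subrr.
  by move=> ne; split; apply: contraNneq ne => /Qinj[]; [move=> /one -> /one ->|move=> /two -> /two ->].
have arcQ p s t s' t' : Q s t != Q s' t' -> p \in B -> Q s t \in p -> Q s' t' \in p ->
    Q (s - (s' - s)) (t - (t' - t)) \in p /\
    Q (s - (s' - s)) (t - (t' - t)) \notin (<[Q s t]> + <[Q s' t']>)%VS.
  move=> ne pB sp s'p; have [ne1 ne2] := third _ _ _ _ ne.
  have := Qlines p _ _ _ _ pB sp s'p ne (- 1); rewrite !mulN1r => s''p; split=> //.
  exact: (conf_arc conf pB (QC _ _) (QC _ _) (QC _ _)).
have nz d e : (d != 0) || (e != 0) -> d * e = 0 -> a * d ^+ 2 + b * e ^+ 2 != 0.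
  move=> de de0; have [p [pB p0 pk]] := block0 d e de.
  have p1 := pk 1; rewrite !mul1r in p1.
  have [_] := arcQ p 0 0 d e (Q0 d e de) pB p0 p1; rewrite !subr0 !sub0r.
  apply: contra => /eqP q0.
  have -> : Q (- d) (- e) = 2%:R *: Q 0 0 + (- 1) *: Q d e.
    rewrite /Q mulrNN !sqrrN de0 q0; apply/rowP => i; rewrite !mxE; ring.
  by rewrite memv_add // memvZ ?memv_line.
have a0 : a != 0.
  by have := nz 1 0; rewrite oner_neq0 mulr0 expr0n expr1n mulr0 addr0 mulr1; apply.
have b0 : b != 0.
  by have := nz 0 1; rewrite oner_neq0 orbT mul0r expr0n expr1n mulr0 add0r mulr1; apply.
(* Suppose equality. The midpoint [v] of [Q 1 m] and [Q (- 1) (- m)] is in [p] but not in [C]: it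
   lies over the origin, where the third coordinate of a point of [C] is 0 and not [m]. By (A3) a
   second C-plane [r] contains [v]; its direction turns out to be [(1, m)] as well, so [r = p]. *)
have bm m : b * m ^+ 2 != a.
  have [-> | m0] := eqVneq m 0; first by rewrite expr0n mulr0 eq_sym.
  apply/negP => /eqP aE.
  have [|p [pB p0 pk]] := block0 1 m; first by rewrite oner_neq0.
  have p1 := pk 1; have pN1 := pk (- 1); rewrite !mul1r in p1; rewrite !mulN1r in pN1.
  pose v := comb O' e1' e2' e3' n 1 0 0 m (a + b * m ^+ 2).
  have vp : v \in p.
    have -> : v = 2%:R^-1 *: (Q 1 m + Q (- 1) (- m)).
      by apply/rowP => i; rewrite !mxE; field.
    by rewrite memvZ // memvD.
  have vC : v \notin C.
    apply/negP => /CP[s [t]]; rewrite -/(P s t) -QE => /(comb_inj basis')[_ <- <- mE _].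
    by move: m0; rewrite mE mulr0 eqxx.
  have [r rB /andP[rp vr]] := conf_ge2 conf (phiQ _ _ _ _ _) vC pB vp.
  have [c0 [c1 [c0C c1C c0r c1r c01]]] := block_pts conf rB.
  move/CP: c0C => [s0 [t0]]; rewrite -/(P s0 t0) -QE => c0E.
  move/CP: c1C => [s1 [t1]]; rewrite -/(P s1 t1) -QE => c1E.
  rewrite {}c0E {}c1E in c0r c1r c01.
  have spanr s t s' t' : Q s t != Q s' t' -> Q s t \in r -> Q s' t' \in r ->
      exists x y z, v = x *: Q s t + y *: Q s' t' + z *: Q (s - (s' - s)) (t - (t' - t)).
    move=> ne sr s'r; have [s''r arc] := arcQ r s t s' t' ne rB sr s'r.
    have le3 : (\dim r <= 3)%N by rewrite (Bdim rB).
    apply: (span3P le3 sr s'r s''r _ _ arc vr).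
      exact: (aff_neq0 (Caff (QC _ _))).
    exact: (aff_notin_line (Caff (QC _ _)) (Caff (QC _ _)) ne).
  have lin x y z s t s' t' s'' t'' : x *: Q s t + y *: Q s' t' + z *: Q s'' t'' =
      comb O' e1' e2' e3' n (x + y + z) (x * s + y * s' + z * s'') (x * t + y * t' + z * t'')
        (x * (s * t) + y * (s' * t') + z * (s'' * t''))
        (x * (a * s ^+ 2 + b * t ^+ 2) + y * (a * s' ^+ 2 + b * t' ^+ 2) +
         z * (a * s'' ^+ 2 + b * t'' ^+ 2)).
    by apply/rowP => i; rewrite !mxE; ring.
  (* The parameters of [v] are an affine combination of those of points of [r], so the origin is on
     the line below [r]. *)
  have r0 : Q 0 0 \in r.
    have [x [y [z]]] := spanr _ _ _ _ c01 c0r c1r; rewrite lin => /(comb_inj basis')[E0 E1 E2 _ _].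
    have -> : Q 0 0 = Q (s0 + (y - z) * (s1 - s0)) (t0 + (y - z) * (t1 - t0)).
      have xE : x = 1 - y - z by rewrite E0; ring.
      by congr (Q _ _); [rewrite [LHS]E1 xE | rewrite [LHS]E2 xE]; ring.
    exact: Qlines.
  have [d [e' [de der]]] : exists d e', Q 0 0 != Q d e' /\ Q d e' \in r.
    by have [c0E | ?] := eqVneq (Q 0 0) (Q s0 t0); [exists s1, t1; rewrite c0E | exists s0, t0].
  have [x [y [z]]] := spanr _ _ _ _ de r0 der.
  rewrite lin => /(comb_inj basis')[_ E1 E2 E3 E4].
  have dd : (d != 0) || (e' != 0).
    by apply: contraNT de; rewrite negb_or !negbK => /andP[/eqP -> /eqP ->].
  have yz : y = z.
    have D1 : (y - z) * d == 0 by rewrite {1}E1; apply/eqP; ring.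
    have D2 : (y - z) * e' == 0 by rewrite {1}E2; apply/eqP; ring.
    apply/eqP; rewrite -subr_eq0; move: D1 D2; rewrite !mulf_eq0.
    by case: (y - z == 0) => //= /eqP d0 /eqP e0; move: dd; rewrite d0 e0 eqxx.
  have mE : m = 2%:R * y * (d * e') by rewrite E3 yz; ring.
  have y0 : y != 0 by apply: contraNneq m0 => y0; rewrite mE y0 mulr0 mul0r.
  have sq : m ^+ 2 = y * (m ^+ 2 * d ^+ 2 + e' ^+ 2).
    apply: (mulfI two0); apply: (mulfI b0).
    have -> : b * (2%:R * m ^+ 2) = a + b * m ^+ 2 by rewrite -aE; ring.
    by rewrite E4 -aE yz; ring.
  (* With [a = b * m ^ 2], the last two coordinates of [v] combine into the perfect square
     [y * (e' - d * m) ^ 2 = 0]. *)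
  have e'E : e' = d * m.
    have : y * (e' - d * m) ^+ 2 == 0.
      have -> : y * (e' - d * m) ^+ 2 = y * (m ^+ 2 * d ^+ 2 + e' ^+ 2) - 2%:R * y * (d * e') * m.
        by ring.
      by rewrite -sq -mE expr2 subrr.
    by rewrite mulf_eq0 (negPf y0) expf_eq0 /= subr_eq0 => /eqP.
  have := pk d; rewrite mulr1 -e'E => dep.
  by case/eqP: rp; apply: (conf_uniq conf rB pB (QC 0 0) (QC d e') de).
exists O', e1', e2', e3', n, a, b; split=> //.
- split; first by rewrite -[RHS](phiQ 1 0 0 0 0); congr (phi _); apply/rowP => i; rewrite !mxE; ring.
  split=> //.
  + by rewrite -[RHS](phiQ 0 1 0 0 0); congr (phi _); apply/rowP => i; rewrite !mxE; ring.
  + by rewrite -[RHS](phiQ 0 0 1 0 0); congr (phi _); apply/rowP => i; rewrite !mxE; ring.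
  + by rewrite -[RHS](phiQ 0 0 0 1 0); congr (phi _); apply/rowP => i; rewrite !mxE; ring.
- move=> x y E; have [x0 | x0] := eqVneq x 0.
    by move/eqP: E; rewrite x0 expr0n mulr0 mulf_eq0 (negPf b0) expf_eq0 /= => /eqP.
  have := bm (y / x); rewrite expr_div_n mulrA E -mulrA divff ?mulr1 ?eqxx //.
  by rewrite expf_eq0.
- move=> c'; split=> [/CP[s [t E]] | [s [t ->]]]; last exact: QC.
  by exists s, t; rewrite -/(Q s t) QE.
Qed.

End NormalForm.

(** * Conics and tangents *)

Section Points.

Variable F : finFieldType.
Local Notation W := 'rV[F]_5.
Implicit Types (v w : W) (X U : subspace F).

Lemma is_pointP X : reflect (exists2 v, v != 0 & X = <[v]>%VS) (is_point X).
Proof.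
apply: (iffP idP) => [/eqP d1 | [v v0 ->]]; last by rewrite /is_point dim_vline v0.
have X0 : X != 0%VS by rewrite -dimv_eq0 d1.
exists (vpick X); first by rewrite vpick0.
by apply/eqP; rewrite eq_sym eqEdim -memvE memv_pick d1 dim_vline vpick0 X0.
Qed.

Lemma points_ofP U X : reflect (exists v, [/\ v != 0, v \in U & X = <[v]>%VS]) (X \in points_of U).
Proof.
rewrite inE; apply: (iffP andP) => [[/is_pointP[v v0 ->] XU] | [v [v0 vU ->]]].
  by exists v; rewrite v0 memvE.
by rewrite -memvE; split=> //; apply/is_pointP; exists v.
Qed.

Lemma line_eq v w : v != 0 -> v \in <[w]>%VS -> <[v]>%VS = <[w]>%VS.
Proof.
move=> v0 vw; apply/eqP; rewrite eqEdim -memvE vw !dim_vline v0 /=.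
by case: (w != 0).
Qed.

Lemma line_scale k v : k != 0 -> <[k *: v]>%VS = <[v]>%VS.
Proof.
move=> k0; have [-> | v0] := eqVneq v 0; first by rewrite scaler0.
by apply: line_eq; rewrite ?scaler_eq0 ?negb_or ?k0 // memvZ // memv_line.
Qed.

Lemma form_col (f : 'Hom(W, F^o)) : exists c : 'cV[F]_5, forall v, f v = (v *m c) 0 0.
Proof.
exists (\col_i f (delta_mx 0 i)) => v.
rewrite {1}[v]row_sum_delta linear_sum mxE; apply: eq_bigr => i _.
by rewrite linearZ mxE.
Qed.

Lemma polarE (M : 'M[F]_5) v w :
  polar M v w = (v *m M *m w^T) 0 0 + (w *m M *m v^T) 0 0.
Proof.
rewrite /polar mulmxDr mulmxDl mxE; congr (_ + _).
have -> : v *m M^T *m w^T = (w *m M *m v^T)^T by rewrite !trmx_mul !trmxK mulmxA.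
by rewrite mxE.
Qed.

Lemma qform_scale (M : 'M[F]_5) k v : qform M (k *: v) = k ^+ 2 * qform M v.
Proof. by rewrite /qform linearZ /= -!scalemxAl -scalemxAr scalerA mxE. Qed.

End Points.

Section Conic.

Variables (F : finFieldType) (phi : 'Hom('rV[F]_5, F^o)) (P D E : 'rV[F]_5).
Local Notation W := 'rV[F]_5.
Hypotheses (F7 : (7 <= #|F|)%N) (two0 : (2%:R : F) != 0).
Hypotheses (pP : phi P = 1) (pD : phi D = 0) (pE : phi E = 0).
Hypothesis indep : forall d e, d *: D + e *: E = 0 -> d = 0 /\ e = 0.

Local Notation p := (<[P]> + <[D]> + <[E]>)%VS.
Definition parabola : {set subspace F} := [set <[P + k *: D + (k ^+ 2) *: E]>%VS | k : F].

Lemma parabola_span v : v \in p <-> exists x y z, v = x *: P + y *: D + z *: E.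
Proof.
split=> [/memv_addP[w /memv_addP[u /vlineP[x ->]]] | [x [y [z ->]]]].
  by move=> [u' /vlineP[y ->] ->] [u'' /vlineP[z ->] ->]; exists x, y, z.
by rewrite !memv_add // memvZ // memv_line.
Qed.

Lemma parabola_free x y z : x *: P + y *: D + z *: E = 0 -> [/\ x = 0, y = 0 & z = 0].
Proof.
move=> H; have := congr1 phi H; rewrite !linearD !linearZ linear0 /= pP pD pE !scaler0 !addr0.
rewrite -[_ *: 1]/(_ * 1) mulr1 => x0; move: H; rewrite x0 scale0r add0r.
by move=> /indep[-> ->].
Qed.

Lemma parabola_inj x y z x' y' z' :
  x *: P + y *: D + z *: E = x' *: P + y' *: D + z' *: E -> [/\ x = x', y = y' & z = z'].
Proof.
move=> /eqP; rewrite -subr_eq0 => /eqP H.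
have /parabola_free[] : (x - x') *: P + (y - y') *: D + (z - z') *: E = 0.
  by rewrite -H; apply/rowP => i; rewrite !mxE; ring.
by move=> /subr0_eq -> /subr0_eq -> /subr0_eq ->.
Qed.

Lemma parabola_forms : exists f g : 'Hom(W, F^o), forall x y z,
  f (x *: P + y *: D + z *: E) = y /\ g (x *: P + y *: D + z *: E) = z.
Proof.
have DN : D \notin (<[P]> + <[E]>)%VS.
  apply/negP => /memv_addP[u /vlineP[x ->] [w /vlineP[z ->] DE]].
  have [] := @parabola_inj 0 1 0 x 0 z; last by move=> _ /eqP; rewrite oner_eq0.
  by rewrite !scale0r scale1r add0r !addr0 DE.
have EN : E \notin (<[P]> + <[D]>)%VS.
  apply/negP => /memv_addP[u /vlineP[x ->] [w /vlineP[z ->] EE]].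
  have [] := @parabola_inj 0 0 1 x z 0; last by move=> _ _ /eqP; rewrite oner_eq0.
  by rewrite !scale0r scale1r !add0r addr0 EE.
have [f [f0 f1]] := separating_form DN; have [g [g0 g1]] := separating_form EN.
exists f, g => x y z; rewrite !linearD !linearZ /= f1 g1.
have sl (U V : {vspace W}) v : v \in U -> v \in (U + V)%VS by move=> vU; apply: (subvP (addvSl _ _)).
have sr (U V : {vspace W}) v : v \in V -> v \in (U + V)%VS by move=> vU; apply: (subvP (addvSr _ _)).
rewrite (f0 P (sl _ _ _ (memv_line P))) (f0 E (sr _ _ _ (memv_line E))).
rewrite (g0 P (sl _ _ _ (memv_line P))) (g0 D (sr _ _ _ (memv_line D))).
by rewrite !scaler0 !add0r !addr0 -![_ *: 1]/(_ * 1) !mulr1.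
Qed.

Lemma parabola_conic : is_conic p (<[E]>%VS |: parabola).
Proof.
have [f [g fgE]] := parabola_forms.
have [cp cpE] := form_col phi; have [cf cfE] := form_col f; have [cg cgE] := form_col g.
have phiE x y z : phi (x *: P + y *: D + z *: E) = x.
  rewrite !linearD !linearZ /= pP pD pE !scaler0 !addr0.
  by rewrite -[_ *: 1]/(_ * 1) mulr1.
(* In the coordinates [x], [y], [z] along [P], [D], [E] this is the form [x * z - y ^ 2]. The matrix
   need not be symmetric; only its polar form matters, and that has trivial radical on the plane
   because 2 is invertible. *)
pose M : 'M[F]_5 := cp *m cg^T - cf *m cf^T.
have prodE (c c' : 'cV[F]_5) (v w : W) :
    (v *m (c *m c'^T) *m w^T) 0 0 = (v *m c) 0 0 * (w *m c') 0 0.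
  rewrite !mulmxA -mulmxA -trmx_mul mxE big_ord1; congr (_ * _); by rewrite mxE.
have subE (A A' : 'M[F]_1) : (A - A') 0 0 = A 0 0 - A' 0 0 by rewrite !mxE.
have bil v w : (v *m M *m w^T) 0 0 = phi v * g w - f v * f w.
  by rewrite /M mulmxBr mulmxBl subE !prodE -!cpE -!cfE -!cgE.
have qE v : qform M v = phi v * g v - f v ^+ 2 by rewrite /qform bil.
have bE v w : polar M v w = phi v * g w + phi w * g v - 2%:R * (f v * f w).
  by rewrite polarE !bil; ring.
apply/existsP; exists M; apply/andP; split.
  apply/forallP => v; apply/implyP => /and3P[/parabola_span[x [y [z vE]]] _ /forallP H].
  have inP x' y' z' : x' *: P + y' *: D + z' *: E \in p by apply/parabola_span; exists x', y', z'.
  have bv x' y' z' : x * z' + x' * z - 2%:R * (y * y') = 0.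
    have /implyP/(_ (inP x' y' z'))/eqP := H (x' *: P + y' *: D + z' *: E).
    rewrite bE vE !phiE; have [-> ->] := fgE x y z; have [-> ->] := fgE x' y' z'.
    by [].
  have z0 : z = 0 by rewrite -(bv 1 0 0); ring.
  have x0 : x = 0 by rewrite -(bv 0 0 1); ring.
  have : - 2%:R * y == 0 by rewrite -(bv 0 1 0); apply/eqP; ring.
  rewrite mulf_eq0 oppr_eq0 (negPf two0) /= => /eqP y0.
  by rewrite vE x0 y0 z0 !scale0r !addr0.
apply/eqP/setP => X; rewrite inE; apply/idP/andP.
  have onconic x y z : x * z = y ^+ 2 -> (x, y, z) != (0, 0, 0) ->
      <[x *: P + y *: D + z *: E]>%VS \in points_of p /\
      [forall v, (v \in <[x *: P + y *: D + z *: E]>%VS) ==> (qform M v == 0)].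
    move=> xz nz; split.
      apply/points_ofP; exists (x *: P + y *: D + z *: E); split=> //.
        by apply: contraNneq nz => /parabola_free[-> -> ->].
      by apply/parabola_span; exists x, y, z.
    apply/forallP => v; apply/implyP => /vlineP[k ->]; rewrite qform_scale qE phiE.
    by have [-> ->] := fgE x y z; rewrite xz subrr mulr0.
  case/setU1P => [-> | /imsetP[k _ ->]].
    have := onconic 0 0 1; rewrite !scale0r scale1r !add0r; apply; first by rewrite mul0r expr0n.
    by apply/eqP => -[/eqP]; rewrite oner_eq0.
  have := onconic 1 k (k ^+ 2); rewrite scale1r; apply; first by rewrite mul1r.
  by apply/eqP => -[/eqP]; rewrite oner_eq0.
move=> [/points_ofP[v [v0 /parabola_span[x [y [z vE]]] XE]] /forallP H].
have /implyP/(_ _)/eqP := H v; rewrite XE memv_line => /(_ isT).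
rewrite qE vE phiE; have [-> ->] := fgE x y z; move=> /eqP; rewrite subr_eq0 => /eqP xz.
have [x0 | x0] := eqVneq x 0.
  move/eqP: xz; rewrite x0 mul0r eq_sym expf_eq0 /= => /eqP y0.
  have z0 : z != 0 by apply: contraNneq v0 => z0; rewrite vE x0 y0 z0 !scale0r !addr0.
  by apply/setU1P; left; rewrite y0 !scale0r !add0r line_scale.
apply/setU1P; right; apply/imsetP; exists (y / x) => //.
have xV0 : x^-1 != 0 by rewrite invr_eq0.
rewrite -(line_scale _ xV0) !scalerDr !scalerA; rewrite mulVf // scale1r.
congr (<[_ + _ *: _ + _ *: _]>%VS); first by rewrite mulrC.
by rewrite -[z](mulfK x0) [z * x]mulrC xz; field.
Qed.

(* The quartic k |-> M (P + k D + k^2 E) vanishes on F, and its leading coefficient is M E. *)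
Lemma conic_extension_uniq N : (forall k, <[P + k *: D + (k ^+ 2) *: E]>%VS != <[E]>%VS) ->
  is_conic p (N |: parabola) -> N = <[E]>%VS.
Proof.
move=> notE /existsP[M /andP[_ /eqP KE]].
have zero k : qform M (P + k *: D + (k ^+ 2) *: E) = 0.
  have /[!KE] : <[P + k *: D + (k ^+ 2) *: E]>%VS \in N |: parabola.
    by apply/setU1P; right; apply/imsetP; exists k.
  by rewrite inE => /andP[_ /forallP/(_ (P + k *: D + (k ^+ 2) *: E))]; rewrite memv_line => /eqP.
pose b (v w : W) := (v *m M *m w^T) 0 0.
have bD u v w : b (u + v) w = b u w + b v w by rewrite /b !mulmxDl mxE.
have bZ k v w : b (k *: v) w = k * b v w by rewrite /b -!scalemxAl mxE.
have bDr u v w : b u (v + w) = b u v + b u w by rewrite /b linearD /= mulmxDr mxE.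
have bZr k v w : b v (k *: w) = k * b v w by rewrite /b linearZ /= -scalemxAr mxE.
have qE k : qform M (P + k *: D + (k ^+ 2) *: E) =
   b E E * k ^+ 4 + (b D E + b E D) * k ^+ 3 + (b P E + b E P + b D D) * k ^+ 2
   + (b P D + b D P) * k + b P P.
  by rewrite -[LHS]/(b _ _) !bD !bDr !bZ !bZr; ring.
have [|bE _ _ _ _] := quartic_eq0 (leq_trans _ F7) (fun k => etrans (esym (qE k)) (zero k)).
  by [].
have E0 : E != 0.
  apply/eqP => E0; have [] := @indep 0 1; first by rewrite E0 scaler0 scale0r addr0.
  by move=> _ /eqP; rewrite oner_eq0.
have : <[E]>%VS \in N |: parabola.
  rewrite KE inE; apply/andP; split.
    by apply/points_ofP; exists E; split=> //; apply/parabola_span; exists 0, 0, 1; rewrite !scale0r scale1r !add0r.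
  by apply/forallP => v; apply/implyP => /vlineP[k ->]; rewrite qform_scale [qform M E]bE mulr0.
by case/setU1P => [-> // | /imsetP[k _ EE]]; case/eqP: (notE k).
Qed.

Lemma parabola_not_infty k : <[P + k *: D + (k ^+ 2) *: E]>%VS != <[E]>%VS.
Proof.
apply/eqP => H; have : P + k *: D + (k ^+ 2) *: E \in <[E]>%VS by rewrite -H memv_line.
move=> /vlineP[c /(congr1 phi)]; rewrite !linearD !linearZ /= pP pD pE !scaler0 !addr0.
by apply/eqP/oner_neq0.
Qed.

Lemma parabola_P_neq0 : P != 0.
Proof. by apply: contra_eq_neq pP => ->; rewrite linear0 eq_sym oner_neq0. Qed.

Lemma parabola_D_notin : D \notin <[P]>%VS.
Proof.
apply/negP => /vlineP[k DE].
have [] := @parabola_free (- k) 1 0; last by move=> _ /eqP; rewrite oner_eq0.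
by rewrite DE scaleNr scale1r addNr scale0r addr0.
Qed.

(** A line through [P] with direction [y *: D + z *: E] and [z] nonzero meets the conic again: in
    [E] if [y = 0], and in the point of parameter [z / y] otherwise. *)
Lemma parabola_tangent_trace l :
  is_tangent p (<[E]>%VS |: parabola) <[P]>%VS l -> (l :&: lker phi)%VS = <[D]>%VS.
Proof.
move=> /and3P[/eqP dl lp /eqP tg].
have mem X : X \in points_of l -> X \in <[E]>%VS |: parabola -> X = <[P]>%VS.
  by move=> Xl XK; apply/set1P; rewrite -tg inE Xl.
have Pl : P \in l.
  have /setIP[] : <[P]>%VS \in points_of l :&: (<[E]>%VS |: parabola) by rewrite tg set11.
  by rewrite inE -memvE => /andP[].
have [w0 w0l w0P] : exists2 w, w \in l & w \notin <[P]>%VS.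
  by apply/subvPn/negP => /dimvS; rewrite dim_vline parabola_P_neq0 dl.
pose w := w0 - phi w0 *: P.
have wl : w \in l by rewrite memvB // memvZ.
have w_neq0 : w != 0.
  by apply: contraNneq w0P => /subr0_eq ->; rewrite memvZ // memv_line.
have pw : phi w = 0.
  by rewrite linearB linearZ /= pP -[_ *: 1]/(_ * 1) mulr1 subrr.
have [x [y [z wE]]] := (parabola_span w).1 (subvP lp w wl).
have x0 : x = 0.
  move: pw; rewrite wE !linearD !linearZ /= pP pD pE !scaler0 !addr0.
  by rewrite -[_ *: 1]/(_ * 1) mulr1.
rewrite x0 scale0r add0r in wE.
have z0 : z = 0.
  apply/eqP; apply: contraT => z0; have [y0 | y0] := eqVneq y 0.
    have : <[E]>%VS = <[P]>%VS.
      apply: mem; last exact: setU11.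
      apply/points_ofP; exists w; rewrite w_neq0; split=> //.
      by rewrite wE y0 scale0r add0r line_scale.
    move=> EP; have : P \in <[E]>%VS by rewrite EP memv_line.
    move=> /vlineP[c /(congr1 phi)]; rewrite linearZ /= pP pE scaler0 => /eqP.
    by rewrite oner_eq0.
  pose k := z / y; have k0 : k != 0 by rewrite mulf_neq0 ?invr_eq0.
  have PE : P + k *: D + (k ^+ 2) *: E = P + (k / y) *: w.
    rewrite wE scalerDr !scalerA addrA; congr (_ + _ *: _ + _ *: _); rewrite /k; by field.
  have Q0 : P + k *: D + k ^+ 2 *: E != 0.
    by rewrite -[P]scale1r; apply/eqP => /parabola_free[/eqP]; rewrite oner_eq0.
  have : <[P + k *: D + k ^+ 2 *: E]>%VS = <[P]>%VS.
    apply: mem; last by apply/setU1P; right; apply/imsetP; exists k.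
    apply/points_ofP; exists (P + k *: D + k ^+ 2 *: E); split=> //.
    by rewrite PE memvD // memvZ.
  move=> QP; have : P + k *: D + k ^+ 2 *: E \in <[P]>%VS by rewrite -QP memv_line.
  move=> /vlineP[c QE]; have [] := @parabola_inj 1 k (k ^+ 2) c 0 0.
    by rewrite scale1r QE !scale0r !addr0.
  by move=> _ /eqP; rewrite (negPf k0).
rewrite z0 scale0r addr0 in wE.
have y0 : y != 0 by apply: contraNneq w_neq0 => y0; rewrite wE y0 scale0r.
have Dl : D \in l by rewrite -[D](scalerK y0) -wE memvZ.
apply/eqP; rewrite eqEsubv; apply/andP; split; last first.
  by rewrite -memvE memv_cap Dl memv_ker pD eqxx.
apply/subvP => v /memv_capP[vl]; rewrite memv_ker => /eqP pv.
have le2 : (\dim l <= 2)%N by rewrite dl.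
have [u [u' vE]] := span2P le2 Pl Dl parabola_P_neq0 parabola_D_notin vl.
move: pv; rewrite vE linearD !linearZ /= pP pD scaler0 addr0.
by rewrite -[_ *: 1]/(_ * 1) mulr1 => ->; rewrite scale0r add0r memvZ // memv_line.
Qed.

Lemma parabola_tangent :
  is_tangent p (<[E]>%VS |: parabola) <[P]>%VS (<[P]> + <[D]>)%VS.
Proof.
apply/and3P; split.
- by rewrite /is_line dim_add_line ?parabola_D_notin // dim_vline parabola_P_neq0.
- exact: addvSl.
apply/eqP/setP => X; rewrite in_set1; apply/setIP/eqP => [[] | ->]; last first.
  split.
    apply/points_ofP; exists P; split=> //; first exact: parabola_P_neq0.
    by apply: (subvP (addvSl _ _)); apply: memv_line.
  apply/setU1P; right; apply/imsetP; exists 0 => //.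
  by rewrite expr0n /= !scale0r !addr0.
have inPD v : v \in (<[P]> + <[D]>)%VS -> exists x y, v = x *: P + y *: D + 0 *: E.
  move=> /memv_addP[u /vlineP[x ->] [w /vlineP[y ->] ->]].
  by exists x, y; rewrite scale0r addr0.
rewrite inE => /andP[_ Xl] /setU1P[XE | /imsetP[k _ XE]].
  have := Xl; rewrite XE -memvE => /inPD[x [y EE]].
  have [] := @parabola_inj 0 0 1 x y 0; first by rewrite !scale0r !add0r scale1r {1}EE scale0r addr0.
  by move=> _ _ /eqP; rewrite oner_eq0.
have := Xl; rewrite XE -memvE => /inPD[x [y]].
rewrite -{1}[P]scale1r => /parabola_inj[_ _ /eqP]; rewrite expf_eq0 /= => /eqP ->.
by rewrite expr0n /= !scale0r !addr0.
Qed.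

End Conic.

(** * The explicit model: C-planes, points at infinity, tangent directions *)

Section Model.

Variables (F : finFieldType) (phi : 'Hom('rV[F]_5, F^o)).
Variables (C : {set 'rV[F]_5}) (B C0 : {set subspace F}).
Hypothesis conf : configuration phi C B.
Hypothesis CE : forall v, v \in C <-> phi v = 1 /\ <[v]>%VS \in C0.
Hypothesis C0_affine : C0 \subset affine_points (lker phi).

Local Notation q := #|F|.
Local Notation W := 'rV[F]_5.

Variables (O e1 e2 e3 n : W) (a b : F).
Local Notation K := (comb O e1 e2 e3 n).

(* For the C-plane pi of direction (d, e) through A = pt s t, the vectors tdir s t d e and
   quad d e represent the points A_pi and pi_infty. *)
Definition pt s t := K 1 s t (s * t) (a * s ^+ 2 + b * t ^+ 2).
Definition tdir s t d e := K 0 d e (s * e + t * d) (2%:R * (a * s * d + b * t * e)).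
Definition quad d e := K 0 0 0 (d * e) (a * d ^+ 2 + b * e ^+ 2).

Hypothesis basis : comb_basis O e1 e2 e3 n.
Hypothesis phiO : phi O = 1 /\ [/\ phi e1 = 0, phi e2 = 0, phi e3 = 0 & phi n = 0].
Hypothesis aniso : forall d e, b * e ^+ 2 = a * d ^+ 2 -> d = 0 /\ e = 0.
Hypothesis C_pt : forall c, c \in C <-> exists s t, c = pt s t.
Hypothesis lines : forall (p : subspace F) s t s' t', p \in B -> pt s t \in p ->
  pt s' t' \in p -> pt s t != pt s' t' ->
  forall k, pt (s + k * (s' - s)) (t + k * (t' - t)) \in p.

Let two0 := odd_two_neq0 (conf_odd conf).

Lemma phi_comb x0 x1 x2 x3 x4 : phi (K x0 x1 x2 x3 x4) = x0.
Proof.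
have [pO [p1 p2 p3 p4]] := phiO.
by rewrite lfun_comb pO p1 p2 p3 p4 !mulr0 !addr0 mulr1.
Qed.

Lemma pt_inj s t s' t' : pt s t = pt s' t' -> s = s' /\ t = t'.
Proof. by move=> /(comb_inj basis)[_ -> -> _ _]. Qed.

Lemma phi_pt s t : phi (pt s t) = 1. Proof. exact: phi_comb. Qed.
Lemma phi_tdir s t d e : phi (tdir s t d e) = 0. Proof. exact: phi_comb. Qed.
Lemma phi_quad d e : phi (quad d e) = 0. Proof. exact: phi_comb. Qed.

(** This is the Taylor expansion of [pt], exact at order two. Comparing [k] and [- k], a chord is a
    multiple of [tdir] at the parameter midpoint. *)
Lemma pt_shift s t d e k :
  pt (s + k * d) (t + k * e) = pt s t + k *: tdir s t d e + k ^+ 2 *: quad d e.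
Proof. by apply/rowP => i; rewrite !mxE; ring. Qed.

Lemma quad_eq0 d e : quad d e = 0 -> d = 0 /\ e = 0.
Proof.
move=> /(basis.2)[_ _ _ /eqP]; rewrite mulf_eq0 => /orP[/eqP-> | /eqP->].
  by rewrite expr0n mulr0 add0r => E; apply: aniso; rewrite expr0n mulr0.
by rewrite expr0n mulr0 addr0 => E; apply: aniso; rewrite expr0n mulr0.
Qed.

Lemma tangent_indep s t d e : (d != 0) || (e != 0) ->
  forall x y, x *: tdir s t d e + y *: quad d e = 0 -> x = 0 /\ y = 0.
Proof.
move=> de x y; have -> : x *: tdir s t d e + y *: quad d e =
  K 0 (x * d) (x * e) (x * (s * e + t * d) + y * (d * e))
    (x * (2%:R * (a * s * d + b * t * e)) + y * (a * d ^+ 2 + b * e ^+ 2)).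
  by apply/rowP => i; rewrite !mxE; ring.
move=> /(basis.2)[_ xd xe E3 E4].
have x0 : x = 0.
  apply/eqP; move/eqP: xd; move/eqP: xe; rewrite !mulf_eq0; case: (x == 0) => //= e0 d0.
  by rewrite e0 d0 in de.
split=> //; apply/eqP; apply: contraT => y0.
have [] := @quad_eq0 d e; last by move=> d0 e0; rewrite d0 e0 eqxx in de.
move: E3 E4; rewrite x0 !mul0r !add0r => /eqP + /eqP.
rewrite !mulf_eq0 (negPf y0) -mulf_eq0 => /eqP /= E3 /eqP E4.
by rewrite /quad E3 E4; apply/rowP => i; rewrite !mxE; ring.
Qed.

Definition plane s t d e : subspace F :=
  (<[pt s t]> + <[tdir s t d e]> + <[quad d e]>)%VS.

Lemma dim_plane s t d e : (d != 0) || (e != 0) -> \dim (plane s t d e) = 3%N.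
Proof.
move=> de; have ind := @tangent_indep s t _ _ de; rewrite /plane.
have P0 := parabola_P_neq0 (phi_pt s t).
have DN := parabola_D_notin (phi_pt s t) (phi_tdir s t d e) (phi_quad d e) ind.
rewrite !dim_add_line ?dim_vline ?P0 //.
apply/negP => /memv_addP[u /vlineP[x ->] [w /vlineP[z ->] EE]].
have [] := @parabola_inj _ _ _ _ _ (phi_pt s t) (phi_tdir s t d e) (phi_quad d e) ind 0 0 1 x z 0.
  by rewrite !scale0r scale1r !add0r addr0.
by move=> _ _ /eqP; rewrite oner_eq0.
Qed.

Lemma block_plane (p : subspace F) s t s' t' : p \in B -> pt s t \in p -> pt s' t' \in p ->
  (s' - s != 0) || (t' - t != 0) -> p = plane s t (s' - s) (t' - t).
Proof.
move=> pB sp s'p de.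
have ne : pt s t != pt s' t'.
  by apply: contraTneq de => /pt_inj[-> ->]; rewrite !subrr eqxx.
have H k : pt (s + k * (s' - s)) (t + k * (t' - t)) \in p by apply: lines.
have := H 1; have := H (- 1); rewrite !pt_shift {H}.
(* The points with [k] equal to 0, 1 and -1 suffice: [E] is half a second difference, and [D]
   follows. *)
suff aux D E : pt s t + (- 1) *: D + (- 1) ^+ 2 *: E \in p ->
    pt s t + 1 *: D + 1 ^+ 2 *: E \in p -> (D \in p) && (E \in p).
  move=> HN H1; have /andP[Dp Ep] := aux _ _ HN H1.
  apply/eqP; rewrite eq_sym eqEdim (conf_dim conf pB) dim_plane // leqnn andbT.
  by rewrite !subv_add -!memvE sp Dp Ep.
move=> HN H1.
have Ep : E \in p.
  have -> : E = 2%:R^-1 *: ((pt s t + 1 *: D + 1 ^+ 2 *: E) +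
      (pt s t + (- 1) *: D + (- 1) ^+ 2 *: E) - 2%:R *: pt s t).
    by apply/rowP => i; rewrite !mxE; field.
  exact: (memvZ _ (memvB (memvD H1 HN) (memvZ _ sp))).
have Dp : D \in p.
  have -> : D = (pt s t + 1 *: D + 1 ^+ 2 *: E) - pt s t - E.
    by apply/rowP => i; rewrite !mxE; ring.
  exact: (memvB (memvB H1 sp) Ep).
by rewrite Dp.
Qed.

Lemma plane_block s t d e : (d != 0) || (e != 0) -> plane s t d e \in B.
Proof.
move=> de; have PC u v : pt u v \in C by apply/C_pt; exists u, v.
have ne : pt s t != pt (s + d) (t + e).
  apply: contraTneq de => /pt_inj[sd te].
  by rewrite -(addKr s d) -sd -(addKr t e) -te !addNr eqxx.
have [p pB /andP[p0 p1]] := conf_block conf (PC s t) (PC (s + d) (t + e)) ne.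
have := block_plane pB p0 p1; rewrite ![_ + _ - _]addrC !addKr => E.
by rewrite -E.
Qed.

Lemma block_planeP (p : subspace F) s t : p \in B -> pt s t \in p ->
  exists d e, (d != 0) || (e != 0) /\ p = plane s t d e.
Proof.
move=> pB sp; have [c [c' [cC c'C cp c'p cc']]] := block_pts conf pB.
have [c2 [/C_pt[s' [t' ->]] c2p ne]] : exists c2, [/\ c2 \in C, c2 \in p & c2 != pt s t].
  have [cE | cE] := eqVneq c (pt s t); last by exists c.
  by exists c'; rewrite -cE eq_sym.
have de : (s' - s != 0) || (t' - t != 0).
  by rewrite -negb_and !subr_eq0; apply: contra ne => /andP[/eqP -> /eqP ->].
by exists (s' - s), (t' - t); split=> //; apply: block_plane.
Qed.

Lemma C0P X : X \in C0 <-> exists s t, X = <[pt s t]>%VS.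
Proof.
split=> [XC | [s [t ->]]]; last first.
  by have /CE[] : pt s t \in C by apply/C_pt; exists s, t.
have := subsetP C0_affine X XC; rewrite inE => /andP[/is_pointP[v v0 XE]].
rewrite /affine XE -memvE memv_ker => pv.
have kv : (phi v)^-1 != 0 by rewrite invr_eq0.
have XE' : X = <[(phi v)^-1 *: v]>%VS by rewrite XE line_scale.
have /C_pt[s [t E]] : (phi v)^-1 *: v \in C.
  by apply/CE; rewrite -XE' linearZ /= -[_ *: _]/(_ * _) mulVf.
by exists s, t; rewrite -XE XE' E.
Qed.

Lemma plane_sectionE s t d e : (d != 0) || (e != 0) ->
  plane_section C0 (plane s t d e) = parabola (pt s t) (tdir s t d e) (quad d e).
Proof.
move=> de; have ind := @tangent_indep s t _ _ de.
apply/setP => X; apply/setIP/imsetP => [[XP XC] | [k _ ->]]; last first.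
  rewrite -pt_shift; split; last by apply/C0P; exists (s + k * d), (t + k * e).
  apply/points_ofP; exists (pt (s + k * d) (t + k * e)); split=> //.
    exact: parabola_P_neq0 (phi_pt _ _).
  rewrite pt_shift; apply/parabola_span; exists 1, k, (k ^+ 2); by rewrite scale1r.
have /C0P[s' [t' XE]] := XC; move: XP; rewrite inE XE -memvE => /andP[_].
move=> /parabola_span[x [y [z E]]]; exists y => //.
rewrite -pt_shift; congr (<[_]>%VS).
have : pt s' t' = K x (x * s + y * d) (x * t + y * e)
  (x * (s * t) + y * (s * e + t * d) + z * (d * e))
  (x * (a * s ^+ 2 + b * t ^+ 2) + y * (2%:R * (a * s * d + b * t * e)) +
   z * (a * d ^+ 2 + b * e ^+ 2)).
  by rewrite E; apply/rowP => i; rewrite !mxE; ring.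
by move=> /(comb_inj basis)[<- -> -> _ _]; rewrite !mul1r.
Qed.

Lemma infty_point_plane s t d e N : (d != 0) || (e != 0) ->
  is_infty_point_of C0 (plane s t d e) N = (N == <[quad d e]>%VS).
Proof.
move=> de; have ind := @tangent_indep s t _ _ de.
have pP := phi_pt s t; have pD := phi_tdir s t d e; have pE := phi_quad d e.
rewrite /is_infty_point_of plane_sectionE //; apply/idP/eqP => [H | ->].
  apply: (conic_extension_uniq (conf_ge7 conf) ind _ H) => k.
  exact: (parabola_not_infty pP pD pE).
exact: (parabola_conic two0 pP pD pE ind).
Qed.

Lemma quad_neq0 d e : (d != 0) || (e != 0) -> quad d e != 0.
Proof. by apply: contraTneq => /quad_eq0[-> ->]; rewrite eqxx. Qed.

Lemma infty_pointsP X : X \in infty_points C0 B <->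
  exists d e, (d != 0) || (e != 0) /\ X = <[quad d e]>%VS.
Proof.
rewrite inE; split=> [/exists_inP[p pB XN] | [d [e [de ->]]]].
  have [c [_ [cC _ cp _ _]]] := block_pts conf pB.
  move/C_pt: cC => [s [t cE]]; rewrite cE in cp.
  have [d [e [de pE]]] := block_planeP pB cp; exists d, e; split=> //.
  by move: XN; rewrite pE infty_point_plane // => /eqP.
apply/exists_inP; exists (plane 0 0 d e); first exact: plane_block.
by rewrite infty_point_plane.
Qed.

Definition tline s t : subspace F := (<[tdir s t 1%R 0%R]> + <[tdir s t 0%R 1%R]>)%VS.
Definition axis : subspace F := (<[e3]> + <[n]>)%VS.

Lemma tlineP s t v : v \in tline s t <-> exists d e, v = tdir s t d e.
Proof.
have E d e : tdir s t d e = d *: tdir s t 1 0 + e *: tdir s t 0 1.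
  by apply/rowP => i; rewrite !mxE; ring.
split=> [/memv_addP[u /vlineP[d ->] [w /vlineP[e ->] ->]] | [d [e ->]]].
  by exists d, e; rewrite [RHS]E.
by rewrite E memv_add // memvZ // memv_line.
Qed.

Lemma axisP v : v \in axis <-> exists x y, v = K 0 0 0 x y.
Proof.
have E x y : K 0 0 0 x y = x *: e3 + y *: n.
  by apply/rowP => i; rewrite !mxE; ring.
split=> [/memv_addP[u /vlineP[d ->] [w /vlineP[e ->] ->]] | [d [e ->]]].
  by exists d, e; rewrite [RHS]E.
by rewrite E memv_add // memvZ // memv_line.
Qed.

Lemma tdir_eq0 s t d e : tdir s t d e = 0 -> d = 0 /\ e = 0.
Proof. by move=> /(basis.2)[_ -> ->]. Qed.

Lemma t_atE s t : t_at (lker phi) C0 B <[pt s t]>%VS = points_of (tline s t).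
Proof.
apply/setP => X; rewrite inE.
apply/exists_inP/points_ofP => [[p pB /andP[sp]] | [v [v0 /tlineP[d [e vE]] ->]]].
  rewrite -memvE in sp; have [d [e [de pE]]] := block_planeP pB sp.
  move=> /existsP[N /existsP[l /and3P[]]]; rewrite pE infty_point_plane // => /eqP ->.
  rewrite plane_sectionE // => tg /eqP ->.
  have := parabola_tangent_trace (phi_pt s t) (phi_tdir s t d e) (phi_quad d e)
    (@tangent_indep s t _ _ de) tg.
  move=> ->; exists (tdir s t d e); split=> //; last by apply/tlineP; exists d, e.
  by apply: contraTneq de => /tdir_eq0[-> ->]; rewrite eqxx.
have de : (d != 0) || (e != 0).
  rewrite -negb_and; apply: contraNN v0 => /andP[/eqP d0 /eqP e0].
  by rewrite vE d0 e0; apply/eqP/rowP => i; rewrite !mxE; ring.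
have tg := parabola_tangent (phi_pt s t) (phi_tdir s t d e) (phi_quad d e) (@tangent_indep s t _ _ de).
exists (plane s t d e); first exact: plane_block.
rewrite -memvE; apply/andP; split.
  by apply/parabola_span; exists 1, 0, 0; rewrite scale1r !scale0r !addr0.
apply/existsP; exists <[quad d e]>%VS; apply/existsP; exists (<[pt s t]> + <[tdir s t d e]>)%VS.
rewrite infty_point_plane // eqxx plane_sectionE // tg /=; apply/eqP.
by rewrite vE (parabola_tangent_trace (phi_pt s t) (phi_tdir s t d e) (phi_quad d e)
    (@tangent_indep s t _ _ de) tg).
Qed.

(** For fixed [(d, e)] this is a linear system in [(s, t)] of determinant
    [2 * (b * e ^ 2 - a * d ^ 2)], nonzero by [aniso]; the witnesses come from Cramer's rule.
    Together with [tdir_inj] it puts each point of Sigma off [axis] on exactly one [tline]. *)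
Lemma bilinear_solve d e y z : (d != 0) || (e != 0) ->
  exists s t, tdir s t d e = K 0 d e y z.
Proof.
move=> de; have D0 : b * e ^+ 2 - a * d ^+ 2 != 0.
  by rewrite subr_eq0; apply: contraTneq de => /aniso[-> ->]; rewrite eqxx.
exists ((2%:R * b * e * y - d * z) / (2%:R * (b * e ^+ 2 - a * d ^+ 2))).
exists ((e * z - 2%:R * a * d * y) / (2%:R * (b * e ^+ 2 - a * d ^+ 2))).
by rewrite /tdir; congr (K _ _ _ _ _); field; rewrite two0 D0.
Qed.

Lemma lkerP v : v \in lker phi <-> exists x1 x2 x3 x4, v = K 0 x1 x2 x3 x4.
Proof.
rewrite memv_ker; split=> [/eqP | [x1 [x2 [x3 [x4 ->]]]]]; last by rewrite phi_comb.
have [x0 [x1 [x2 [x3 [x4 ->]]]]] := basis.1 v.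
by rewrite phi_comb => ->; exists x1, x2, x3, x4.
Qed.

(** By [bilinear_solve] a point of Sigma off [axis] is a tangent direction, so it is on a C-line and
    is no 0-point. If a C-line of direction [(d, e)] passes through a point of [axis], that point is
    [quad d e], because [tdir] is off [axis]. *)
Lemma t_inftyE : t_infty (lker phi) C0 B = points_of axis.
Proof.
apply/setP => X; apply/setUP/points_ofP => [[/infty_pointsP[d [e [de ->]]] | ] | ].
- exists (quad d e); rewrite quad_neq0 //; split=> //.
  by apply/axisP; exists (d * e), (a * d ^+ 2 + b * e ^+ 2).
- rewrite inE => /andP[/points_ofP[v [v0 /lkerP[x1 [x2 [x3 [x4 vE]]]] ->]] /forall_inP H].
  exists v; split=> //; apply/axisP; exists x3, x4.
  suff /norP[/negPn/eqP x10 /negPn/eqP x20] : ~~ ((x1 != 0) || (x2 != 0)).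
    by rewrite vE x10 x20.
  apply/negP => x12; have [s [t tE]] := @bilinear_solve _ _ x3 x4 x12.
  case/negP: (H _ (@plane_block s t _ _ x12)); rewrite -memvE memv_cap vE -tE memv_ker phi_tdir eqxx andbT.
  by apply/parabola_span; exists 0, 1, 0; rewrite scale1r !scale0r add0r addr0.
move=> [v [v0 /axisP[x [y vE]] ->]].
have [/exists_inP[p pB vp] | /exists_inPn H] :=
  boolP [exists p in B, (<[v]> <= p :&: lker phi)%VS].
  left; apply/infty_pointsP; have [c [_ [cC _ cp _ _]]] := block_pts conf pB.
  move/C_pt: cC => [s [t cE]]; rewrite cE in cp.
  have [d [e [de pE]]] := block_planeP pB cp; exists d, e; split=> //.
  move: vp; rewrite -memvE memv_cap pE => /andP[/parabola_span[x' [y' [z' E]]] _].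
  have : K 0 0 0 x y = K x' (x' * s + y' * d) (x' * t + y' * e)
    (x' * (s * t) + y' * (s * e + t * d) + z' * (d * e))
    (x' * (a * s ^+ 2 + b * t ^+ 2) + y' * (2%:R * (a * s * d + b * t * e)) +
     z' * (a * d ^+ 2 + b * e ^+ 2)).
    by rewrite -vE E; apply/rowP => i; rewrite !mxE; ring.
  move=> /(comb_inj basis)[x0 E1 E2 _ _]; rewrite -x0 !mul0r !add0r in E1 E2.
  have y0 : y' = 0.
    apply/eqP; move/esym/eqP: E1; move/esym/eqP: E2; rewrite !mulf_eq0.
    by case: (y' == 0) => //= e0 d0; rewrite e0 d0 in de.
  move: E; rewrite -x0 y0 !scale0r !add0r => E.
  have z0 : z' != 0 by apply: contraNneq v0 => z0; rewrite E z0 scale0r.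
  by rewrite E line_scale.
right; rewrite inE; apply/andP; split; last by apply/forall_inP => p pB; apply: H.
apply/points_ofP; exists v; split=> //; apply/lkerP; by exists 0, 0, x, y.
Qed.

(** * Spreads for which C is an arc *)

Section Spread.

Variable S' : {set subspace F}.
Hypothesis spread : is_spread (lker phi) S'.
Hypothesis arc : is_arc (bb_lines (lker phi) S') (bb_image C0).

Lemma spread_line l : l \in S' -> \dim l = 2%N /\ (l <= lker phi)%VS.
Proof. by have [_ H _ _] := spread => /H/andP[/eqP]. Qed.

Lemma spread_eq l m v : l \in S' -> m \in S' -> v != 0 -> v \in l -> v \in m -> l = m.
Proof.
move=> lS mS v0 vl vm; have [_ _ H _] := spread; apply/eqP; apply: contraT => lm.
have /pred0P/(_ <[v]>%VS)/= := H l m lS mS lm.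
suff mem (U : {vspace W}) : v \in U -> <[v]>%VS \in points_of U by rewrite !mem.
by move=> vU; apply/points_ofP; exists v.
Qed.

Lemma spread_cover v : v != 0 -> phi v = 0 -> exists2 l, l \in S' & v \in l.
Proof.
move=> v0 pv; have [_ _ _ H] := spread.
have [|l lS vl] := H <[v]>%VS; last by exists l; rewrite // memvE.
by apply/points_ofP; exists v; rewrite memv_ker pv.
Qed.

Lemma pt_line_inj s t s' t' : <[pt s t]>%VS = <[pt s' t']>%VS -> pt s t = pt s' t'.
Proof.
move=> E; have : pt s t \in <[pt s' t']>%VS by rewrite -E memv_line.
move=> /vlineP[k kE]; move: (kE) => /(congr1 phi).
by rewrite linearZ /= !phi_pt -[_ *: 1]/(_ * 1) mulr1 kE => <-; rewrite scale1r.
Qed.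

Lemma spread_triple l s1 t1 s2 t2 s3 t3 : l \in S' ->
  pt s1 t1 != pt s2 t2 -> pt s1 t1 != pt s3 t3 -> pt s2 t2 != pt s3 t3 ->
  pt s2 t2 - pt s1 t1 \in l -> pt s3 t3 - pt s1 t1 \in l -> False.
Proof.
move=> lS n12 n13 n23 l2 l3; have [dl lk] := spread_line lS.
pose p : subspace F := (l + <[pt s1 t1]>)%VS.
have p1l : pt s1 t1 \notin l.
  by apply/negP => /(subvP lk); rewrite memv_ker phi_pt; apply/negP/oner_neq0.
have pk : (p :&: lker phi)%VS = l.
  apply/eqP; rewrite eqEsubv; apply/andP; split; last by rewrite subv_cap addvSl.
  apply/subvP => v /memv_capP[/memv_addP[u ul [w /vlineP[k ->] ->]]].
  rewrite memv_ker linearD linearZ /= phi_pt; have := subvP lk u ul; rewrite memv_ker => /eqP ->.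
  by rewrite add0r -[_ *: 1]/(_ * 1) mulr1 => /eqP ->; rewrite scale0r addr0.
have p1 : pt s1 t1 \in p by apply: (subvP (addvSr _ _)); apply: memv_line.
have p2 : pt s2 t2 \in p.
  by rewrite -[pt s2 t2](subrK (pt s1 t1)) memvD //; apply: (subvP (addvSl _ _)).
have p3 : pt s3 t3 \in p.
  by rewrite -[pt s3 t3](subrK (pt s1 t1)) memvD //; apply: (subvP (addvSl _ _)).
pose L : {set bb_point F} := bb_affine_line (lker phi) p.
have LS : L \in bb_lines (lker phi) S'.
  apply/setU1P; right; apply/imsetP; exists p => //.
  rewrite !inE pk lS andbT /is_plane dim_add_line // dl eqxx /= /affine.
  by apply/subvPn; exists (pt s1 t1); rewrite // memv_ker phi_pt oner_neq0.
pose X : {set bb_point F} :=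
  inl <[pt s1 t1]>%VS |: [set inl <[pt s2 t2]>%VS; inl <[pt s3 t3]>%VS].
have inlN s t s' t' : pt s t != pt s' t' ->
    (inl <[pt s t]>%VS : bb_point F) != inl <[pt s' t']>%VS.
  apply: contraNneq => H; apply/eqP/pt_line_inj.
  exact: (congr1 (fun x : bb_point F => if x is inl u then u else 0%VS) H).
have XC : X \subset bb_image C0.
  apply/subsetP => x; rewrite !inE.
  have mem s t : inl <[pt s t]>%VS \in bb_image C0.
    by apply: imset_f; apply/C0P; exists s, t.
  by case/or3P => /eqP ->; apply: mem.
have X3 : #|X| = 3%N.
  by rewrite cardsU1 cards2 !inE negb_or !inlN.
have /negP := arc XC X3 LS; apply; apply/subsetP => x; rewrite !inE.
have mem s t : pt s t \in p -> inl <[pt s t]>%VS \in L.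
  move=> sp; apply/setU1P; right; apply: imset_f; rewrite inE; apply/andP; split.
    by apply/points_ofP; exists (pt s t); rewrite (parabola_P_neq0 (phi_pt s t)).
  by have /(subsetP C0_affine) : <[pt s t]>%VS \in C0 by apply/C0P; exists s, t.
by case/or3P => /eqP ->; have := mem _ _ p1; have := mem _ _ p2; have := mem _ _ p3; rewrite !inE.
Qed.

(** By [bilinear_solve] the given vector is a tangent direction [tdir s t d e]. With [quad d e] also
    in [l], the line [l] would be the C-line of a C-plane, which contains three points of [C]. *)
Lemma spread_quad_notin l d e y z : l \in S' -> (d != 0) || (e != 0) ->
  K 0 d e y z \in l -> quad d e \notin l.
Proof.
move=> lS de vl; apply/negP => ql; have [s [t tE]] := @bilinear_solve d e y z de.
rewrite -tE in vl.
have E k := pt_shift s t d e k.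
have neq k k' : k != k' -> pt (s + k * d) (t + k * e) != pt (s + k' * d) (t + k' * e).
  move=> kk'; apply: contraTneq de => /pt_inj[/addrI/eqP + /addrI/eqP].
  rewrite -subr_eq0 -mulrBl mulf_eq0 -[_ * e == _]subr_eq0 -mulrBl mulf_eq0.
  by rewrite subr_eq0 (negPf kk') /= => -> ->.
have mem k : pt (s + k * d) (t + k * e) - pt (s + 0 * d) (t + 0 * e) \in l.
  rewrite !E expr0n /= !scale0r !addr0 addrAC [pt s t + _]addrC addrK.
  by rewrite memvD // memvZ.
apply: (spread_triple lS (neq 0 1 _) (neq 0 (- 1) _) (neq 1 (- 1) _)) => //.
- by rewrite eq_sym oner_neq0.
- by rewrite eq_sym oppr_eq0 oner_neq0.
- by rewrite -subr_eq0 opprK.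
Qed.

Lemma dim_axis : \dim axis = 2%N.
Proof.
have e30 : e3 != 0.
  apply/eqP => e30; have [_ _ _ /eqP] : [/\ 0 = 0 :> F, 0 = 0 :> F, 0 = 0 :> F, 1 = 0 :> F & 0 = 0 :> F].
    by apply: (basis.2 0 0 0 1 0); rewrite /comb e30 !scale0r !scaler0 !addr0.
  by rewrite oner_eq0.
rewrite /axis dim_add_line ?dim_vline ?e30 //; apply/negP => /vlineP[k nE].
have [_ _ _ _ /eqP] : [/\ 0 = 0 :> F, 0 = 0 :> F, 0 = 0 :> F, - k = 0 & 1 = 0 :> F].
  by apply: (basis.2 0 0 0 (- k) 1); rewrite /comb nE !scale0r !add0r scaleNr scale1r addNr.
by rewrite oner_eq0.
Qed.

Lemma tdir_inj s t s' t' d e : (d != 0) || (e != 0) ->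
  tdir s t d e = tdir s' t' d e -> s = s' /\ t = t'.
Proof.
move=> de /(comb_inj basis)[_ _ _ E3 /(mulfI two0) E4].
have D0 : b * e ^+ 2 - a * d ^+ 2 != 0.
  by rewrite subr_eq0; apply: contraTneq de => /aniso[-> ->]; rewrite eqxx.
have F3 : (s - s') * e + (t - t') * d = 0.
  by rewrite -(subrr (s * e + t * d)) {2}E3; ring.
have F4 : a * (s - s') * d + b * (t - t') * e = 0.
  by rewrite -(subrr (a * s * d + b * t * e)) {2}E4; ring.
split; apply: subr0_eq; apply: (mulfI D0); rewrite mulr0.
  transitivity (b * e * ((s - s') * e + (t - t') * d) - d * (a * (s - s') * d + b * (t - t') * e)).
    by ring.
  by rewrite F3 F4 !mulr0 subr0.
transitivity (e * (a * (s - s') * d + b * (t - t') * e) - a * d * ((s - s') * e + (t - t') * d)).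
  by ring.
by rewrite F3 F4 !mulr0 subr0.
Qed.

Lemma dim_tline s t : \dim (tline s t) = 2%N.
Proof.
have D0 : tdir s t 1 0 != 0 by apply/eqP => /tdir_eq0[/eqP]; rewrite oner_eq0.
rewrite /tline dim_add_line ?dim_vline ?D0 //; apply/negP => /vlineP[k E].
have : tdir s t 0 1 - k *: tdir s t 1 0 = tdir s t (- k) 1.
  by apply/rowP => i; rewrite !mxE; ring.
by rewrite -E subrr => /esym/tdir_eq0[_ /eqP]; rewrite oner_eq0.
Qed.

(* Once l is normalised to contain the tangent directions (1, 0) at (s, t), the two chords
   below, in directions (1, 0) and (d, 1), share an end point and lie in a translate of l. *)
Lemma spread_graph l : l \in S' -> (l :&: axis)%VS = 0%VS -> exists s t, l = tline s t.
Proof.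
move=> lS la; have [dl lk] := spread_line lS.
have ak : (axis <= lker phi)%VS.
  by apply/subvP => v /axisP[x [y ->]]; apply/lkerP; exists 0, 0, x, y.
have kE : (l + axis)%VS = lker phi.
  apply/eqP; rewrite eqEdim subv_add lk ak /= dimv_disjoint_sum // dl dim_axis.
  have := limg_ker_dim phi fullv; rewrite capfv dimvf dim_matrix => dE.
  have arith x k : (x + k = 1 * 5)%N -> (0 < k)%N -> (x <= 2 + 2)%N.
    by case: k => // k; rewrite addnS mul1n => -[xk] _; apply: (leq_trans (leq_addr k x)); rewrite xk.
  apply: arith dE _.
  rewrite lt0n dimv_eq0; apply/eqP => i0.
  have := memv_img phi (memvf O); rewrite i0 memv0.
  by have [-> _] := phiO; rewrite oner_eq0.
(* Since [l] is a complement of [axis] in Sigma, it has a unique vector over each direction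
   [(d, e)]; [g1] and [g2] are those over [(1, 0)] and [(0, 1)]. *)
have split v : v \in lker phi -> exists g x y, g \in l /\ v = g + K 0 0 0 x y.
  by rewrite -kE => /memv_addP[g gl [w /axisP[x [y ->]] ->]]; exists g, x, y.
have [g1 [x1 [y1 [g1l E1]]]] : exists g x y, g \in l /\ K 0 1 0 0 0 = g + K 0 0 0 x y.
  by apply: split; apply/lkerP; exists 1, 0, 0, 0.
have [g2 [x2 [y2 [g2l E2]]]] : exists g x y, g \in l /\ K 0 0 1 0 0 = g + K 0 0 0 x y.
  by apply: split; apply/lkerP; exists 0, 1, 0, 0.
have a0 : a != 0.
  apply/eqP => a0; have [] := @aniso 1 0; first by rewrite a0 expr0n mulr0 mul0r.
  by move/eqP; rewrite oner_eq0.
have [s [t g1E]] : exists s t, g1 = tdir s t 1 0.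
  exists (- y1 / (2%:R * a)), (- x1).
  rewrite -[g1](addrK (K 0 0 0 x1 y1)) -E1.
  have -> : tdir (- y1 / (2%:R * a)) (- x1) 1 0 = K 0 1 0 (- x1) (- y1).
    by rewrite /tdir; congr (K _ _ _ _ _); field; rewrite ?a0 ?two0.
  by apply/rowP => i; rewrite !mxE; ring.
(* The pair [(s, t)] was chosen to match [g1]; [(p, r)] is the error that remains in [g2] and has to
   vanish. *)
have [p [r g2E]] : exists p r, g2 = tdir s t 0 1 + K 0 0 0 p r.
  exists (- x2 - s), (- y2 - 2%:R * b * t).
  rewrite -[g2](addrK (K 0 0 0 x2 y2)) -E2.
  by apply/rowP => i; rewrite !mxE; ring.
exists s, t.
suff [p0 r0] : p = 0 /\ r = 0.
  apply/eqP; rewrite eq_sym eqEdim dl dim_tline leqnn andbT.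
  have g2E' : g2 = tdir s t 0 1.
    by rewrite g2E p0 r0; apply/rowP => i; rewrite !mxE; ring.
  by rewrite subv_add -!memvE -g1E -g2E' g1l g2l.
(* The two factors are, up to nonzero scalars, the later [v] and [lam], whose vanishing would
   degenerate a chord. Their product is a cubic in [d]; if it is 0 for all [d], its leading
   coefficient gives [p = 0] and then its linear one gives [r = 0]. *)
have [/existsP[d /andP[d1 d2]] | /existsPn H] :=
  boolP [exists d, (r - 2%:R * a * d * p != 0) && (b * p - d * r + a * d ^+ 2 * p != 0)]; last first.
  have [||_ A3 _ A1 _] := @quartic_eq0 F 0 (- (2%:R * a ^+ 2 * p ^+ 2)) (3%:R * a * p * r)
     (- r ^+ 2 - 2%:R * a * b * p ^+ 2) (r * b * p).
  - exact: leq_trans (conf_ge7 conf).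
  - move=> d; have := H d; rewrite -negb_or negbK -mulf_eq0 => /eqP E; rewrite -[RHS]E; ring.
  have p0 : p = 0.
    move/eqP: A3; rewrite oppr_eq0 !mulf_eq0 (negPf two0) (negPf a0) /= orbb.
    by move/eqP.
  split=> //; move/eqP: A1; rewrite p0 expr0n mulr0 subr0 oppr_eq0 expf_eq0 /=.
  by move/eqP.
have D0 : b - a * d ^+ 2 != 0.
  rewrite subr_eq0; apply/eqP => bE; have [] := @aniso d 1; first by rewrite expr1n mulr1.
  by move=> _ /eqP; rewrite oner_eq0.
(* These solve [tdir (s + c1) (t + c2) d 1 = d *: g1 + g2], so chords of direction [(d, 1)] with
   parameter midpoint [(s + c1, t + c2)] are parallel to [l]. *)
pose c1 := (2%:R * b * p - d * r) / (2%:R * (b - a * d ^+ 2)).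
pose c2 := (r - 2%:R * a * d * p) / (2%:R * (b - a * d ^+ 2)).
have c20 : c2 != 0 by rewrite mulf_neq0 // invr_eq0 mulf_neq0.
have lam0 : c1 - c2 * d != 0.
  have -> : c1 - c2 * d = (b * p - d * r + a * d ^+ 2 * p) / (b - a * d ^+ 2).
    by rewrite /c1 /c2; field; rewrite ?D0 ?two0.
  by rewrite mulf_neq0 // invr_eq0.
have pE : p = c1 + c2 * d by rewrite /c1 /c2; field; rewrite ?D0 ?two0.
have rE : r = 2%:R * (a * c1 * d + b * c2) by rewrite /c1 /c2; field; rewrite ?D0 ?two0.
move: (c1) (c2) c20 lam0 pE rE => u v v0 lam0 pE rE {c1 c2 d1 d2}.
(* The half-length of the second chord is taken to be [v], which brings one of its ends to
   [(s + lam, t)]; the chord of direction [(1, 0)] with midpoint [(s, t)] from this same end stops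
   at [(s - lam, t)]. *)
pose lam := u - v * d.
case: (@spread_triple l (s + lam) t (s - lam) t (s + u + v * d) (t + 2%:R * v)) => //.
- apply: contraNneq lam0 => /pt_inj[/addrI/eqP + _].
  by rewrite -subr_eq0 opprK -mulr2n -mulr_natl mulf_eq0 (negPf two0).
- apply: contraNneq v0 => /pt_inj[_ /eqP].
  by rewrite -[X in X == _]addr0 (inj_eq (addrI _)) eq_sym mulf_eq0 (negPf two0).
- apply: contraNneq v0 => /pt_inj[_ /eqP].
  by rewrite -[X in X == _]addr0 (inj_eq (addrI _)) eq_sym mulf_eq0 (negPf two0).
- have -> : pt (s - lam) t - pt (s + lam) t = (- 2%:R * lam) *: g1.
    by rewrite g1E; apply/rowP => i; rewrite !mxE; ring.
  by rewrite memvZ.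
have -> : pt (s + u + v * d) (t + 2%:R * v) - pt (s + lam) t = (2%:R * v) *: (d *: g1 + g2).
  by rewrite g1E g2E pE rE /lam; apply/rowP => i; rewrite !mxE; ring.
by rewrite memvZ // memvD // memvZ.
Qed.

Lemma spread_axis : axis \in S'.
Proof.
apply: contraT => aS.
have K0 x1 x2 x3 x4 : (x1 != 0) || (x2 != 0) -> K 0 x1 x2 x3 x4 != 0.
  by apply: contraTneq => /(basis.2)[_ -> -> _ _]; rewrite eqxx.
have e3a : K 0 0 0 1 0 \in axis by apply/axisP; exists 1, 0.
have e30 : K 0 0 0 1 0 != 0.
  by apply/eqP => /(basis.2)[_ _ _ /eqP]; rewrite oner_eq0.
have [l lS e3l] := spread_cover e30 (phi_comb _ _ _ _ _); have [dl lk] := spread_line lS.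
have [g gl ga] : exists2 g, g \in l & g \notin axis.
  apply/subvPn; apply: contraNN aS => la.
  by have /eqP <- : l == axis by rewrite eqEdim la dl dim_axis.
have [x1 [x2 [y [z gE]]]] := (lkerP g).1 (subvP lk g gl).
have x12 : (x1 != 0) || (x2 != 0).
  rewrite -negb_and; apply: contraNN ga => /andP[/eqP x10 /eqP x20].
  by rewrite gE x10 x20; apply/axisP; exists y, z.
have foot k : exists st : F * F, tdir st.1 st.2 x1 x2 = K 0 x1 x2 (y + k) z /\
    tline st.1 st.2 \notin S'.
  have [s [t tE]] := @bilinear_solve x1 x2 (y + k) z x12; exists (s, t); split=> //=.
  apply/negP => tS; have kl : K 0 x1 x2 (y + k) z \in l.
    have -> : K 0 x1 x2 (y + k) z = g + k *: K 0 0 0 1 0.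
      by rewrite gE; apply/rowP => i; rewrite !mxE; ring.
    by rewrite memvD // memvZ.
  have lt : l = tline s t.
    by apply: (spread_eq lS tS (K0 _ _ _ _ x12) kl); apply/tlineP; exists x1, x2.
  move: e3l; rewrite lt => /tlineP[d [e /(comb_inj basis)[_ d0 e0 E3 _]]].
  by move: E3; rewrite -d0 -e0 !mulr0 addr0 => /eqP; rewrite oner_eq0.
have [[s0 t0] /= [E0 N0]] := foot 0; have [[s1 t1] /= [E1 N1]] := foot 1.
pose d := s1 - s0; pose e := t1 - t0.
have de : (d != 0) || (e != 0).
  rewrite -negb_and !subr_eq0; apply/negP => /andP[/eqP sE /eqP tE].
  move: E1; rewrite sE tE E0 => /(comb_inj basis)[_ _ _ /addrI/eqP].
  by rewrite eq_sym oner_eq0.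
(* If the spread line through [tdir s t d e] missed [axis], it would be a [tline] by [spread_graph],
   and by [tdir_inj] that of [(s, t)] itself. *)
have onaxis s t : tline s t \notin S' -> exists m u,
    [/\ m \in S', tdir s t d e \in m, u != 0, u \in m & u \in axis].
  move=> NS; have v0 : tdir s t d e != 0 by apply: K0.
  have [m mS vm] := spread_cover v0 (phi_tdir s t d e).
  have ma : (m :&: axis)%VS != 0%VS.
    apply: contraNneq NS => /(spread_graph mS)[s' [t' mE]].
    move: (vm); rewrite mE => /tlineP[d' [e' E]].
    have [_ dd ee _ _] := comb_inj basis E; rewrite -dd -ee in E.
    by have [-> ->] := tdir_inj de E; rewrite -mE.
  exists m, (vpick (m :&: axis)%VS); split=> //; first by rewrite vpick0.
    by have /memv_capP[] := memv_pick (m :&: axis).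
  by have /memv_capP[] := memv_pick (m :&: axis).
have [m0 [u0 [m0S v0m u00 u0m /axisP[a0 [b0 u0E]]]]] := onaxis s0 t0 N0.
have [m1 [u1 [m1S v1m u10 u1m /axisP[a1 [b1 u1E]]]]] := onaxis s1 t1 N1.
(* The two tangent directions differ by [2%:R *: quad d e], which is in [axis]. Hence [m0] and [m1]
   lie in one plane, spanned by [axis] and either direction; they meet, so the spread makes them
   equal. *)
have m01 : m0 = m1.
  have [det | det] := eqVneq (a0 * b1 - a1 * b0) 0.
    suff [k u1k] : exists k, u1 = k *: u0 by apply: (spread_eq m0S m1S u10 _ u1m); rewrite u1k memvZ.
    have [a00 | a00] := eqVneq a0 0.
      have b00 : b0 != 0.
        apply: contraNneq u00 => b00; rewrite u0E a00 b00.
        by apply/eqP/rowP => i; rewrite !mxE; ring.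
      have a10 : a1 = 0.
        by move/eqP: det; rewrite a00 mul0r sub0r oppr_eq0 mulf_eq0 (negPf b00) orbF => /eqP.
      exists (b1 / b0); rewrite u1E u0E a00 a10; apply/rowP => i; rewrite !mxE; by field.
    exists (a1 / a0); have b1E : b1 = a1 * b0 / a0.
      have -> : a1 * b0 = a0 * b1 by rewrite -[RHS](subrK (a1 * b0)) det add0r.
      by rewrite [a0 * b1]mulrC mulfK.
    rewrite u1E u0E b1E; apply/rowP => i; rewrite !mxE; by field.
  (* A common point of the two lines is found by Cramer's rule: [x *: u0 - x' *: u1] must be
     [2%:R *: quad d e]. *)
  pose q1 := 2%:R * (d * e); pose q2 := 2%:R * (a * d ^+ 2 + b * e ^+ 2).
  pose x := (q1 * b1 - q2 * a1) / (a0 * b1 - a1 * b0).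
  pose x' := (q1 * b0 - q2 * a0) / (a0 * b1 - a1 * b0).
  have E : tdir s0 t0 d e + x *: u0 = tdir s1 t1 d e + x' *: u1.
    have -> : tdir s1 t1 d e = tdir s0 t0 d e + 2%:R *: quad d e.
      by rewrite /d /e; apply/rowP => i; rewrite !mxE; ring.
    rewrite -[RHS]addrA; apply: (congr1 (fun w => tdir s0 t0 d e + w)); rewrite u0E u1E.
    have xE3 : x * a0 = q1 + x' * a1 by rewrite /x /x'; field.
    have xE4 : x * b0 = q2 + x' * b1 by rewrite /x /x'; field.
    transitivity (K 0 0 0 (x * a0) (x * b0)); first by apply/rowP => i; rewrite !mxE; ring.
    by rewrite xE3 xE4 /q1 /q2; apply/rowP => i; rewrite !mxE; ring.
  apply: (@spread_eq m0 m1 (tdir s0 t0 d e + x *: u0)) => //.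
  - have -> : tdir s0 t0 d e + x *: u0 = K 0 d e (s0 * e + t0 * d + x * a0)
        (2%:R * (a * s0 * d + b * t0 * e) + x * b0).
      by rewrite u0E; apply/rowP => i; rewrite !mxE; ring.
    exact: K0.
  - by rewrite memvD // memvZ.
  - by rewrite E memvD // memvZ.
(* The common line contains the difference of the two tangent directions, hence [quad d e]. *)
have := spread_quad_notin m0S de v0m.
have -> : quad d e = 2%:R^-1 *: (tdir s1 t1 d e - tdir s0 t0 d e).
  by rewrite /d /e; apply/rowP => i; rewrite !mxE; field.
by rewrite memvZ // memvB // m01.
Qed.

(** By disjointness a line of [S'] other than [axis] misses [axis], so it is a [tline]. Conversely
    the line of [S'] through [tdir s t 1 0] is a [tline], and by [tdir_inj] it is that of
    [(s, t)]. *)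
Lemma spread_eq_C_spread : [set points_of l | l in S'] = C_spread (lker phi) C0 B.
Proof.
have graph l : l \in S' -> l != axis -> exists s t, l = tline s t.
  move=> lS la; apply: spread_graph => //; apply/eqP; apply: contraNT la => la0.
  have [ul ua] := memv_capP (memv_pick (l :&: axis)).
  by apply/eqP/(spread_eq lS spread_axis _ ul ua); rewrite vpick0.
have tS s t : tline s t \in S'.
  have v0 : tdir s t 1 0 != 0 by apply/eqP => /tdir_eq0[/eqP]; rewrite oner_eq0.
  have [l lS vl] := spread_cover v0 (phi_tdir _ _ _ _).
  have [|s' [t' lE]] := graph l lS.
    apply: contraTneq vl => ->; apply/negP => /axisP[x [y /(comb_inj basis)[_ /eqP]]].
    by rewrite oner_eq0.
  move: (vl); rewrite lE => /tlineP[d [e E]].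
  have [_ dd ee _ _] := comb_inj basis E; rewrite -dd -ee in E.
  have de : ((1 : F) != 0) || ((0 : F) != 0) by rewrite oner_neq0.
  by have [-> ->] := tdir_inj de E; rewrite -lE.
apply/setP => Y; apply/imsetP/setU1P => [[l lS ->] | [-> | /imsetP[X /C0P[s [t ->]] ->]]].
- have [-> | /(graph l lS)[s [t ->]]] := eqVneq l axis; first by left; rewrite t_inftyE.
  right; apply/imsetP; exists <[pt s t]>%VS; last by rewrite t_atE.
  by apply/C0P; exists s, t.
- by exists axis; rewrite ?t_inftyE ?spread_axis.
by exists (tline s t); rewrite ?t_atE.
Qed.

End Spread.

End Model.

Lemma hyperplane_form (F : finFieldType) (Sigma : subspace F) :
  is_hyperplane Sigma -> exists phi : 'Hom('rV[F]_5, F^o), lker phi = Sigma.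
Proof.
move=> /eqP d4; have : ~~ (fullv <= Sigma)%VS.
  by apply/negP => /dimvS; rewrite d4 dimvf dim_matrix.
case/subvPn => v _ vS; have [f [f0 f1]] := separating_form vS.
have fullE : (Sigma + <[v]>)%VS = fullv.
  by apply/eqP; rewrite eqEdim subvf dim_add_line // d4 dimvf dim_matrix.
exists f; apply/eqP; rewrite eqEsubv; apply/andP; split; apply/subvP => u; last first.
  by move=> /f0 fu; rewrite memv_ker fu.
have : u \in (Sigma + <[v]>)%VS by rewrite fullE memvf.
move=> /memv_addP[s sS [w /vlineP[k ->] ->]]; rewrite memv_ker linearD linearZ /= f0 // f1 add0r.
by rewrite -[_ *: 1]/(_ * 1) mulr1 => /eqP ->; rewrite scale0r addr0.
Qed.

(** * From the projective axioms to normalised vectors *)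

Section AffineVectors.

Variables (F : finFieldType) (phi : 'Hom('rV[F]_5, F^o)) (C CP : {set subspace F}).
Hypotheses (q_odd : odd #|F|) (q_ge7 : (7 <= #|F|)%N).
Hypotheses (C_affine : C \subset affine_points (lker phi)) (C_card : #|C| = (#|F| ^ 2)%N).
Hypothesis CP_affine : CP \subset affine_planes (lker phi).
Hypothesis A1_arc : forall p : subspace F, p \in CP -> is_plane_arc #|F| p (plane_section C p).
Hypothesis A2 : forall P Q : subspace F, P \in C -> Q \in C -> P != Q ->
  exists! p : subspace F, [/\ p \in CP, (P <= p)%VS & (Q <= p)%VS].
Hypothesis A3 : forall P : subspace F, P \in affine_points (lker phi) ->
  [\/ P \in C, #|[set p in CP | (P <= p)%VS]| = 0%N | #|[set p in CP | (P <= p)%VS]| = 2%N].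

Local Notation W := 'rV[F]_5.

(** Each affine point has exactly one representative with [phi v = 1], so this set is in bijection
    with [C]. *)
Definition affine_vectors : {set W} := [set v | (phi v == 1) && (<[v]>%VS \in C)].

Lemma affine_vectorsE v : v \in affine_vectors <-> phi v = 1 /\ <[v]>%VS \in C.
Proof. by rewrite inE; split=> [/andP[/eqP] | [-> ->]]; rewrite ?eqxx. Qed.

Lemma affine_vector_inj v w : phi v = 1 -> phi w = 1 -> <[v]>%VS = <[w]>%VS -> v = w.
Proof.
move=> pv pw E; have : v \in <[w]>%VS by rewrite -E memv_line.
move=> /vlineP[k kE]; move: pv; rewrite kE linearZ /= pw -[_ *: 1]/(_ * 1) mulr1 => ->.
by rewrite scale1r.
Qed.

Lemma affine_vector_of X : X \in C -> exists2 v, v \in affine_vectors & X = <[v]>%VS.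
Proof.
move=> XC; have := subsetP C_affine X XC; rewrite inE => /andP[/is_pointP[v v0 XE]].
rewrite /affine XE -memvE memv_ker => pv.
have kv : (phi v)^-1 != 0 by rewrite invr_eq0.
exists ((phi v)^-1 *: v); last by rewrite line_scale.
by apply/affine_vectorsE; rewrite aff_scale // line_scale // -XE.
Qed.

Lemma card_affine_section (U : subspace F) :
  #|[set v in affine_vectors | v \in U]| = #|plane_section C U|.
Proof.
rewrite -(card_in_imset (f := fun v : W => <[v]>%VS)); last first.
  move=> v w /setIdP[/affine_vectorsE[pv _] _] /setIdP[/affine_vectorsE[pw _] _].
  exact: affine_vector_inj.
apply: eq_card => X; apply/imsetP/setIP => [[v /setIdP[/affine_vectorsE[pv vC] vU] ->] | [XU XC]].
  by split=> //; apply/points_ofP; exists v; rewrite (aff_neq0 pv).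
have [v vC XE] := affine_vector_of XC; exists v => //; apply/setIdP; split=> //.
by move: XU; rewrite inE XE -memvE => /andP[].
Qed.

Lemma affine_configuration : configuration phi affine_vectors CP.
Proof.
have dimP p : p \in CP -> \dim p = 3%N.
  by move=> /(subsetP CP_affine); rewrite inE => /andP[/eqP].
have affpt v : phi v = 1 -> <[v]>%VS \in affine_points (lker phi).
  move=> pv; rewrite inE /affine -memvE memv_ker pv oner_neq0 andbT.
  by apply/is_pointP; exists v; rewrite ?(aff_neq0 pv).
split=> //.
- by move=> v /affine_vectorsE[].
- have := card_affine_section fullv.
  have -> : [set v in affine_vectors | v \in fullv] = affine_vectors.
    by apply/setP => v; rewrite in_set memvf andbT.
  suff -> : plane_section C fullv = C by rewrite C_card.
  apply/setIidPr/subsetP => X XC; have [v /affine_vectorsE[pv _] ->] := affine_vector_of XC.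
  by apply/points_ofP; exists v; rewrite (aff_neq0 pv) memvf.
- by move=> p pB; rewrite card_affine_section; have [] := A1_arc pB.
- move=> p a b c pB aC bC cC ap bp cp ab ca cb; apply/negP => cab.
  have [/affine_vectorsE[pa aC'] /affine_vectorsE[pb bC'] /affine_vectorsE[pc cC']] := And3 aC bC cC.
  have [_ _ arc] := A1_arc pB.
  have inj v w : phi v = 1 -> phi w = 1 -> v != w -> <[v]>%VS != <[w]>%VS.
    by move=> pv pw; apply: contraNneq => /(affine_vector_inj pv pw) ->.
  pose X : {set subspace F} := <[a]>%VS |: [set <[b]>%VS; <[c]>%VS].
  have sec v : v \in p -> phi v = 1 -> <[v]>%VS \in C -> <[v]>%VS \in plane_section C p.
    by move=> vp pv vC; rewrite in_setI vC andbT; apply/points_ofP; exists v; rewrite (aff_neq0 pv).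
  have Xs : X \subset plane_section C p.
    by apply/subsetP => x; rewrite in_setU1 in_set2 => /or3P[] /eqP ->; apply: sec.
  have X3 : #|X| = 3%N.
    have bc : b != c by rewrite eq_sym.
    have ac : a != c by rewrite eq_sym.
    by rewrite cardsU1 cards2 in_set2 negb_or !inj.
  have lL : points_of (<[a]> + <[b]>)%VS \in pg_lines F.
    apply/imsetP; exists (<[a]> + <[b]>)%VS => //; rewrite inE /is_line.
    by rewrite dim_add_line ?dim_vline ?(aff_neq0 pa) // (aff_notin_line pa pb ab).
  have /negP := arc X Xs X3 _ lL; apply; apply/subsetP => x.
  have mem v : phi v = 1 -> v \in (<[a]> + <[b]>)%VS -> <[v]>%VS \in points_of (<[a]> + <[b]>)%VS.
    by move=> pv vl; apply/points_ofP; exists v; rewrite (aff_neq0 pv).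
  rewrite in_setU1 in_set2 => /or3P[] /eqP ->; apply: mem => //.
    by apply: (subvP (addvSl _ _)); apply: memv_line.
  by apply: (subvP (addvSr _ _)); apply: memv_line.
- move=> a b /affine_vectorsE[pa aC] /affine_vectorsE[pb bC] ab.
  have ab' : <[a]>%VS != <[b]>%VS.
    by apply: contraNneq ab => /(affine_vector_inj pa pb) ->.
  have [p [[pB ap bp] _]] := A2 aC bC ab'; exists p => //.
  by rewrite !memvE ap bp.
- move=> p r a b pB rB /affine_vectorsE[pa aC] /affine_vectorsE[pb bC] ab ap bp ar br.
  have ab' : <[a]>%VS != <[b]>%VS.
    by apply: contraNneq ab => /(affine_vector_inj pa pb) ->.
  rewrite !memvE in ap bp ar br.
  have [s [_ sU]] := A2 aC bC ab'.
  by rewrite -(sU p) // -(sU r).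
- move=> v p1 p2 p3 pv vC p1B p2B p3B v1 v2 v3.
  have inS p : p \in CP -> v \in p -> p \in [set p in CP | (<[v]> <= p)%VS].
    by move=> pB vp; rewrite inE pB -memvE.
  case: (A3 (affpt v pv)) => [vC' | c0 | c2].
  + by case/negP: vC; apply/affine_vectorsE.
  + by have := inS p1 p1B v1; move/eqP: c0; rewrite cards_eq0 => /eqP ->; rewrite inE.
  have [-> | n12] := eqVneq p1 p2; first by constructor 1.
  have [-> | n13] := eqVneq p1 p3; first by constructor 2.
  have [-> | n23] := eqVneq p2 p3; first by constructor 3.
  have : (2 < #|[set p in CP | (<[v]> <= p)%VS]|)%N.
    by apply/card_gt2P; exists p1, p2, p3; rewrite !inS // n12 n23 eq_sym n13.
  by rewrite c2.
move=> v p pv vC pB vp.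
have pS : p \in [set p in CP | (<[v]> <= p)%VS] by rewrite inE pB -memvE.
case: (A3 (affpt v pv)) => [vC' | c0 | c2].
- by case/negP: vC; apply/affine_vectorsE.
- by move: pS; move/eqP: c0; rewrite cards_eq0 => /eqP ->; rewrite inE.
have /card_gt0P[r] : (0 < #|[set p in CP | (<[v]> <= p)%VS] :\ p|)%N.
  by rewrite lt0n; apply: contra_eq_neq c2 => z; rewrite (cardsD1 p) pS z.
by rewrite !inE -memvE => /and3P[rp rB vr]; exists r; rewrite // rp.
Qed.

End AffineVectors.

Theorem theorem3p26 (q : nat) (F : finFieldType) (cardF : #|F| = q)
    (q_odd : odd q) (q_ge7 : (7 <= q)%N)
    (Sigma : subspace F) (Sigma_hyp : is_hyperplane Sigma)
    (C CP : {set subspace F})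
    (C_affine : C \subset affine_points Sigma) (C_card : #|C| = (q ^ 2)%N)
    (CP_affine : CP \subset affine_planes Sigma)
    (A1_arc : forall p : subspace F, p \in CP ->
       is_plane_arc q p (plane_section C p))
    (A1_max : forall p : subspace F,
       is_plane p -> (4 < #|plane_section C p|)%N -> p \in CP)
    (A2 : forall P Q : subspace F, P \in C -> Q \in C -> P != Q ->
       exists! p : subspace F, [/\ p \in CP, (P <= p)%VS & (Q <= p)%VS])
    (A3 : forall P : subspace F, P \in affine_points Sigma ->
       [\/ P \in C,
           #|[set p in CP | (P <= p)%VS]| = 0%N
         | #|[set p in CP | (P <= p)%VS]| = 2%N])
    (S' : {set subspace F}) (S'_spread : is_spread Sigma S')
    (S'_neq : [set points_of l | l in S'] <> C_spread Sigma C CP) :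
  ~ is_arc (bb_lines Sigma S') (bb_image C).
Proof.
subst q; have [phi phiE] := hyperplane_form Sigma_hyp; subst Sigma => arc.
have conf := affine_configuration q_odd q_ge7 C_affine C_card CP_affine A1_arc A2 A3.
have [O [e1 [e2 [e3 [n [a [b [basis phiO aniso CP_pt lines]]]]]]]] := normal_form conf.
(* The arc property would force the lines of [S'], as point sets, to be those of the spread of
   [C]. *)
exact: S'_neq (spread_eq_C_spread conf (affine_vectorsE phi C) C_affine basis phiO aniso CP_pt lines
  S'_spread arc).
Qed.
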